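(* Let $c\in(1,9/8)$ be fixed. Then for every $\phi\in C^\infty(\mathbb R^3)$ we have \[ \frac1{r_c(\lambda)}\sum_{x\in\mathbf P_c^3(\lambda)}\phi(x)\xrightarrow[\lambda\to\infty]{}\int_{\mathbb S_c^2}\phi(x)\,d\nu_c(x), \] where $\lambda$ runs through positive integers and $\nu_c$ is the probability measure on $\mathbb S_c^2$ given by \[ \nu_c:=\frac{\mu_c}{\mu_c(\mathbb S_c^2)},\qquad\text{where}\qquad \mu_c(\mathbb S_c^2)=\frac{8\,\Gamma(1/c)^3}{c^2\,\Gamma(3/c)}. \]
   Context: For $x\in\mathbb R^3$, $|x|_c:=(|x_1|^c+|x_2|^c+|x_3|^c)^{1/c}$, and $\mathbb S_c^2:=\{x\in\mathbb R^3:|x|_c=1\}$. $\mu_c$ denotes the unique Borel measure on $\mathbb S_c^2$ such that for every $f\ge0$ measurable or $f\in L^1(\mathbb R^3)$, \[ \int_{\mathbb R^3}f(x)\,dx=\int_0^\infty r^2\int_{\mathbb S_c^2}f(ry)\,d\mu_c(y)\,dr. \] For a positive integer $\lambda$, \[ \mathbf S_c^3(\lambda):=\{x\in\mathbb Z^3:\lfloor|x_1|^c\rfloor+\lfloor|x_2|^c\rfloor+\lfloor|x_3|^c\rfloor=\lambda\},\quad r_c(\lambda):=\#\mathbf S_c^3(\lambda),\quad \mathbf P_c^3(\lambda):=\{\lambda^{-1/c}x:x\in\mathbf S_c^3(\lambda)\}. \] (For all sufficiently large $\lambda$ one has $r_c(\lambda)>0$.) $\Gamma$ is the Gamma function. 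*)

(* Defs.v *)
From HB Require Import structures.
From mathcomp Require Import all_boot all_order all_algebra finmap.
From mathcomp Require Import zify.
From mathcomp Require Import all_classical all_reals all_analysis.
From mathcomp Require Import measurable_realfun.

Set Implicit Arguments.
Unset Strict Implicit.
Unset Printing Implicit Defensive.

Import Order.TTheory GRing.Theory Num.Theory.
Import numFieldNormedType.Exports.

Local Open Scope classical_set_scope.
Local Open Scope ring_scope.

(* Points of the three-dimensional space are nested pairs [((x1, x2), x3)].
   [R * R * R] carries the normed space structure; [space3 R] is the same type
   seen as the product of three copies of the measurable space on which
   [lebesgue_measure] lives, i.e., with the Borel sigma-algebra. *)
Notation space3 R :=
  (measurableTypeR R * measurableTypeR R * measurableTypeR R)%type.

Section defs.
Variable R : realType.
Local Notation R3 := (R * R * R)%type.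

Definition lebesgue3 : {measure set (space3 R) -> \bar R} :=
  ((@lebesgue_measure R \x @lebesgue_measure R) \x @lebesgue_measure R)%E.

Definition Gamma (s : R) : R :=
  \int[@lebesgue_measure R]_(t in `]0%R, +oo[) (t `^ (s - 1) * expR (- t)).

Definition cnorm (c : R) (x : R3) : R :=
  (`|x.1.1| `^ c + `|x.1.2| `^ c + `|x.2| `^ c) `^ c^-1.

Definition csphere (c : R) : set (space3 R) := [set x | cnorm c x = 1].

(* Borel measures on the sphere are represented by the Borel measures on the
   whole space that vanish off the sphere.  When [f] is integrable, the inner
   integral is only meaningful for almost every [r]; the values that the
   library assigns to it on the remaining null set are immaterial. *)
Definition is_csphere_measure (c : R) (mu : {measure set (space3 R) -> \bar R}) :
    Prop :=
  mu (~` csphere c) = 0%E /\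
  forall f : space3 R -> \bar R,
    (measurable_fun setT f /\
      (forall x, 0 <= f x)%E) \/
      lebesgue3.-integrable setT f ->
    (\int[lebesgue3]_x f x =
     \int[@lebesgue_measure R]_(r in `]0%R, +oo[)
       ((r ^+ 2)%:E * \int[mu]_(y in csphere c) f (r *: (y : R3))))%E.

Lemma inv_mass_ge0 (c : R) (mu : {measure set (space3 R) -> \bar R}) :
  0 <= (fine (mu (csphere c)))^-1.
Proof. by rewrite invr_ge0 fine_ge0. Qed.

Definition csphere_normalized (c : R) (mu : {measure set (space3 R) -> \bar R}) :
    {measure set (space3 R) -> \bar R} :=
  mscale (NngNum (inv_mass_ge0 c mu)) mu.

Definition lattice_csphere (c : R) (l : nat) : set (int * int * int) :=
  [set x | Num.floor (`|x.1.1%:~R : R| `^ c) + Num.floor (`|x.1.2%:~R : R| `^ c)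
           + Num.floor (`|x.2%:~R : R| `^ c) = l%:Z].

Lemma finite_lattice_csphere (c : R) (l : nat) :
  1 <= c -> finite_set (lattice_csphere c l).
Proof.
move=> c1.
pose I := [set n : int | `|n| <= l.+1%:Z].
have fI : finite_set I.
  apply: (@sub_finite_set _ _ ((fun k : nat => k%:Z - l.+1%:Z) @` `I_(l.+1 + l.+2)));
    last exact/finite_image/finite_II.
  move=> n; rewrite /I /= ler_norml => /andP[h1 h2].
  exists (absz (n + l.+1%:Z)%R); lia.
apply: (@sub_finite_set _ _ (I `*` I `*` I)); last by do 2 ?apply: finite_setX.
have f0 (n : int) : 0 <= Num.floor (`|n%:~R : R| `^ c) by rewrite floor_ge0 powR_ge0.
have fn (n : int) : Num.floor (`|n%:~R : R| `^ c) <= l%:Z -> `|n| <= l.+1%:Z.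
  move=> h; have [->//|n0] := eqVneq n 0.
  have n1 : 1 <= `|n%:~R : R| by rewrite -intr_norm ler1z; lia.
  suff : `|n| <= Num.floor (`|n%:~R : R| `^ c) by lia.
  rewrite floor_ge_int intr_norm -{1}(powRr1 (normr_ge0 (n%:~R : R))).
  exact: ler_powR.
move=> x /= hx; move: (f0 x.1.1) (f0 x.1.2) (f0 x.2) => a1 a2 a3.
move: hx; rewrite /lattice_csphere /= => hx.
by split; [split|]; apply: fn; lia.
Qed.

Definition rcount (c : R) (l : nat) : nat := #|` fset_set (lattice_csphere c l)|.

Definition rescaled_csphere (c : R) (l : nat) : set R3 :=
  [set (l%:R `^ (- c^-1)) *: ((x.1.1%:~R, x.1.2%:~R, x.2%:~R) : R3)
    | x in lattice_csphere c l].

Definition basis3 : seq R3 := [:: (1, 0, 0); (0, 1, 0); (0, 0, 1)].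

Fixpoint is_Ck (k : nat) (f : R3 -> R) : Prop :=
  continuous f /\
  if k is k'.+1 then
    forall e, e \in basis3 ->
      (forall x, derivable f x e) /\ is_Ck k' (fun x => 'D_e f x)
  else True.

Definition smooth (f : R3 -> R) : Prop := forall k, is_Ck k f.

End defs.

(* Main.v *)
Require Import Defs.
From HB Require Import structures.
From mathcomp Require Import all_boot all_order all_algebra finmap.
From mathcomp Require Import all_classical all_reals all_analysis.
From mathcomp Require Import measurable_realfun.
From mathcomp Require Import zify ring lra.

Set Implicit Arguments.
Unset Strict Implicit.
Unset Printing Implicit Defensive.

Import Order.TTheory GRing.Theory Num.Theory.
Import numFieldNormedType.Exports.

Local Open Scope classical_set_scope.
Local Open Scope ring_scope.


(** The lattice sphere of index [l] has about [l ^ (3 * g - 1)] points, where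
    [g = 1 / c]: it is too thin for its points to be compared directly with a
    volume.  The union of the spheres of indices between [l] and [l + d * l] is
    not.  It consists of the lattice points of a solid shell, and the rescaled
    sums of a continuous function over it converge to the integral over the
    shell by dominated convergence ([shell_sum_cvg]).  The heart of the proof
    is that a single sphere already behaves like the average over such a
    shell: [stable_continuous] says that, at a common scale, the sums over
    spheres of neighbouring indices nearly agree.

    To see this, let the first two coordinates run through a box of side
    [d * l ^ g].  They extend to a lattice point with positive third
    coordinate if and only if the remaining value [N], namely [l] minus the
    two floors, is itself the floor of some [m ^ c], i.e., if and only if there
    is an integer in the short interval from [N ^ g] to [(N + 1) ^ g].  If the
    numbers [N ^ g] are well distributed modulo [1], this happens for a
    proportion of about [g * N ^ (g - 1)] of the pairs ([box_count]); as [N]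
    hardly varies with the pair and with [l], the count is the same for
    neighbouring values of [l] ([box_stability]).  The distribution modulo [1]
    is tested with the square of the Fejer kernel ([arc_count]), which leaves
    exponential sums with phases [h * N ^ g] over the pairs of the box.
    Since [N] is a sum of one term for each coordinate, Cauchy's inequality
    completes one of the two variables to a full interval ([bilinear_cos]), and
    the Kusmin-Landau inequality bounds the complete sums ([sum_cos_gap]).  The
    saving beats the shortness of the interval because [5 * g > 4].  A
    partition of unity and the symmetries of the sphere reduce the general
    test function to one that is supported where the third coordinate is
    large.

    For the limit, subtract from the test function its mean over the sphere.
    In polar coordinates the integral of the difference over a shell of
    thickness [d] is then [o(d)] ([shell_mean]), whereas the volume of the
    shell is of order [d] ([shell_volume]).  Hence the sums of the difference
    over the lattice spheres are negligible with respect to the numbers of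
    points.  The mass of the sphere comes out by integrating
    [expR (- gauge c x)] in Cartesian and in polar coordinates
    ([sphere_mass]). *)

(** * The Kusmin-Landau inequality *)

Section trigonometry.
Context {R : realType}.
Implicit Types x y : R.

Lemma sin_le_id x : 0 <= x -> sin x <= x.
Proof.
rewrite le_eqVlt => /predU1P[<-|x0]; first by rewrite sin0.
have [|xi _] := @MVT R sin cos 0 x x0 (fun u _ => is_derive_sin u).
  by apply: continuous_subspaceT => ?; exact: continuous_sin.
by rewrite sin0 !subr0 => ->; rewrite ger_pMl ?cos_le1.
Qed.

Lemma cos_ge_quadratic x : 0 <= x -> x <= 1 -> 1 - x ^+ 2 / 2 <= cos x.
Proof.
move=> x0 x1.
rewrite [in leRHS](_ : x = (x / 2) *+ 2); last by rewrite -mulr_natr divfK.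
rewrite cos_mulr2n cos2sin2 (mulr2n (1 - _)).
have s0 : 0 <= sin (x / 2).
  by apply: sin_ge0_pi; have := @pi_ge2 R => ?; apply/andP; split; lra.
have sx : sin (x / 2) <= x / 2 by apply: sin_le_id; lra.
have : sin (x / 2) ^+ 2 <= (x / 2) ^+ 2 by rewrite lerXn2r ?nnegrE//; lra.
by rewrite !expr2; lra.
Qed.

Lemma sin_ge_half x : 0 <= x -> x <= 1 -> x / 2 <= sin x.
Proof.
rewrite le_eqVlt => /predU1P[<-|x0 x1]; first by rewrite mul0r sin0.
have [|xi] := @MVT R sin cos 0 x x0 (fun u _ => is_derive_sin u).
  by apply: continuous_subspaceT => ?; exact: continuous_sin.
rewrite in_itv/= => /andP[xi0 xi1]; rewrite sin0 !subr0 => ->.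
rewrite mulrC ler_pM2r//.
have xi2 : xi ^+ 2 <= 1 by rewrite expr_le1//; lra.
by apply: le_trans (cos_ge_quadratic _ _); lra.
Qed.

Lemma sin_pi_ge x : 0 <= x -> x <= 3 / 4 -> x / 3 <= sin (pi * x).
Proof.
move=> x0 x1; have p2 := @pi_ge2 R; have p4 := @pihalf_lt2 R.
have [x4|x4] := leP x (1 / 4).
  have := @sin_ge_half (pi * x); rewrite mulr_ge0 ?pi_ge0// => /(_ isT) h.
  by apply: le_trans (h _); nra.
have q4 : 1 / 4 <= sin (pi / 4 : R).
  by apply: le_trans (sin_ge_half _ _); lra.
have mon y : 1 / 4 <= y -> y <= 1 / 2 -> 1 / 4 <= sin (pi * y).
  move=> y4 y2; apply: (le_trans q4); rewrite leNgt ltr_sin -?leNgt ?in_itv/=; nra.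
have [x2|x2] := leP x (1 / 2); first by apply: le_trans (mon _ _ _); lra.
have -> : sin (pi * x) = sin (pi * (1 - x)).
  by rewrite mulrBr mulr1 sinB sinpi cospi; lra.
by apply: le_trans (mon _ _ _); lra.
Qed.

Lemma norm_sin_pi_ge x : `|x| <= 3 / 4 -> `|x| / 3 <= `|sin (pi * x)|.
Proof.
move=> x1; apply: le_trans (sin_pi_ge _ x1) _ => //.
have [x0|x0] := leP 0 x; first by rewrite (ger0_norm x0) ler_norm.
by rewrite (ltr0_norm x0) mulrN sinN ler_normr lexx orbT.
Qed.

Lemma cos_natpi x k : cos (x + 2 * pi * k%:R) = cos x.
Proof.
rewrite -[RHS](periodicn (@cosD2pi R) k); congr (cos (_ + _)).
by rewrite -[RHS]mulr_natr -[pi *+ 2]mulr_natr; ring.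
Qed.

(** The half-angle cotangent is what converts [cos (f i)] into a difference
    of values of [sin] along the sequence [f]. *)
Definition hcot x := cos (x / 2) / sin (x / 2).

Lemma hcot_ge0 x : 0 < x -> x <= 2 -> 0 <= hcot x.
Proof.
have p2 := @pi_ge2 R => x0 x2; rewrite divr_ge0//.
  by apply: cos_ge0_pihalf; apply/andP; split; lra.
by apply: sin_ge0_pi; apply/andP; split; lra.
Qed.

Lemma hcot_anti x y : 0 < x -> x <= y -> y <= 2 -> hcot y <= hcot x.
Proof.
have p2 := @pi_ge2 R => x0 xy y2.
have c (u v : R) : 0 < u -> u <= v -> v <= 2 -> 0 <= cos (v / 2) <= cos (u / 2).
  move=> u0 uv v2; apply/andP; split.
    by apply: cos_ge0_pihalf; apply/andP; split; lra.
  by rewrite leNgt ltr_cos -?leNgt ?in_itv/=; lra.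
have s (u v : R) : 0 < u -> u <= v -> v <= 2 -> 0 < sin (u / 2) <= sin (v / 2).
  move=> u0 uv v2; apply/andP; split.
    by apply: sin_gt0_pi; apply/andP; split; lra.
  by rewrite leNgt ltr_sin -?leNgt ?in_itv/=; lra.
have /andP[cy cxy] := c _ _ x0 xy y2.
have /andP[sx sxy] := s _ _ x0 xy y2.
rewrite /hcot ler_pM// ?invr_ge0; last by rewrite lef_pV2 ?posrE//; lra.
lra.
Qed.

Lemma hcot_le x : 0 < x -> x <= 2 -> hcot x <= 4 / x.
Proof.
move=> x0 x2; rewrite /hcot.
have s : x / 2 / 2 <= sin (x / 2) by apply: sin_ge_half; lra.
have s0 : 0 < sin (x / 2) by apply: lt_le_trans s; lra.
rewrite ler_pdivrMr// (le_trans (cos_le1 _))// mulrAC ler_pdivlMr//; lra.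
Qed.

(** Abel summation: since the weights increase, their total variation is
    bounded by the last one. *)
Lemma abel_bound (b s : nat -> R) (m : nat) :
  (forall i, (i <= m)%N -> 0 <= b i) ->
  (forall i, (i < m)%N -> b i <= b i.+1) ->
  (forall i, `|s i| <= 1) ->
  `|\sum_(i < m.+1) b i * (s i.+1 - s i)| <= 2 * b m.
Proof.
move=> b0 bm s1.
suff h : `|b m * s m.+1 - \sum_(i < m.+1) b i * (s i.+1 - s i)| <= b m.
  have := s1 m.+1; have := b0 m (leqnn m); move: h.
  rewrite !ler_norml => /andP[? ?] ? /andP[? ?]; apply/andP; split; nra.
elim: m b0 bm => [|m IH] b0 bm.
  rewrite big_ord1 (_ : _ - _ = b 0 * s 0); last by ring.
  by rewrite normrM (ger0_norm (b0 0 isT)) ler_piMr ?b0.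
rewrite big_ord_recr/=.
rewrite (_ : _ - _ = b m * s m.+1 - (\sum_(i < m.+1) b i * (s i.+1 - s i)) +
    (b m.+1 - b m) * s m.+1); last by ring.
apply: (le_trans (ler_normD _ _)).
have bb : 0 <= b m.+1 - b m by rewrite subr_ge0 bm.
rewrite normrM (ger0_norm bb) -[leRHS](subrKC (b m)) lerD//.
  by apply: IH => i im; [apply: b0; rewrite ltnW|apply: bm; rewrite ltnW].
by rewrite ler_piMr.
Qed.

Lemma cos_hcot f d : sin (d / 2) != 0 ->
  cos f = hcot d / 2 * (sin (f + d) - sin f) + (cos f - cos (f + d)) / 2.
Proof.
move=> s0; rewrite /hcot.
have -> : f + d = f + (d / 2) *+ 2 by congr (_ + _); rewrite -mulr_natr divfK.
rewrite sinD cosD sin_mulr2n cos_mulr2n (mulr2n (cos (d / 2) * sin (d / 2))) (mulr2n (cos (d / 2) ^+ 2)).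
have := cos2Dsin2 (d / 2); move: (cos (d / 2)) (sin (d / 2)) s0 => C S s0 h.
have -> : cos f * (C * S + C * S) = S * (cos f * C * 2) by ring.
have {}h : C ^+ 2 = 1 - S ^+ 2 by rewrite -h; ring.
rewrite h.
have -> : sin f * (1 - S ^+ 2 + (1 - S ^+ 2) - 1) + S * (cos f * C * 2) - sin f =
  S * (2 * (cos f * C - sin f * S)) by ring.
have -> : C / S / 2 * (S * (2 * (cos f * C - sin f * S))) = C * (cos f * C - sin f * S).
  by field.
have -> : C * (cos f * C - sin f * S) = cos f * C ^+ 2 - sin f * (C * S) by ring.
by rewrite h; field.
Qed.

(** The Kusmin-Landau inequality: a sum of cosines whose phase increments
    decrease while staying inside [[dmin, 2]] is governed by the reciprocal of
    the smallest increment, because [cos (f i)] is, up to a telescoping term, the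
    increment of [sin \o f] weighted by a monotone cotangent. *)
Lemma kusmin_landau (f : nat -> R) (dmin : R) (m : nat) :
  0 < dmin ->
  (forall i, (i < m)%N -> dmin <= f i.+1 - f i <= 2) ->
  (forall i, (i.+1 < m)%N -> f i.+2 - f i.+1 <= f i.+1 - f i) ->
  `|\sum_(i < m) cos (f i)| <= 1 + 4 / dmin.
Proof.
move=> d0; have p2 := @pi_ge2 R; set d := fun i => f i.+1 - f i.
have D4 : 0 < 4 / dmin by rewrite divr_gt0.
case: m => [|m] fd fm; first by rewrite big_ord0 normr0; lra.
have dd i : (i <= m)%N -> dmin <= d i by move=> im; have /andP[] := fd i im.
have d2 i : (i <= m)%N -> d i <= 2 by move=> im; have /andP[] := fd i im.
have E (i : 'I_m.+1) : cos (f i) = hcot (d i) / 2 * (sin (f i.+1) - sin (f i)) +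
    (cos (f i) - cos (f i.+1)) / 2.
  have im : (i <= m)%N by rewrite -ltnS.
  rewrite {1}(@cos_hcot (f i) (d i)) /d ?subrKC//.
  have := dd i im; have := d2 i im; rewrite /d => *.
  by rewrite gt_eqF// sin_gt0_pi//; apply/andP; split; lra.
rewrite (eq_bigr _ (fun i _ => E i)) big_split/= -mulr_suml.
have -> : \sum_(i < m.+1) (cos (f i) - cos (f i.+1)) = cos (f 0) - cos (f m.+1).
  rewrite -(big_mkord predT (fun i => cos (f i) - cos (f i.+1))) -[RHS]opprB.
  rewrite -(telescope_sumr (fun i => cos (f i)) (leq0n m.+1)) -sumrN.
  by apply: eq_bigr => i _; rewrite opprB.
have := @abel_bound (fun i => hcot (d i) / 2) (fun i => sin (f i)) m.
move=> /(_ _ _ (fun i => sin_max (f i)))/=.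
have -> : 2 * (hcot (d m) / 2) = hcot (d m) by field.
move=> h.
have {}h : `|\sum_(i < m.+1) hcot (d i) / 2 * (sin (f i.+1) - sin (f i))| <= hcot (d m).
  apply: h => i im.
    by rewrite divr_ge0// hcot_ge0 ?d2// (lt_le_trans d0) ?dd.
  rewrite ler_pM2r// hcot_anti ?d2 1?ltnW// ?(lt_le_trans d0) ?dd//.
  exact: fm.
have h4 : hcot (d m) <= 4 / dmin.
  apply: (le_trans (hcot_le _ _)); rewrite ?d2// ?(lt_le_trans d0) ?dd//.
  by rewrite ler_pM2l// lef_pV2 ?posrE// ?(lt_le_trans d0) ?dd.
apply: (le_trans (ler_normD _ _)); rewrite addrC lerD//; last exact: le_trans h4.
rewrite normrM (@ger0_norm _ 2^-1)// ler_pdivrMr//.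
have := cos_max (f 0); have := cos_max (f m.+1); rewrite !ler_norml; lra.
Qed.

End trigonometry.

(** * The squared Fejer kernel as a test for short arcs *)

Section kernel.
Context {R : realType}.
Implicit Types x y : R.

Definition csum K x : R := \sum_(a < K) cos (2 * pi * a%:R * x).
Definition ssum K x : R := \sum_(a < K) sin (2 * pi * a%:R * x).
(** The square modulus of a geometric sum, normalized to be [1] at the
    integers. *)
Definition fejer K x := (csum K x ^+ 2 + ssum K x ^+ 2) / K%:R ^+ 2.

Lemma fejer_ge0 K x : 0 <= fejer K x.
Proof. by rewrite divr_ge0 ?addr_ge0 ?sqr_ge0. Qed.

(** The angles are equally spaced over [h] turns.  Multiplied by the sine of
    half a step, the sum telescopes, and it closes up after a whole number of
    turns. *)
Lemma sum_cos_turn (N : nat) (h : int) y : (`|h| < N)%N -> h != 0 ->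
  \sum_(j < N) cos (2 * pi * h%:~R * (y - j%:R / N%:R)) = 0.
Proof.
move=> hN h0; have N0 : (0 < N)%N by lia.
have NR : N%:R != 0 :> R by rewrite pnatr_eq0; lia.
pose t : R := pi * h%:~R / N%:R.
have st : sin t != 0.
  have tE : `|t| = pi * (`|h|%N%:R / N%:R).
    rewrite /t !normrM normfV (ger0_norm (pi_ge0 R)) normr_nat -mulrA.
    by rewrite natr_absz intr_norm.
  have : 0 < sin `|t|.
    rewrite tE; apply: sin_gt0_pi; rewrite mulr_gt0 ?pi_gt0 ?divr_gt0 ?ltr0n ?absz_gt0//=.
    by rewrite gtr_pMr ?pi_gt0// ltr_pdivrMr ?ltr0n// mul1r ltr_nat.
  have [t0|t0] := leP 0 t; first by rewrite (ger0_norm t0) => /lt0r_neq0.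
  by rewrite (ltr0_norm t0) sinN oppr_gt0 => /ltr0_neq0.
apply: (mulfI (mulf_neq0 (_ : 2 != 0) st)) => //; rewrite mulr0 mulr_sumr.
pose f (j : nat) := sin (2 * pi * h%:~R * y - (2 * j%:R - 1) * t).
transitivity (\sum_(0 <= j < N) (f j - f j.+1)); last first.
  have -> : \sum_(0 <= j < N) (f j - f j.+1) = f 0 - f N.
    rewrite -[RHS]opprB -(telescope_sumr f (leq0n N)) -sumrN.
    by apply: eq_bigr => j _; rewrite opprB.
  rewrite /f; apply/eqP; rewrite subr_eq0; apply/eqP.
  set z := 2 * pi * h%:~R * y - (2 * N%:R - 1) * t.
  have -> : 2 * pi * h%:~R * y - (2 * 0 - 1) * t = z + 2 * pi * h%:~R.
    by rewrite /z /t; field.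
  have per (k : nat) (u : R) : sin (u + 2 * pi * k%:R) = sin u.
    have <- := periodicn (@sinD2pi R) k u; congr (sin (_ + _)).
    by rewrite -[RHS]mulr_natr -[pi *+ 2]mulr_natr; ring.
  case: (intP h) => [|k|k]; first by rewrite mulr0 addr0.
    by rewrite per.
  by rewrite mulrNz mulrN -[LHS](per k.+1) subrK.
rewrite big_mkord; apply: eq_bigr => j _.
rewrite /f; set A := 2 * pi * h%:~R * (y - j%:R / N%:R).
have -> : 2 * pi * h%:~R * y - (2 * j%:R - 1) * t = A + t by rewrite /A /t; field.
have -> : 2 * pi * h%:~R * y - (2 * j.+1%:R - 1) * t = A - t.
  by rewrite /A /t -natr1; field.
by rewrite sinD sinB; ring.
Qed.

(** Trigonometric polynomials with equal weights [w] and frequencies [n i]: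
    averaging over a fine enough grid only sees the zero frequencies. *)
Definition trigpoly (I : finType) (w : R) (n : I -> int) x :=
  w * \sum_i cos (2 * pi * (n i)%:~R * x).

Lemma trigpoly_grid (I : finType) (w : R) (n : I -> int) (N : nat) y :
  (forall i, `|n i| < N)%N ->
  \sum_(j < N) trigpoly w n (y - j%:R / N%:R) =
  N%:R * (w * #|[pred i | n i == 0]|%:R).
Proof.
move=> nN; rewrite /trigpoly -mulr_sumr exchange_big/= mulrCA; congr (_ * _).
rewrite (bigID (fun i => n i == 0))/= [X in _ + X]big1 ?addr0; last first.
  by move=> i ni; exact: sum_cos_turn.
rewrite (eq_bigr (fun=> N%:R)).
  by rewrite sumr_const mulr_natr.
move=> i /eqP ->; under eq_bigr do rewrite mulr0 mul0r cos0.
by rewrite sumr_const card_ord.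
Qed.

(** A frequency of modulus [h > 0] contributes at most [E] by the bound on
    exponential sums, so that the sample [y] sees the same mean as the
    uniform measure. *)
Lemma trigpoly_sample (I S : finType) (w : R) (n : I -> int) (N : nat)
    (y : S -> R) (E t : R) : 0 <= w -> 0 <= E ->
  (forall i, `|n i| < N)%N ->
  (forall h t, (0 < h)%N -> (h < N)%N ->
    `|\sum_s cos (2 * pi * h%:R * y s + t)| <= E) ->
  `|\sum_s trigpoly w n (y s - t) - #|S|%:R * (w * #|[pred i | n i == 0]|%:R)|
    <= w * #|I|%:R * E.
Proof.
move=> w0 E0 nN hE; rewrite /trigpoly -mulr_sumr exchange_big/= mulrCA -mulrBr.
rewrite normrM (ger0_norm w0) -mulrA ler_wpM2l//.
rewrite (bigID (fun i => n i == 0))/=.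
rewrite (eq_bigr (fun=> #|S|%:R)); last first.
  move=> i /eqP ->; under eq_bigr do rewrite mulr0 mul0r cos0.
  by rewrite sumr_const.
rewrite sumr_const -[_ *+ _]mulr_natr addrAC subrr add0r.
apply: (le_trans (ler_norm_sum _ _ _)).
have -> : #|I|%:R * E = \sum_(i : I) E by rewrite sumr_const mulr_natl.
rewrite [leRHS](bigID (fun i => n i == 0))/= -[leLHS]add0r lerD ?sumr_ge0//.
apply: ler_sum => i ni.
have := nN i; case: (intP (n i)) ni => [//|k _|k _] kN.
  rewrite (eq_bigr (fun s => cos (2 * pi * k.+1%:R * y s + - (2 * pi * k.+1%:R * t)))).
    by apply: hE.
  by move=> s _; congr cos; ring.
rewrite (eq_bigr (fun s => cos (2 * pi * k.+1%:R * y s + - (2 * pi * k.+1%:R * t)))).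
  by apply: hE => //; rewrite abszN in kN.
by move=> s _; rewrite -cosN; congr cos; rewrite mulrNz; ring.
Qed.

Definition diff2 K (i : 'I_K * 'I_K) : int := i.1%:Z - i.2%:Z.

Lemma fejerE K x : fejer K x = trigpoly (K%:R ^- 2) (@diff2 K) x.
Proof.
rewrite /trigpoly mulrC /fejer; congr (_ / _).
rewrite !expr2 /csum /ssum !big_distrlr/= -big_split/=.
under eq_bigr do rewrite -big_split/=.
rewrite pair_big/=; apply: eq_bigr => -[a b] _ /=.
by rewrite -cosB /diff2/= intrB; congr cos; ring.
Qed.

(** The frequencies [a - b] are symmetric about [0].  Hence the square of the
    Fejer kernel needs only cosines of sums of two frequencies. *)
Lemma sum_sin_diff K x :
  \sum_(i : 'I_K * 'I_K) sin (2 * pi * (diff2 i)%:~R * x) = 0.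
Proof.
rewrite -(pair_big predT predT (fun a b => sin (2 * pi * (@diff2 K (a, b))%:~R * x)))/=.
have E (a b : 'I_K) : sin (2 * pi * (diff2 (a, b))%:~R * x) =
  sin (2 * pi * a%:R * x) * cos (2 * pi * b%:R * x) -
  cos (2 * pi * a%:R * x) * sin (2 * pi * b%:R * x).
  by rewrite -sinB /diff2/= intrB; congr sin; ring.
under eq_bigr do (under eq_bigr do rewrite E; rewrite sumrB -!mulr_sumr).
by rewrite sumrB -!mulr_suml mulrC subrr.
Qed.

Definition diff4 K (i : ('I_K * 'I_K) * ('I_K * 'I_K)) : int :=
  diff2 i.1 + diff2 i.2.

Lemma fejer2E K x : fejer K x ^+ 2 = trigpoly (K%:R ^- 4) (@diff4 K) x.
Proof.
rewrite fejerE /trigpoly exprMn -exprVn -exprM -exprVn; congr (_ * _).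
have S0 := sum_sin_diff K x.
have -> : (\sum_i cos (2 * pi * (@diff2 K i)%:~R * x)) ^+ 2 =
  (\sum_i cos (2 * pi * (@diff2 K i)%:~R * x)) ^+ 2
  - (\sum_i sin (2 * pi * (@diff2 K i)%:~R * x)) ^+ 2.
  by rewrite S0 expr0n subr0.
rewrite !expr2 !big_distrlr/= -sumrB.
transitivity (\sum_i \sum_j (
    cos (2 * pi * (@diff2 K i)%:~R * x) * cos (2 * pi * (@diff2 K j)%:~R * x) -
    sin (2 * pi * (@diff2 K i)%:~R * x) * sin (2 * pi * (@diff2 K j)%:~R * x))).
  by apply: eq_bigr => i _; rewrite sumrB.
rewrite pair_big/=; apply: eq_bigr => -[a b] _ /=.
by rewrite -cosD /diff4/= intrD; congr cos; ring.
Qed.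

(** Both geometric sums collapse after multiplication by [sin (pi * x)]. *)
Lemma fejer_sin K x : fejer K x * sin (pi * x) ^+ 2 <= K%:R ^- 2.
Proof.
rewrite /fejer mulrAC ler_piMl ?invr_ge0 ?exprn_ge0//.
pose u (j : nat) := (2 * j%:R - 1) * (pi * x).
have C : 2 * (csum K x * sin (pi * x)) = sin (u K) - sin (u 0).
  rewrite -(telescope_sumr (fun j => sin (u j)) (leq0n K)) big_mkord mulr_suml mulr_sumr.
  apply: eq_bigr => j _; rewrite /u -[j.+1%:R]natr1.
  rewrite (_ : (2 * (j%:R + 1) - 1) * (pi * x) = 2 * pi * j%:R * x + pi * x); last by ring.
  rewrite (_ : (2 * j%:R - 1) * (pi * x) = 2 * pi * j%:R * x - pi * x); last by ring.
  by rewrite sinD sinB; ring.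
have S : 2 * (ssum K x * sin (pi * x)) = cos (u 0) - cos (u K).
  rewrite -[RHS]opprB -(telescope_sumr (fun j => cos (u j)) (leq0n K)) big_mkord.
  rewrite mulr_suml mulr_sumr -sumrN.
  apply: eq_bigr => j _; rewrite /u -[j.+1%:R]natr1.
  rewrite (_ : (2 * (j%:R + 1) - 1) * (pi * x) = 2 * pi * j%:R * x + pi * x); last by ring.
  rewrite (_ : (2 * j%:R - 1) * (pi * x) = 2 * pi * j%:R * x - pi * x); last by ring.
  by rewrite cosD cosB; ring.
have : 4 * ((csum K x ^+ 2 + ssum K x ^+ 2) * sin (pi * x) ^+ 2) <= 4.
  have -> : 4 * ((csum K x ^+ 2 + ssum K x ^+ 2) * sin (pi * x) ^+ 2) =
     (2 * (csum K x * sin (pi * x))) ^+ 2 + (2 * (ssum K x * sin (pi * x))) ^+ 2 by ring.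
  rewrite C S.
  have -> : (sin (u K) - sin (u 0)) ^+ 2 + (cos (u 0) - cos (u K)) ^+ 2 =
    (cos (u K) ^+ 2 + sin (u K) ^+ 2) + (cos (u 0) ^+ 2 + sin (u 0) ^+ 2)
     - 2 * (cos (u K) * cos (u 0) + sin (u K) * sin (u 0)) by ring.
  rewrite !cos2Dsin2 -cosB; have := cos_geN1 (u K - u 0); lra.
lra.
Qed.

Lemma fejer0 K : (0 < K)%N -> fejer K 0 = 1.
Proof.
move=> K0; rewrite /fejer /csum /ssum.
under eq_bigr do rewrite mulr0 cos0.
under [X in _ + X ^+ _]eq_bigr do rewrite mulr0 sin0.
rewrite sumr_const card_ord big1// expr0n addr0 divff//.
by rewrite expf_neq0// pnatr_eq0 -lt0n.
Qed.

Lemma card_diff2_eq0 K : #|[pred i : 'I_K * 'I_K | diff2 i == 0]| = K.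
Proof.
have inj : injective (fun a : 'I_K => (a, a)) by move=> a b [].
rewrite -[RHS]card_ord -(card_codom inj).
apply: eq_card => -[a b]; rewrite !inE /diff2/=; apply/eqP/codomP => [ab|[k [-> ->]]]; last by rewrite subrr.
by exists a => //; congr pair; apply: val_inj => /=; lia.
Qed.

End kernel.

Section arc_count.
Context {R : realType}.

Lemma card_grid (N : nat) (a b : R) : 0 <= a -> a <= b -> b < 1 ->
  `|#|[pred j : 'I_N | a <= j%:R / N%:R <= b]|%:R - N%:R * (b - a)| <= 1.
Proof.
move=> a0 ab b1; have [->|N0] := posnP N.
  by rewrite eq_card0 ?mul0r ?subrr ?normr0// => -[].
have NR : 0 < N%:R :> R by rewrite ltr0n.
pose A := `|Num.ceil (N%:R * a)|%N; pose B := Num.truncn (N%:R * b).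
have ca : Num.ceil (N%:R * a) = A%:Z.
  by rewrite /A gez0_abs// ceil_ge0// (lt_le_trans (ltrN10 R))// mulr_ge0.
have Al : A%:R - 1 < N%:R * a.
  by have := ceilB1_lt (N%:R * a); rewrite ca intrB.
have Au : N%:R * a <= A%:R by have := ceil_ge (N%:R * a); rewrite ca.
have /andP[Bl Bu] := truncn_itv (mulr_ge0 (ltW NR) (le_trans a0 ab)).
have -> : #|[pred j : 'I_N | a <= j%:R / N%:R <= b]| = (B.+1 - A)%N.
  have BN : (B.+1 <= N)%N.
    rewrite -(ltr_nat R); apply: le_lt_trans Bl _.
    by rewrite gtr_pMr.
  rewrite -sum1_card -(big_mkord (fun j => a <= j%:R / N%:R <= b) (fun=> 1%N))/=.
  transitivity (\sum_(0 <= j < N | (A <= j < B.+1)%N) 1)%N.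
    rewrite big_nat_cond [RHS]big_nat_cond; apply: eq_bigl => j.
    congr (_ && _); rewrite ler_pdivlMr// ler_pdivrMr// ![_ * N%:R]mulrC.
    congr (_ && _).
      apply/idP/idP => [h|h]; last by apply: (le_trans Au); rewrite ler_nat.
      rewrite leqNgt; apply/negP => jA.
      have : j.+1%:R <= A%:R :> R by rewrite ler_nat.
      by rewrite -natr1; lra.
    apply/idP/idP => [h|h].
      by rewrite -(ltr_nat R); exact: le_lt_trans h _.
    by apply: le_trans Bl; rewrite ler_nat.
  rewrite sum1_count -size_filter.
  rewrite (@perm_size _ _ (index_iota A B.+1)) ?size_iota//.
  apply: uniq_perm; rewrite ?filter_uniq ?iota_uniq// => j.
  by rewrite mem_filter !mem_index_iota; lia.
rewrite mulrBr ler_norml; have [AB|BA] := leqP A B.+1.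
  by rewrite natrB// -natr1; apply/andP; split; rewrite -natr1 in Bu; lra.
rewrite (_ : (_ - _)%N = 0%N); last by lia.
have : B.+2%:R <= A%:R :> R by rewrite ler_nat.
have : N%:R * a <= N%:R * b by rewrite ler_pM2l.
by rewrite -(natr1 B.+1) => *; apply/andP; split; lra.
Qed.

Lemma card_mulr (T : finType) (A : pred T) (x : R) :
  #|A|%:R * x = \sum_(i in A) x.
Proof. by rewrite sumr_const mulr_natl. Qed.

Variables (S : finType) (y : S -> R) (K : nat) (E : R).
Hypothesis K0 : (0 < K)%N.
Hypothesis y01 : forall s, 0 <= y s < 1.
Hypothesis E0 : 0 <= E.
Hypothesis yE : forall h t, (0 < h)%N -> (h < 2 * K)%N ->
  `|\sum_s cos (2 * pi * h%:R * y s + t)| <= E.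
Let N := (2 * K)%N.
Let M : R := #|S|%:R.
Let node (j : nat) : R := j%:R / N%:R.

Let KR : 0 < K%:R :> R. Proof. by rewrite ltr0n. Qed.
Let NR : 0 < N%:R :> R. Proof. by rewrite ltr0n muln_gt0. Qed.

Let diff2N (i : 'I_K * 'I_K) : (`|diff2 i| < N)%N.
Proof. by case: i => a b; rewrite /diff2/= /N; have := ltn_ord a; have := ltn_ord b; lia. Qed.

Let diff4N (i : ('I_K * 'I_K) * ('I_K * 'I_K)) : (`|diff4 i| < N)%N.
Proof.
case: i => -[a b] [c d]; rewrite /diff4 /diff2/= /N.
by have := ltn_ord a; have := ltn_ord b; have := ltn_ord c; have := ltn_ord d; lia.
Qed.

Let Z : R := N%:R * (K%:R ^- 4 * #|[pred i | @diff4 K i == 0]|%:R).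

(** The frequencies of the kernel and of its square are smaller than the
    number [N] of nodes, so that their sums over the nodes do not depend on
    [x]: the translates by the nodes form a partition of a constant. *)
Lemma sum_fejer x : \sum_(j < N) fejer K (x - node j) = 2.
Proof.
under eq_bigr do rewrite fejerE.
rewrite (trigpoly_grid _ _ diff2N) card_diff2_eq0 /N natrM.
by field; rewrite gt_eqF.
Qed.

Lemma sum_fejer2 x : \sum_(j < N) fejer K (x - node j) ^+ 2 = Z.
Proof.
under eq_bigr do rewrite fejer2E.
exact: (trigpoly_grid _ _ diff4N).
Qed.

Lemma fejer2_mass_ge1 : 1 <= Z.
Proof.
have N0 : (0 < N)%N by rewrite muln_gt0.
rewrite -(sum_fejer2 0) (bigD1 (Ordinal N0))//= /node mul0r subr0 fejer0// expr1n.
by rewrite lerDl sumr_ge0// => j _; rewrite sqr_ge0.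
Qed.

Lemma fejer_sample t : `|\sum_s fejer K (y s - t) - M / K%:R| <= E.
Proof.
under eq_bigr do rewrite fejerE.
have w0 : 0 <= K%:R ^- 2 :> R by rewrite invr_ge0 exprn_ge0.
have := trigpoly_sample t w0 E0 diff2N yE => h.
rewrite card_diff2_eq0 card_prod card_ord natrM in h.
have -> : E = K%:R ^- 2 * (K%:R * K%:R) * E by field; rewrite gt_eqF.
by have -> : M / K%:R = M * (K%:R ^- 2 * K%:R) by field; rewrite gt_eqF.
Qed.

Lemma fejer2_sample t : `|\sum_s fejer K (y s - t) ^+ 2 - M * Z / N%:R| <= E.
Proof.
under eq_bigr do rewrite fejer2E.
have w0 : 0 <= K%:R ^- 4 :> R by rewrite invr_ge0 exprn_ge0.
have := trigpoly_sample t w0 E0 diff4N yE => h.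
rewrite !card_prod !card_ord !natrM in h.
have -> : E = K%:R ^- 4 * (K%:R * K%:R * (K%:R * K%:R)) * E by field; rewrite gt_eqF.
have -> // : M * Z / N%:R = M * (K%:R ^- 4 * #|[pred i | @diff4 K i == 0]|%:R).
by rewrite /Z; field; rewrite !gt_eqF.
Qed.

Lemma fejer2_far (eta x : R) : 0 < eta -> eta <= `|x| -> `|x| <= 3 / 4 ->
  fejer K x ^+ 2 <= 9 / (K%:R * eta) ^+ 2 * fejer K x.
Proof.
move=> e0 ex x34; rewrite expr2 ler_wpM2r ?fejer_ge0//.
have s : eta ^+ 2 / 9 <= sin (pi * x) ^+ 2.
  rewrite -[leRHS]real_normK ?num_real//.
  rewrite (_ : eta ^+ 2 / 9 = (eta / 3) ^+ 2); last by field.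
  rewrite lerXn2r ?nnegrE//; first by lra.
  by apply: le_trans (norm_sin_pi_ge x34); lra.
have f := @fejer_sin R K x.
have h : fejer K x * (eta ^+ 2 / 9) <= K%:R ^- 2.
  by apply: le_trans f; rewrite ler_wpM2l// fejer_ge0.
have e2 : 0 < eta ^+ 2 / 9 by rewrite divr_gt0// exprn_gt0.
rewrite -(ler_pM2r e2); apply: le_trans h _.
by rewrite le_eqVlt; apply/orP; left; apply/eqP; field; rewrite !gt_eqF.
Qed.

Variables (u v eta : R).
Hypotheses (u4 : 1 / 4 <= u - eta) (uv : u + eta <= v - eta) (v4 : v + eta <= 3 / 4).
Hypothesis eta0 : 0 < eta.
Let arc := [pred s | u <= y s < v].
Let outer := [pred j : 'I_N | u - eta <= node j <= v + eta].
Let inner := [pred j : 'I_N | u + eta <= node j <= v - eta].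
Let d : R := 9 / (K%:R * eta) ^+ 2.

Let d0 : 0 <= d. Proof. by rewrite divr_ge0// sqr_ge0. Qed.

Let node01 (j : 'I_N) : 0 <= node j < 1.
Proof. by rewrite /node divr_ge0//= ltr_pdivrMr// mul1r ltr_nat. Qed.

(** Almost all of the constant [Z], all but a proportion [2 * d], comes from
    the nodes within [eta] of a point; these nodes are [outer] ones when the
    point lies in the arc.  Each node receives [M * Z / N] up to [E]. *)
Lemma arc_upper : #|arc|%:R * (1 - 2 * d) <= #|outer|%:R * (M / N%:R + E).
Proof.
have [u4' v4' eta0'] := And3 u4 v4 eta0; have Z1 := fejer2_mass_ge1.
rewrite -(ler_pM2r (lt_le_trans ltr01 Z1)).
apply: (@le_trans _ _ (\sum_s \sum_(j in outer) fejer K (y s - node j) ^+ 2)).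
  rewrite -mulrA card_mulr.
  rewrite [leRHS](bigID [in arc])/= -[leLHS]addr0 lerD//; last first.
    by rewrite sumr_ge0// => s _; rewrite sumr_ge0// => j _; rewrite sqr_ge0.
  apply: ler_sum => s; rewrite inE => /andP[us vs].
  have := sum_fejer2 (y s); rewrite (bigID [in outer])/= => ZE.
  have : \sum_(i < N | i \notin outer) fejer K (y s - node i) ^+ 2 <= 2 * d.
    rewrite -(sum_fejer (y s)) mulrC mulr_sumr.
    apply: (@le_trans _ _ (\sum_(i < N | i \notin outer) d * fejer K (y s - node i))).
      apply: ler_sum => j; rewrite inE negb_and -!ltNge => jo.
      have /andP[n0 n1] : 0 <= node j < 1 by exact: node01.
      apply: fejer2_far => //.
        by rewrite ler_normr; apply/orP; case/orP: jo => ?; [left|right]; lra.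
      by rewrite ler_norml; apply/andP; split; lra.
    rewrite [leRHS](bigID [in outer])/= lerDr sumr_ge0// => j _.
    by rewrite mulr_ge0// fejer_ge0.
  have : 2 * d <= Z * (2 * d) by rewrite ler_peMl// mulr_ge0.
  by move: ZE; lra.
rewrite exchange_big/= -mulrA card_mulr; apply: ler_sum => j _.
have := fejer2_sample (node j); rewrite ler_norml => /andP[_].
have : E <= E * Z by rewrite ler_peMr.
have -> : M * Z / N%:R = M / N%:R * Z by ring.
by rewrite mulrDl; lra.
Qed.

(** Dually, the [inner] nodes receive nearly nothing from the points off the
    arc. *)
Lemma arc_lower :
  #|inner|%:R * ((M / N%:R - E) - d * (2 * (M / N%:R) + E)) <= #|arc|%:R.
Proof.
have [u4' v4' eta0'] := And3 u4 v4 eta0; have uv' := uv.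
have Z1 := fejer2_mass_ge1; have Z0 := lt_le_trans ltr01 Z1.
have M0 : 0 <= M / N%:R by rewrite divr_ge0.
rewrite -(ler_pM2r Z0).
have up : \sum_s \sum_(j in inner) fejer K (y s - node j) ^+ 2 <=
    #|arc|%:R * Z + #|inner|%:R * (d * (2 * (M / N%:R) + E)).
  rewrite (bigID [in arc])/= lerD//.
    rewrite card_mulr; apply: ler_sum => s _.
    rewrite -(sum_fejer2 (y s)) [leRHS](bigID [in inner])/= lerDl.
    by rewrite sumr_ge0// => j _; rewrite sqr_ge0.
  apply: (@le_trans _ _ (\sum_(s | s \notin arc) \sum_(j in inner) d * fejer K (y s - node j))).
    apply: ler_sum => s sA; apply: ler_sum => j; rewrite inE => /andP[j1 j2].
    have /andP[y0 y1] := y01 s.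
    move: sA; rewrite inE negb_and -ltNge -leNgt => sA.
    apply: fejer2_far => //.
      by rewrite ler_normr; apply/orP; case/orP: sA => ?; [right|left]; lra.
    by rewrite ler_norml; apply/andP; split; lra.
  apply: (@le_trans _ _ (\sum_s \sum_(j in inner) d * fejer K (y s - node j))).
    rewrite [leRHS](bigID [in arc])/= lerDr sumr_ge0// => s _.
    by rewrite sumr_ge0// => j _; rewrite mulr_ge0// fejer_ge0.
  rewrite exchange_big/= card_mulr; apply: ler_sum => j _.
  rewrite -mulr_sumr ler_wpM2l//.
  have := fejer_sample (node j); rewrite ler_norml => /andP[_].
  have -> : M / K%:R = 2 * (M / N%:R) by rewrite /N natrM; field; rewrite gt_eqF.
  by lra.
have lo : #|inner|%:R * (M / N%:R * Z - E) <=
    \sum_s \sum_(j in inner) fejer K (y s - node j) ^+ 2.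
  rewrite exchange_big/= card_mulr; apply: ler_sum => j _.
  have := fejer2_sample (node j); rewrite ler_norml => /andP[+ _].
  have -> : M * Z / N%:R = M / N%:R * Z by ring.
  by lra.
have h1 : E <= E * Z by rewrite ler_peMr.
have h2 : d * (2 * (M / N%:R) + E) <= d * (2 * (M / N%:R) + E) * Z.
  by rewrite ler_peMr// mulr_ge0// addr_ge0// mulr_ge0.
have h3 : #|inner|%:R * (E + d * (2 * (M / N%:R) + E)) <=
     #|inner|%:R * (E * Z + d * (2 * (M / N%:R) + E) * Z).
  by rewrite ler_wpM2l//; lra.
by move: up lo h3; lra.
Qed.

End arc_count.

(* The arithmetic of the main and error terms of [arc_count]. *)
Lemma arc_count_arith (R : realType) (A J1 J2 m E d e X : R) :
  0 < e -> e <= 1 / 20 -> 0 <= A -> 0 <= J1 -> 0 <= m -> 0 <= X -> 0 <= E -> 0 <= d ->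
  E <= 4 * e ^+ 2 * m -> d <= 9 * e ^+ 2 ->
  J1 <= X * (1 + 2 * e + e ^+ 2 / 2) -> X * (1 - 2 * e - e ^+ 2 / 2) <= J2 ->
  A * (1 - 2 * d) <= J1 * (m + E) ->
  J2 * (m - E - d * (2 * m + E)) <= A ->
  `|A - X * m| <= 20 * e * (X * m).
Proof.
move=> e0 e1 A0 J10 m0 X0 E0 d0 Em d9 J1u J2l up lo.
have e4 : e ^+ 2 <= 1 / 400.
  by rewrite (_ : 1 / 400 = (1 / 20) ^+ 2); [rewrite lerXn2r ?nnegrE//; lra|field].
have e20 : 0 <= e ^+ 2 by rewrite sqr_ge0.
have e2e : e ^+ 2 <= e * (1 / 20) by rewrite expr2 ler_wpM2l// ltW.
have Xm0 : 0 <= X * m by rewrite mulr_ge0.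
have hu : A * (1 - 18 * e ^+ 2) <= X * m * ((1 + 2 * e + e ^+ 2 / 2) * (1 + 4 * e ^+ 2)).
  apply: (@le_trans _ _ (A * (1 - 2 * d))); first by rewrite ler_wpM2l//; lra.
  apply: (le_trans up); rewrite (_ : X * m * _ = (X * (1 + 2 * e + e ^+ 2 / 2)) * (m * (1 + 4 * e ^+ 2))); last by ring.
  by rewrite ler_pM//; lra.
have hl : X * m * ((1 - 2 * e - e ^+ 2 / 2) * (1 - 23 * e ^+ 2)) <= A.
  apply: le_trans lo; rewrite (_ : X * m * _ = (X * (1 - 2 * e - e ^+ 2 / 2)) * (m * (1 - 23 * e ^+ 2))); last by ring.
  have dm : d * (2 * m + E) <= 9 * e ^+ 2 * (2 * m + 4 * e ^+ 2 * m).
    by rewrite ler_pM//; lra.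
  have dm2 : 9 * e ^+ 2 * (2 * m + 4 * e ^+ 2 * m) <= 19 * e ^+ 2 * m.
    have : e ^+ 2 * m * (36 * e ^+ 2) <= e ^+ 2 * m * 1.
      by rewrite ler_wpM2l ?mulr_ge0//; lra.
    by lra.
  have ml : m * (1 - 23 * e ^+ 2) <= m - E - d * (2 * m + E) by lra.
  have m23 : 0 <= m * (1 - 23 * e ^+ 2) by rewrite mulr_ge0//; lra.
  apply: (@le_trans _ _ (J2 * (m * (1 - 23 * e ^+ 2)))); first by rewrite ler_wpM2r.
  rewrite ler_wpM2l// (le_trans _ J2l)// mulr_ge0//; lra.
rewrite ler_norml; apply/andP; split.
  suff : X * m * (1 - 20 * e) <= A by lra.
  by apply: le_trans hl; rewrite ler_wpM2l//; nra.
suff : A <= X * m * (1 + 20 * e) by lra.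
have p : 0 < 1 - 18 * e ^+ 2 by lra.
rewrite -(ler_pM2r p) (le_trans hu)// -[leRHS]mulrA ler_wpM2l//.
nra.
Qed.

(** Quantitative equidistribution from small Fourier coefficients: the arc
    [[1/2, 1/2 + w)] has to be tested at frequencies up to a large multiple of
    [1 / w] only.  The arc is compared with a sum of translates of the squared
    Fejer kernel over the grid of step [1 / (2 * K)]; these translates form a
    partition of a constant, and each of them has a negligible integral far
    from its node. *)
Lemma arc_count (R : realType) (S : finType) (y : S -> R) (K : nat) (E w e : R) :
  (forall s, 0 <= y s < 1) -> 0 <= E ->
  (forall h t, (0 < h)%N -> (h < 2 * K)%N ->
    `|\sum_s cos (2 * pi * h%:R * y s + t)| <= E) ->
  0 < e -> e <= 1 / 20 -> 0 < w -> w <= 1 / 8 ->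
  1 <= e ^+ 2 * w * K%:R -> E * K%:R <= 2 * e ^+ 2 * #|S|%:R ->
  `|#|[pred s | 1 / 2 <= y s < 1 / 2 + w]|%:R - w * #|S|%:R| <=
    20 * e * (w * #|S|%:R).
Proof.
move=> y01 E0 yE e0 e1 w0 w8 Kw EK.
have K0 : (0 < K)%N by rewrite lt0n; apply/eqP => k; move: Kw; rewrite k; lra.
have KR : 0 < K%:R :> R by rewrite ltr0n.
have ew : 0 < e * w by rewrite mulr_gt0.
have ew1 : e * w <= 1 / 160 by nra.
set M : R := #|S|%:R in EK *.
have M0 : 0 <= M by [].
set N := (2 * K)%N; have NR : 0 < N%:R :> R by rewrite ltr0n muln_gt0.
have NK : N%:R = 2 * K%:R :> R by rewrite /N natrM.
set d : R := 9 / (K%:R * (e * w)) ^+ 2.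
have d0 : 0 <= d by rewrite divr_ge0// sqr_ge0.
have d9 : d <= 9 * e ^+ 2.
  rewrite /d ler_pdivrMr ?exprn_gt0 ?mulr_gt0//.
  have -> : 9 * e ^+ 2 * (K%:R * (e * w)) ^+ 2 = 9 * (e ^+ 2 * w * K%:R) ^+ 2 by ring.
  by rewrite ler_peMr// exprn_ege1.
have up := @arc_upper R S y K E K0 E0 yE (1/2) (1/2 + w) (e * w).
have lo := @arc_lower R S y K E K0 y01 E0 yE (1/2) (1/2 + w) (e * w).
rewrite -/N -/M -/d in up lo.
have e2 : e * e <= e / 20 by nra.
have ew' : 1 / 4 <= 1 / 2 - e * w by lra.
have ew'' : 1 / 2 + w + e * w <= 3 / 4 by lra.
have we : 2 * (e * w) <= w by nra.
have {}up := up ew' ew'' ew.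
have {}lo : #|[pred j : 'I_N | 1 / 2 + e * w <= j%:R / N%:R <= 1 / 2 + w - e * w]|%:R *
    (M / N%:R - E - d * (2 * (M / N%:R) + E)) <= #|[pred s | 1 / 2 <= y s < 1 / 2 + w]|%:R.
  by apply: lo; lra.
have c1 : `|#|[pred j : 'I_N | 1 / 2 - e * w <= j%:R / N%:R <= 1 / 2 + w + e * w]|%:R
    - N%:R * (1 / 2 + w + e * w - (1/2 - e * w))| <= 1 by apply: card_grid; lra.
have c2 : `|#|[pred j : 'I_N | 1 / 2 + e * w <= j%:R / N%:R <= 1 / 2 + w - e * w]|%:R
    - N%:R * (1 / 2 + w - e * w - (1/2 + e * w))| <= 1 by apply: card_grid; lra.
move: up lo c1 c2.
set A := #|[pred s | _]|%:R; set J1 := #|_|%:R; set J2 := #|_|%:R.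
set m := M / N%:R; move=> up lo /ler_normlP[_ c1] /ler_normlP[c2 _].
have m0 : 0 <= m by rewrite divr_ge0// ltW.
have ME : w * M = N%:R * w * m by rewrite /m; field; rewrite gt_eqF.
have Em : E <= 4 * e ^+ 2 * m.
  rewrite /m mulrA ler_pdivlMr// NK; lra.
have Nw : 2 <= e ^+ 2 * (N%:R * w) by rewrite NK; lra.
rewrite ME /A; apply: (@arc_count_arith _ _ J1 J2 m E d e) => //.
- by rewrite mulr_ge0// ltW.
- by clear -c1 Nw; lra.
- by clear -c2 Nw; lra.
Qed.

(** * A bilinear exponential sum *)

Section power_differences.
Context {R : realType}.
Implicit Types (p g a b s t k : R).

Lemma ler_powR_neg p a b : p <= 0 -> 0 < a -> a <= b -> b `^ p <= a `^ p.
Proof.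
move=> p0 a0 ab; have b0 := lt_le_trans a0 ab.
rewrite -[p]opprK !(powRN _ (- p)) lef_pV2 ?posrE ?powR_gt0//.
by apply: ge0_ler_powR; rewrite ?nnegrE ?oppr_ge0// ltW.
Qed.

Lemma MVT_powR p a b : 0 < a -> a <= b ->
  exists2 x, a <= x <= b & b `^ p - a `^ p = p * x `^ (p - 1) * (b - a).
Proof.
move=> a0 ab.
have d x : x \in `]a, b[%R -> is_derive x 1 (@powR R ^~ p) (p * x `^ (p - 1)).
  by rewrite in_itv/= => /andP[ax _]; apply: is_derive1_powR; exact: lt_trans ax.
have [|x] := MVT_segment ab d; last by rewrite in_itv/=; exists x.
apply: derivable_within_continuous => x; rewrite in_itv/= => /andP[ax _].
by apply: derivable_powR; rewrite in_itv/= andbT (lt_le_trans a0).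
Qed.

Lemma is_derive_powR_shift p k (x : R) : 0 < x + k ->
  is_derive x 1 (fun u : R => (u + k) `^ p) (p * (x + k) `^ (p - 1)).
Proof.
move=> xk; rewrite -[X in is_derive _ _ _ X]mulr1.
apply: (@is_derive1_comp R (@powR R ^~ p) (fun u : R => u + k)).
  exact: is_derive1_powR.
by rewrite -[X in is_derive _ _ _ X]addr0; apply: is_deriveD.
Qed.

Lemma MVT_gap p k s t : 0 <= k -> 0 < s -> s <= t ->
  exists2 x, s <= x <= t & ((t + k) `^ p - t `^ p) - ((s + k) `^ p - s `^ p) =
    p * ((x + k) `^ (p - 1) - x `^ (p - 1)) * (t - s).
Proof.
move=> k0 s0 st.
pose f (x : R) := (x + k) `^ p - x `^ p.
have d (x : R) : 0 < x -> is_derive x 1 f (p * ((x + k) `^ (p - 1) - x `^ (p - 1))).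
  move=> x0; rewrite mulrBr; apply: is_deriveB; last exact: is_derive1_powR.
  by apply: is_derive_powR_shift; rewrite ltr_wpDr.
have d' (x : R) : x \in `]s, t[%R ->
    is_derive x 1 f (p * ((x + k) `^ (p - 1) - x `^ (p - 1))).
  by rewrite in_itv/= => /andP[sx _]; apply: d; exact: lt_trans sx.
have [|x] := MVT_segment st d'; last by rewrite in_itv/=; exists x.
apply: derivable_within_continuous => x; rewrite in_itv/= => /andP[sx _].
by apply: ex_derive; apply: d; exact: lt_le_trans sx.
Qed.

(** The phase that is left once the two values of a sparse variable, [k]
    apart, have been paired. *)
Definition gap p k t := (t + k) `^ p - t `^ p.

(** Up to the factor [g], [drop g k] is the derivative of [- gap g k]. *)
Definition drop g k t := t `^ (g - 1) - (t + k) `^ (g - 1).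

Variable g : R.
Hypotheses (g0 : 0 < g) (g1 : g < 1).

(** This gives the second difference of the phase a constant sign. *)
Lemma drop_anti k s t : 0 <= k -> 0 < s -> s <= t -> drop g k t <= drop g k s.
Proof.
move=> k0 s0 st; have [x /andP[sx xt] E] := MVT_gap (g - 1) k0 s0 st.
have g1' := g1; have x0 : 0 < x := lt_le_trans s0 sx.
suff : 0 <= (t + k) `^ (g - 1) - t `^ (g - 1) - ((s + k) `^ (g - 1) - s `^ (g - 1)).
  by rewrite /drop; lra.
rewrite E mulr_ge0 ?subr_ge0// mulr_le0//; first by lra.
by rewrite subr_le0; apply: ler_powR_neg; lra.
Qed.

Lemma gap_dec k t : 0 <= k -> 0 < t ->
  g * drop g k (t + 1) <= gap g k t - gap g k (t + 1) <= g * drop g k t.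
Proof.
move=> k0 t0; have t1 : t <= t + 1 by rewrite lerDl.
have [x /andP[tx xt] E] := MVT_gap g k0 t0 t1.
have x0 : 0 < x := lt_le_trans t0 tx.
have -> : gap g k t - gap g k (t + 1) = g * drop g k x.
  by rewrite -opprB [X in - X]E /drop; ring.
by rewrite !ler_pM2l// !drop_anti.
Qed.

Lemma drop_le k t : 0 <= k -> 0 < t -> drop g k t <= (1 - g) * k * t `^ (g - 2).
Proof.
move=> k0 t0; have tk : t <= t + k by rewrite lerDl.
have [x /andP[tx xt] E] := MVT_powR (g - 1) t0 tk.
have g1' := g1; rewrite /drop -[_ - (t + k) `^ _]opprB E (_ : g - 1 - 1 = g - 2); last by ring.
have : x `^ (g - 2) <= t `^ (g - 2) by apply: ler_powR_neg; lra.
have : 0 <= (1 - g) * k by rewrite mulr_ge0//; lra.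
by move: (x `^ _) (t `^ _) => u v; nra.
Qed.

Lemma drop_ge k t : 0 <= k -> 0 < t -> (1 - g) * k * (t + k) `^ (g - 2) <= drop g k t.
Proof.
move=> k0 t0; have tk : t <= t + k by rewrite lerDl.
have [x /andP[tx xt] E] := MVT_powR (g - 1) t0 tk.
have g1' := g1; rewrite /drop -[_ - (t + k) `^ _]opprB E (_ : g - 1 - 1 = g - 2); last by ring.
have : (t + k) `^ (g - 2) <= x `^ (g - 2) by apply: ler_powR_neg; lra.
have : 0 <= (1 - g) * k by rewrite mulr_ge0//; lra.
by move: (x `^ _) ((t + k) `^ _) => u v; nra.
Qed.

End power_differences.

Section sums.
Context {R : realType}.

Lemma sqr_sum_le (I : finType) (v : I -> R) :
  (\sum_i v i) ^+ 2 <= #|I|%:R * \sum_i v i ^+ 2.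
Proof.
have : 0 <= \sum_i \sum_j (v i - v j) ^+ 2.
  by rewrite sumr_ge0// => i _; rewrite sumr_ge0// => j _; rewrite sqr_ge0.
have -> : \sum_i \sum_j (v i - v j) ^+ 2 =
    2 * (#|I|%:R * \sum_i v i ^+ 2) - 2 * (\sum_i v i) ^+ 2.
  have -> : (\sum_i v i) ^+ 2 = \sum_i \sum_j v i * v j by rewrite expr2 big_distrlr.
  have -> : 2 * (#|I|%:R * \sum_i v i ^+ 2) =
      \sum_i \sum_(j : I) v i ^+ 2 + \sum_(i : I) \sum_j v j ^+ 2.
    rewrite sumr_const.
    under [X in _ = X + _]eq_bigr do rewrite sumr_const.
    by rewrite sumrMnl -mulr_natl; ring.
  rewrite mulr_sumr -big_split/= -sumrB; apply: eq_bigr => i _.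
  rewrite mulr_sumr -big_split/= -sumrB; apply: eq_bigr => j _.
  by ring.
by lra.
Qed.

Lemma harmonic_ln (L : nat) : \sum_(1 <= k < L.+1) (k%:R : R)^-1 <= 1 + ln L%:R.
Proof.
case: L => [|L]; first by rewrite big_geq// ln0 ?addr0.
elim: L => [|L IH]; first by rewrite big_nat1 invr1 ln1 addr0.
rewrite big_nat_recr//=.
have L0 : 0 < L.+1%:R :> R by rewrite ltr0n.
have L1 : 0 < L.+2%:R :> R by rewrite ltr0n.
have := @le_ln1Dx R (- L.+2%:R^-1).
rewrite ltrN2 invf_lt1// ltr1n => /(_ isT).
have -> : 1 - L.+2%:R^-1 = L.+1%:R / L.+2%:R :> R.
  have -> : L.+1%:R = L.+2%:R - 1 :> R by rewrite -[L.+2%:R]natr1 addrK.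
  by field; rewrite gt_eqF.
rewrite ln_div ?posrE//.
by move: IH; move: (\sum_(_ <= _ < _) _) (L.+2%:R^-1) (ln L.+1%:R) (ln L.+2%:R) => *; lra.
Qed.

Definition dist_nat (a b : nat) : nat := (a - b + (b - a))%N.

Lemma sum_inv_dist (L : nat) (b : 'I_L) :
  \sum_(b' < L | b' != b) (dist_nat b b')%:R^-1 <= 2 * (1 + ln L%:R) :> R.
Proof.
have bL := ltn_ord b.
have -> : \sum_(b' < L | b' != b) (dist_nat b b')%:R^-1 =
    \sum_(0 <= i < b) (dist_nat b i)%:R^-1 + \sum_(b.+1 <= i < L) (dist_nat b i)%:R^-1 :> R.
  rewrite -(big_mkord (fun i => i != b) (fun i => (dist_nat b i)%:R^-1)).
  rewrite (@big_cat_nat _ _ _ b)//=; last exact: ltnW.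
  congr (_ + _).
    rewrite big_nat_cond [RHS]big_nat_cond; apply: eq_bigl => i.
    by case: ltnP; rewrite ?andbF//= => ib; rewrite ltn_eqF.
  rewrite (@big_cat_nat _ _ _ b.+1)//= big_nat_cond big_pred0 ?add0r; last first.
    by move=> i; lia.
  rewrite big_nat_cond [RHS]big_nat_cond; apply: eq_bigl => i.
  by case: (leqP b.+1 i) => //= bi; rewrite gtn_eqF.
have H (m : nat) : (m < L)%N -> \sum_(1 <= k < m.+1) (k%:R : R)^-1 <= 1 + ln L%:R.
  move=> mL; apply: le_trans (harmonic_ln L).
  by rewrite [leRHS](@big_cat_nat _ _ _ m.+1)//= ?lerDl ?sumr_ge0// ltnW.
rewrite (_ : 2 * _ = (1 + ln L%:R) + (1 + ln L%:R)); last by ring.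
apply: lerD.
  rewrite big_nat_rev/= add0n.
  have := H b bL; rewrite big_add1/=; apply: le_trans.
  rewrite le_eqVlt; apply/orP; left; apply/eqP; apply: eq_big_nat => i ib.
  by congr (_%:R^-1); rewrite /dist_nat; lia.
have := H (L - b.+1)%N; rewrite -[X in \sum_(X <= _ < _) (dist_nat _ _)%:R^-1]add0n big_addn.
move=> h; apply: le_trans (h _); last by lia.
rewrite big_add1/=.
rewrite le_eqVlt; apply/orP; left; apply/eqP; apply: eq_big_nat => i ib.
by congr (_%:R^-1); rewrite /dist_nat; lia.
Qed.

End sums.

Section exponential_sum.
Context {R : realType}.
Variable g : R.
Hypotheses (g0 : 0 < g) (g1 : g < 1).

(** The increments of the phase [gap g k] are about [k * t ^ (g - 2)] and
    monotone, so that the Kusmin-Landau inequality applies. *)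
Lemma sum_cos_gap (h : nat) (D : nat) (k t0 t1 t : R) :
  (0 < h)%N -> 1 <= k -> 0 < t0 -> t0 <= t -> t + k + D.+1%:R <= t1 ->
  2 * pi * h%:R * g * (1 - g) * k * t0 `^ (g - 2) <= 2 ->
  `|\sum_(i < D.+1) cos (2 * pi * h%:R * gap g k (t + i%:R))| <=
    1 + 4 / (2 * pi * g * (1 - g) * t1 `^ (g - 2) * k).
Proof.
move=> h0 k1 t00 tt t1D up; have g0' := g0; have g1' := g1.
have pg : 0 < @pi R := pi_gt0 R.
have k0 : 0 <= k by lra.
have h1 : 1 <= h%:R :> R by rewrite ler1n.
pose f i := - (2 * pi * h%:R * gap g k (t + i%:R)).
have fE i : cos (2 * pi * h%:R * gap g k (t + i%:R)) = cos (f i) by rewrite cosN.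
under eq_bigr do rewrite fE.
have df i : f i.+1 - f i = 2 * pi * h%:R * (gap g k (t + i%:R) - gap g k (t + i%:R + 1)).
  by rewrite /f -[i.+1%:R]natr1 addrA; ring.
have p0 : 0 < 2 * pi * h%:R :> R by rewrite !mulr_gt0//; lra.
have ti i : 0 < t + i%:R by apply: lt_le_trans (lt_le_trans t00 tt) _; rewrite lerDl.
have t10 : 0 < t1 by apply: lt_le_trans t1D; have := ti D.+1; lra.
apply: kusmin_landau.
- by rewrite !mulr_gt0 ?powR_gt0//; lra.
- move=> i iD; rewrite df; have /andP[lo hi] := gap_dec g0 g1 k0 (ti i).
  apply/andP; split.
    apply: (@le_trans _ _ (2 * pi * h%:R * (g * ((1 - g) * k * t1 `^ (g - 2))))).
      rewrite (_ : 2 * pi * g * (1 - g) * t1 `^ (g - 2) * k =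
        2 * pi * 1 * (g * ((1 - g) * k * t1 `^ (g - 2)))); last by ring.
      rewrite ler_wpM2r//; first by rewrite !mulr_ge0 ?powR_ge0//; lra.
      by rewrite ler_wpM2l ?mulr_ge0//; lra.
    rewrite ler_wpM2l ?(ltW p0)// (le_trans _ lo)// ler_wpM2l ?(ltW g0)//.
    have ti1 : 0 < t + i%:R + 1 by have := ti i; lra.
    apply: le_trans (drop_ge g1 k0 ti1).
    rewrite ler_wpM2l ?mulr_ge0//; first by lra.
    apply: ler_powR_neg; [lra|lra|].
    have : i.+1%:R <= D.+1%:R :> R by rewrite ler_nat.
    by rewrite -[i.+1%:R]natr1; lra.
  apply: le_trans up.
  apply: (@le_trans _ _ (2 * pi * h%:R * (g * ((1 - g) * k * t0 `^ (g - 2))))); last first.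
    by rewrite le_eqVlt; apply/orP; left; apply/eqP; ring.
  rewrite ler_wpM2l ?(ltW p0)// (le_trans hi)// ler_wpM2l ?(ltW g0)//.
  apply: (le_trans (drop_le g1 k0 (ti i))).
  rewrite ler_wpM2l ?mulr_ge0//; first by lra.
  by apply: ler_powR_neg => //; [lra|rewrite ler_wpDr].
- move=> i iD; rewrite !df -[i.+1%:R]natr1 addrA ler_wpM2l ?(ltW p0)//.
  have ti1 : 0 < t + i%:R + 1 by have := ti i; lra.
  have /andP[lo _] := gap_dec g0 g1 k0 (ti i).
  have /andP[_ hi] := gap_dec g0 g1 k0 ti1.
  exact: le_trans hi lo.
Qed.

End exponential_sum.

Section bilinear.
Context {R : realType}.
Variable g : R.
Hypotheses (g0 : 0 < g) (g1 : g < 1).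

Lemma sum_image_le (I : finType) (D : nat) (i : I -> nat) (F : nat -> R) :
  injective i -> (forall a, (i a < D)%N) -> (forall n, 0 <= F n) ->
  \sum_a F (i a) <= \sum_(n < D) F n.
Proof.
move=> inj iD F0; pose f a := Ordinal (iD a).
have fi : injective f by move=> a b /(congr1 val)/inj.
rewrite (eq_bigr (fun a => F (f a)))//.
rewrite -(big_map f predT (fun n : 'I_D => F n)) big_uniq/=; last first.
  by rewrite map_inj_uniq ?index_enum_uniq.
rewrite [leRHS](bigID [in [seq f a | a <- index_enum I]])/=.
by rewrite lerDl sumr_ge0.
Qed.

(** After Cauchy's inequality, the sparse variable [i a] is completed to a
    full interval and only differences of the sparse variable [Y b] remain. *)
Lemma bilinear_cos (L D h : nat) (i Y : 'I_L -> nat) (t0 t1 Dk t : R) :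
  injective i -> (forall a, (i a <= D)%N) ->
  (forall b b' : 'I_L, (dist_nat b b' <= dist_nat (Y b) (Y b'))%N) ->
  (forall b b', (dist_nat (Y b) (Y b'))%:R <= Dk) ->
  0 < t0 -> (forall b, t0 <= (Y b)%:R) -> (forall b, (Y b)%:R + D.+1%:R <= t1) ->
  (0 < h)%N -> 2 * pi * h%:R * g * (1 - g) * Dk * t0 `^ (g - 2) <= 2 ->
  (\sum_a \sum_b cos (2 * pi * h%:R * (Y b + i a)%:R `^ g + t)) ^+ 2 <=
  L%:R * (L%:R * D.+1%:R + L%:R ^+ 2 +
    4 / (2 * pi * g * (1 - g) * t1 `^ (g - 2)) * (2 * L%:R * (1 + ln L%:R))).
Proof.
move=> ii iD Ydist YDk t00 Yt0 Yt1 h0 up.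
have g0' := g0; have g1' := g1; have pg : 0 < @pi R := pi_gt0 R.
set kap := 2 * pi * g * (1 - g) * t1 `^ (g - 2).
have [L0|L0] := posnP L.
  move: i Y ii iD Ydist YDk Yt0 Yt1; rewrite L0 => *.
  by rewrite big_ord0 expr0n/= mul0r.
have t10 : 0 < t1.
  by have := Yt1 (Ordinal L0); have := Yt0 (Ordinal L0); have : 0 <= D.+1%:R :> R by []; lra.
have kap0 : 0 < kap by rewrite !mulr_gt0 ?powR_gt0//; lra.
pose phi b n := 2 * pi * h%:R * (Y b + n)%:R `^ g + t.
apply: (le_trans (sqr_sum_le _)); rewrite card_ord ler_wpM2l//.
pose F n := (\sum_b cos (phi b n)) ^+ 2 + (\sum_b sin (phi b n)) ^+ 2.
apply: (@le_trans _ _ (\sum_a F (i a))).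
  by apply: ler_sum => a _; rewrite lerDl sqr_ge0.
have F0 n : 0 <= F n by rewrite addr_ge0 ?sqr_ge0.
have iD' a : (i a < D.+1)%N by rewrite ltnS.
apply: (le_trans (sum_image_le ii iD' F0)).
have -> : \sum_(n < D.+1) F n =
    \sum_b \sum_b' \sum_(n < D.+1) cos (phi b n - phi b' n).
  under eq_bigr do rewrite /F !expr2 !big_distrlr/= -big_split/=.
  rewrite exchange_big/=; apply: eq_bigr => b _.
  rewrite -exchange_big/=; apply: eq_bigr => n _.
  by rewrite -big_split/=; apply: eq_bigr => b' _; rewrite cosB.
have off (b b' : 'I_L) : b' != b ->
    \sum_(n < D.+1) cos (phi b n - phi b' n) <= 1 + 4 / kap * (dist_nat b b')%:R^-1.
  move=> bb'.
  have d0 : (0 < dist_nat b b')%N.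
    by move: bb'; rewrite /dist_nat -val_eqE/=; lia.
  suff main c c' : (Y c' <= Y c)%N -> (dist_nat b b' <= Y c - Y c')%N ->
      \sum_(n < D.+1) cos (phi c n - phi c' n) <= 1 + 4 / kap * (dist_nat b b')%:R^-1.
    have [le|lt] := leqP (Y b') (Y b).
      by apply: main => //; have := Ydist b b'; rewrite /dist_nat; lia.
    under eq_bigr do rewrite -cosN opprB.
    by apply: main; have := Ydist b b'; rewrite /dist_nat; lia.
  move=> cc dc; pose k : R := (Y c - Y c')%:R.
  have k1 : 1 <= k by rewrite ler1n; apply: leq_trans dc.
  have YY : (Y c)%:R = (Y c')%:R + k :> R by rewrite /k -natrD subnKC.
  have -> : \sum_(n < D.+1) cos (phi c n - phi c' n) =
      \sum_(n < D.+1) cos (2 * pi * h%:R * gap g k ((Y c')%:R + n%:R)).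
    apply: eq_bigr => n _; congr cos; rewrite /phi /gap !natrD YY.
    by rewrite [_ + k + _]addrAC; ring.
  have K : k <= Dk by apply: le_trans (YDk c c'); rewrite ler_nat /dist_nat; lia.
  have upk : 2 * pi * h%:R * g * (1 - g) * k * t0 `^ (g - 2) <= 2.
    apply: le_trans up; rewrite ler_wpM2r ?powR_ge0// ler_wpM2l//.
    by rewrite !mulr_ge0//; lra.
  have t1' : (Y c')%:R + k + D.+1%:R <= t1 by rewrite -YY.
  apply: (le_trans (ler_norm _)).
  apply: (le_trans (sum_cos_gap g0 g1 h0 k1 t00 (Yt0 c') t1' upk)).
  rewrite lerD2l invfM mulrA ler_wpM2l ?(divr_ge0 _ (ltW kap0))//.
  have kp : 0 < k by rewrite (lt_le_trans ltr01).
  have dp : 0 < (dist_nat b b')%:R :> R by rewrite ltr0n.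
  by rewrite lef_pV2 ?posrE// /k ler_nat.
apply: (@le_trans _ _ (\sum_(b < L) (D.+1%:R + (L%:R + 4 / kap * (2 * (1 + ln L%:R)))))).
  apply: ler_sum => b _; rewrite (bigD1 b)//= lerD//.
    under eq_bigr do rewrite subrr cos0.
    by rewrite sumr_const card_ord.
  apply: (le_trans (ler_sum _ (off b))).
  rewrite big_split/= -mulr_sumr lerD//.
    by rewrite sumr_const ler_nat (leq_trans (max_card _))// card_ord.
  by rewrite ler_wpM2l ?(divr_ge0 _ (ltW kap0))// sum_inv_dist.
rewrite sumr_const card_ord -mulr_natl le_eqVlt; apply/orP; left; apply/eqP.
ring.
Qed.

End bilinear.

(** * Counting floors of powers along a box *)

Section windows.
Context {R : realType}.

Lemma cos_intpi (x : R) (n : int) : cos (x + 2 * pi * n%:~R) = cos x.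
Proof.
case: (intP n) => [|k|k]; first by rewrite mulr0 addr0.
  by rewrite cos_natpi.
by rewrite mulrNz mulrN -[LHS](cos_natpi _ k.+1) subrK.
Qed.

Definition frac (x : R) : R := x - (Num.floor x)%:~R.

Lemma frac_itv x : 0 <= frac x < 1.
Proof.
by have := floor_itv x; rewrite intrD /frac => /andP[? ?]; apply/andP; split; lra.
Qed.

Lemma cos_frac (h : nat) (x t : R) :
  cos (2 * pi * h%:R * frac x + t) = cos (2 * pi * h%:R * x + t).
Proof.
rewrite -[RHS](cos_intpi _ (- (h%:Z * Num.floor x))); congr cos.
by rewrite /frac mulrNz intrM; ring.
Qed.

(** An integer lies in [[x, x + w)] iff [1/2 - x] reduces into the arc that
    starts at [1/2]; that arc stays away from the cut of the circle. *)
Lemma frac_arc (x w : R) : 0 < w -> w <= 1 / 2 ->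
  (1 / 2 <= frac (1 / 2 - x) < 1 / 2 + w) = ((Num.ceil x)%:~R < x + w).
Proof.
move=> w0 w2.
have c1 : (Num.ceil x)%:~R - 1 < x by have := ceilB1_lt x; rewrite intrB.
have c2 : x <= (Num.ceil x)%:~R := ceil_ge x.
have fl : Num.floor (1 / 2 - x) =
    if (Num.ceil x)%:~R - x < 1 / 2 then - Num.ceil x else 1 - Num.ceil x.
  apply/eqP; rewrite floor_eq; case: ltP => h.
    by rewrite intrD mulrNz; apply/andP; split; lra.
  by rewrite !intrD mulrNz; apply/andP; split; lra.
rewrite /frac fl; case: ltP => h.
  by rewrite mulrNz; apply/idP/idP => [/andP[? ?]|?]; [|apply/andP; split]; lra.
by rewrite intrD mulrNz; apply/idP/idP => [/andP[? ?]|?]; [|apply/andP; split]; lra.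
Qed.

Lemma ln_lt_powR (A p : R) : 0 < A -> 0 < p ->
  exists2 x0, 0 < x0 & forall x, x0 <= x -> A * (1 + ln x) <= x `^ p.
Proof.
move=> A0 p0; have p2 : 0 < p / 2 by rewrite divr_gt0.
pose B := A * (1 + 2 / p).
have B0 : 0 < B by rewrite mulr_gt0// addr_gt0// divr_gt0.
exists (Num.max 1 (B `^ (p / 2)^-1)) => [|x]; first by rewrite lt_max ltr01.
rewrite ge_max => /andP[x1 xB]; have x0 : 0 < x by apply: lt_le_trans x1.
have xp : B <= x `^ (p / 2).
  have -> : B = (B `^ (p / 2)^-1) `^ (p / 2).
    by rewrite -powRrM mulVf ?gt_eqF// powRr1 ?ltW.
  by apply: ge0_ler_powR; rewrite ?nnegrE ?powR_ge0// ltW.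
have l : ln x <= 2 / p * x `^ (p / 2).
  have := ltW (ln_sublinear (powR_gt0 (p / 2) x0)).
  rewrite ln_powR -(ler_pM2l (_ : 0 < 2 / p)) ?divr_gt0//.
  by rewrite mulrA (_ : 2 / p * (p / 2) = 1) ?mul1r//; field; rewrite gt_eqF.
have o : 1 <= x `^ (p / 2).
  by have := ler_powR x1 (ltW p2); rewrite powRr0.
have -> : x `^ p = x `^ (p / 2) * x `^ (p / 2).
  by rewrite -powRD; [congr (_ `^ _); field|rewrite (gt_eqF x0) implybT].
apply: (@le_trans _ _ (B * x `^ (p / 2))); last by rewrite ler_wpM2r ?powR_ge0.
by rewrite /B -mulrA (ler_wpM2l (ltW A0))// mulrDl mul1r lerD.
Qed.

(** The values [N] that are of the form [floor (m ^ c)] for a natural [m],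
    with [g = 1 / c]. *)
Definition hit (g : R) (N : nat) : bool :=
  (Num.ceil (N%:R `^ g))%:~R < N.+1%:R `^ g.

Lemma powR_succ_diff (g x : R) : 0 < g -> g < 1 -> 0 < x ->
  g * (x + 1) `^ (g - 1) <= (x + 1) `^ g - x `^ g <= g * x `^ (g - 1).
Proof.
move=> g0 g1 x0; have x1 : x <= x + 1 by rewrite lerDl.
have [y /andP[xy yx] ->] := MVT_powR g x0 x1.
have y0 := lt_le_trans x0 xy.
have gn : g - 1 <= 0 by rewrite subr_le0 ltW.
by rewrite addrAC subrr add0r mulr1 !ler_pM2l// !ler_powR_neg.
Qed.

Lemma hit_arc (g : R) (N : nat) :
  hit g N = ((Num.ceil (N%:R `^ g))%:~R < N%:R `^ g + (N.+1%:R `^ g - N%:R `^ g)).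
Proof. by rewrite /hit subrKC. Qed.

(** Whether [N] is hit means that [- N ^ g] reduces modulo [1] into an arc of
    length [(N + 1) ^ g - N ^ g].  When these lengths are within a factor
    [1 +- 2 * e] of [w], the hits are caught between two arcs of fixed
    length, and arcs are counted by [arc_count]. *)
Lemma window_count (S : finType) (N : S -> nat) (g w e E : R) (K : nat) :
  0 < g -> g < 1 -> (forall s, (0 < N s)%N) ->
  (forall s, w * (1 - 2 * e) <= (N s).+1%:R `^ g - (N s)%:R `^ g <= w * (1 + 2 * e)) ->
  0 < e -> e <= 1 / 20 -> 0 < w -> w <= 1 / 16 -> 0 <= E ->
  (forall h t, (0 < h)%N -> (h < 2 * K)%N ->
    `|\sum_s cos (2 * pi * h%:R * (N s)%:R `^ g + t)| <= E) ->
  1 <= e ^+ 2 * (w * (1 - 2 * e)) * K%:R -> E * K%:R <= 2 * e ^+ 2 * #|S|%:R ->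
  `|#|[pred s | hit g (N s)]|%:R - w * #|S|%:R| <= 24 * e * (w * #|S|%:R).
Proof.
move=> g0 g1 N0 Nw e0 e1 w0 w16 E0 hE Kw EK.
set wm := w * (1 - 2 * e) in Nw Kw; set wp := w * (1 + 2 * e) in Nw.
have we : 0 < w * e by rewrite mulr_gt0.
have we20 : w * e <= w / 20 by rewrite ler_pM2l//; lra.
have wm0 : 0 < wm by rewrite /wm; lra.
have wmp : wm <= wp by rewrite /wm /wp; lra.
have wp8 : wp <= 1 / 8 by rewrite /wp; lra.
pose y s := frac (1 / 2 - (N s)%:R `^ g).
have y01 s : 0 <= y s < 1 by exact: frac_itv.
have yE h t : (0 < h)%N -> (h < 2 * K)%N -> `|\sum_s cos (2 * pi * h%:R * y s + t)| <= E.
  move=> h0 hK; have := hE h (- (pi * h%:R + t)) h0 hK.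
  rewrite (eq_bigr (fun s => cos (2 * pi * h%:R * y s + t)))//.
  by move=> s _; rewrite cos_frac -[RHS]cosN; congr cos; field.
have arcE w' : 0 < w' -> w' <= 1 / 8 -> forall s,
    (1 / 2 <= y s < 1 / 2 + w') = ((Num.ceil ((N s)%:R `^ g))%:~R < (N s)%:R `^ g + w').
  by move=> w'0 w'8 s; rewrite frac_arc//; lra.
have Kp : 1 <= e ^+ 2 * wp * K%:R.
  by apply: (le_trans Kw); rewrite ler_wpM2r// ler_wpM2l// sqr_ge0.
have wp0 := lt_le_trans wm0 wmp; have wm8 := le_trans wmp wp8.
have := arc_count y01 E0 yE e0 e1 wm0 wm8 Kw EK.
have := arc_count y01 E0 yE e0 e1 wp0 wp8 Kp EK.
set Ap := #|[pred s | 1 / 2 <= y s < 1 / 2 + wp]|.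
set Am := #|[pred s | 1 / 2 <= y s < 1 / 2 + wm]|.
set A := #|[pred s | hit g (N s)]|.
have hp : A%:R <= Ap%:R :> R.
  rewrite ler_nat subset_leq_card//; apply/fintype.subsetP => s; rewrite !inE.
  rewrite hit_arc arcE// => h; apply: (lt_le_trans h); rewrite lerD2l.
  by have /andP[] := Nw s.
have hm : Am%:R <= A%:R :> R.
  rewrite ler_nat subset_leq_card//; apply/fintype.subsetP => s; rewrite !inE.
  rewrite hit_arc arcE// => h; apply: (lt_le_trans h); rewrite lerD2l.
  by have /andP[] := Nw s.
have M0 : 0 <= w * #|S|%:R by rewrite mulr_ge0// ltW.
have wmM : wm * #|S|%:R = w * #|S|%:R * (1 - 2 * e) by rewrite /wm; ring.
have wpM : wp * #|S|%:R = w * #|S|%:R * (1 + 2 * e) by rewrite /wp; ring.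
rewrite wmM wpM; move: (w * #|S|%:R) M0 => X X0.
have Xe : 0 <= X * e by rewrite mulr_ge0// ltW.
have Xee : 0 <= X * e * e by rewrite mulr_ge0// ltW.
have Xe2 : X * e * e <= X * e / 20 by rewrite ler_wpM2l//; lra.
move=> /ler_normlP[_ hu] /ler_normlP[hl _]; clear -hu hl hp hm X0 Xe Xe2 Xee.
by rewrite ler_norml; apply/andP; split; lra.
Qed.

End windows.

Section parameters.
Context {R : realType}.

(** All the numbers of a short interval around [N0] have nearly the same gap
    between consecutive [g]-th powers. *)
Lemma window_range (g N0 e : R) (N : nat) :
  0 < g -> g < 1 -> 0 < N0 -> 0 < e -> e <= 1 / 20 ->
  N0 * (1 - e) <= N%:R -> N%:R + 1 <= N0 * (1 + e) ->
  g * N0 `^ (g - 1) * (1 - 2 * e) <= N.+1%:R `^ g - N%:R `^ g <=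
    g * N0 `^ (g - 1) * (1 + 2 * e).
Proof.
move=> g0 g1 N00 e0 e1 lo hi.
have em : 0 < 1 - e by lra.
have ep : 0 < 1 + e by lra.
have N1 : 0 < N%:R :> R by apply: lt_le_trans lo; rewrite mulr_gt0.
have /andP[l u] := powR_succ_diff g0 g1 N1.
have gn : g - 1 <= 0 by lra.
rewrite -[N.+1%:R]natr1; apply/andP; split.
  apply: le_trans l; rewrite -mulrA ler_pM2l//.
  apply: (@le_trans _ _ ((N0 * (1 + e)) `^ (g - 1))); last first.
    by apply: ler_powR_neg => //; lra.
  rewrite (powRM _ (ltW N00) (ltW ep)) (ler_wpM2l (powR_ge0 _ _))//.
  apply: (@le_trans _ _ ((1 + e) `^ (- 1))); last by rewrite ler_powR//; lra.
  rewrite (powR_inv1 (ltW ep)) -(ler_pM2r ep) mulVf ?gt_eqF//.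
  have : 0 <= e * e by rewrite mulr_ge0// ltW.
  by lra.
apply: (le_trans u); rewrite -mulrA ler_pM2l//.
apply: (@le_trans _ _ ((N0 * (1 - e)) `^ (g - 1))).
  by apply: ler_powR_neg => //; rewrite mulr_gt0.
rewrite (powRM _ (ltW N00) (ltW em)) (ler_wpM2l (powR_ge0 _ _))//.
apply: (@le_trans _ _ ((1 - e) `^ (- 1))).
  by rewrite ger_powR ?em//=; lra.
rewrite (powR_inv1 (ltW em)) -(ler_pM2r em) mulVf ?gt_eqF//.
have : 0 <= e * (1 / 20 - e) by rewrite mulr_ge0//; lra.
by lra.
Qed.

(* Names a positive constant while hiding its body from unification. *)
Lemma pos_abstract (x : R) : 0 < x -> exists2 y, y = x & 0 < y.
Proof. by exists x. Qed.

(* The range of frequencies needed to detect an arc of length about [w]. *)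
Lemma frequency_cutoff (e w : R) : 0 < e -> e <= 1 / 20 -> 0 < w -> w <= 1 / 16 ->
  exists2 K : nat, (0 < K)%N &
    1 <= e ^+ 2 * (w * (1 - 2 * e)) * K%:R /\ K%:R <= 4 / (e ^+ 2 * w).
Proof.
move=> e0 e1 w0 w16; have we : w * e <= w / 20 by rewrite ler_pM2l//; lra.
pose wm := w * (1 - 2 * e).
have wmw : w / 2 <= wm by rewrite /wm; lra.
have wmu : wm <= w by have := mulr_ge0 (ltW w0) (ltW e0); rewrite /wm; lra.
have wm0 : 0 < wm by lra.
have e2 : 0 < e ^+ 2 by rewrite exprn_gt0.
have e21 : e ^+ 2 <= 1 by rewrite expr_le1//; lra.
have ewm0 : 0 < e ^+ 2 * wm by rewrite mulr_gt0.
exists (Num.truncn (1 / (e ^+ 2 * wm))).+1 => //.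
have /andP[Kl Ku] := truncn_itv (divr_ge0 ler01 (ltW ewm0)).
split; first by move: Ku; rewrite ltr_pdivrMr// mulrC => /ltW.
rewrite ler_pdivlMr ?mulr_gt0// -natr1.
move: Kl; rewrite ler_pdivlMr//; set k := (Num.truncn _)%:R => Kl.
have k0 : 0 <= k by rewrite /k.
have : (k + 1) * (e ^+ 2 * w) <= (k + 1) * (2 * (e ^+ 2 * wm)).
  rewrite ler_wpM2l ?addr_ge0// (_ : 2 * (e ^+ 2 * wm) = e ^+ 2 * (2 * wm)); last by ring.
  by rewrite ler_wpM2l ?sqr_ge0//; lra.
have : e ^+ 2 * wm <= 1 * 1 by rewrite ler_pM ?sqr_ge0 ?(ltW wm0)//; lra.
by lra.
Qed.

(** Up to constants the left-hand side is [L ^ 2 * lam ^ (2 - g) * ln lam],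
    while on the right [L] is about [lam ^ g] and [K] about [lam ^ (1 - g)];
    the quotient is [lam ^ (5 * g - 4)] against a logarithm. *)
Lemma exp_sum_small (g d C0 CK e : R) : 4 / 5 < g -> g < 1 -> 0 < d -> 0 < C0 ->
  0 < CK -> 0 < e ->
  exists2 x0 : R, 0 < x0 & forall lam : R, 1 <= lam -> x0 <= lam ->
  forall L D K : nat, d * lam `^ g / 2 <= L%:R -> L%:R <= lam ->
  D.+1%:R <= C0 * lam -> (0 < K)%N -> K%:R <= CK * lam `^ (1 - g) ->
  L%:R * (L%:R * D.+1%:R + L%:R ^+ 2 +
    4 / (2 * pi * g * (1 - g) * (4 * lam) `^ (g - 2)) * (2 * L%:R * (1 + ln L%:R)))
  <= (2 * e ^+ 2 * L%:R ^+ 2 / K%:R) ^+ 2.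
Proof.
move=> g45 g1 d0 C00 CK0 e0; have g0 : 0 < g by lra.
have pg : 0 < @pi R := pi_gt0 R.
have [|kap0 kapE kap00] := @pos_abstract (2 * pi * g * (1 - g) * 4 `^ (g - 2)).
  by rewrite !mulr_gt0 ?powR_gt0//; lra.
have [|C' C'E C'0] := @pos_abstract (C0 + 1 + 8 / kap0).
  by rewrite !addr_gt0// divr_gt0.
have [|A AE A0] := @pos_abstract (C' * CK ^+ 2 / (e ^+ 4 * d ^+ 2)).
  by rewrite divr_gt0 ?mulr_gt0 ?exprn_gt0.
have [|x0 x00 hx] := @ln_lt_powR R A (5 * g - 4) A0; first by lra.
exists x0 => // lam lam1 lamx L D K Ld Ll DC K0 KCK.
have lam0 : 0 < lam by apply: lt_le_trans lam1.
have LR : 0 < L%:R :> R.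
  by apply: lt_le_trans Ld; rewrite divr_gt0// mulr_gt0// powR_gt0.
have KR : 0 < K%:R :> R by rewrite ltr0n.
have P (a b : R) : lam `^ a * lam `^ b = lam `^ (a + b).
  by rewrite powRD// (gt_eqF lam0) implybT.
have lnl : 0 <= ln lam by rewrite ln_ge0.
have lnL : ln L%:R <= ln lam by rewrite ler_ln ?posrE.
pose Q := lam `^ (2 - g); have Ql : lam <= Q.
  by rewrite -{1}(powRr1 (ltW lam0)) ler_powR//; lra.
have Q0 : 0 < Q by apply: lt_le_trans Ql.
have kq : (2 * pi * g * (1 - g) * (4 * lam) `^ (g - 2))^-1 = Q / kap0.
  rewrite powRM ?(ltW lam0)// mulrA -kapE invfM mulrC; congr (_ / _).
  by rewrite -powRN /Q; congr (_ `^ _); ring.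
rewrite kq.
pose Z := L%:R ^+ 2 * (C' * (Q * (1 + ln lam))).
apply: (@le_trans _ _ Z).
  have QlnL : Q * (1 + ln L%:R) <= Q * (1 + ln lam) by rewrite ler_pM2l//; lra.
  have QQ : Q <= Q * (1 + ln lam) by rewrite ler_peMr ?(ltW Q0)//; lra.
  have -> : L%:R * (L%:R * D.+1%:R + L%:R ^+ 2 + 4 * (Q / kap0) * (2 * L%:R * (1 + ln L%:R)))
     = L%:R ^+ 2 * (D.+1%:R + L%:R + 8 / kap0 * (Q * (1 + ln L%:R))) by ring.
  rewrite /Z C'E ler_wpM2l ?sqr_ge0// (mulrDl (C0 + 1)) (mulrDl C0) mul1r.
  rewrite (lerD (lerD _ _))//.
  - by apply: (le_trans DC); rewrite ler_pM2l//; lra.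
  - by lra.
  - by rewrite ler_wpM2l// divr_ge0// ltW.
pose B := CK * lam `^ (1 - g); have B0 : 0 < B by rewrite mulr_gt0// powR_gt0.
apply: (@le_trans _ _ ((2 * e ^+ 2 * L%:R ^+ 2 / B) ^+ 2)); last first.
  have n0 : 0 <= 2 * e ^+ 2 * L%:R ^+ 2 by rewrite mulr_ge0 ?sqr_ge0// mulr_ge0 ?sqr_ge0.
  rewrite lerXn2r ?nnegrE ?(divr_ge0 n0) ?(ltW B0)//.
  by rewrite ler_wpM2l// lef_pV2.
have -> : (2 * e ^+ 2 * L%:R ^+ 2 / B) ^+ 2 = L%:R ^+ 2 * (4 * e ^+ 4 / B ^+ 2 * L%:R ^+ 2).
  by field; rewrite gt_eqF.
rewrite ler_wpM2l ?sqr_ge0//.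
apply: (@le_trans _ _ (4 * e ^+ 4 / B ^+ 2 * (d * lam `^ g / 2) ^+ 2)); last first.
  have n0 : 0 <= 4 * e ^+ 4 by rewrite mulr_ge0// exprn_ge0// ltW.
  rewrite ler_wpM2l ?(divr_ge0 n0) ?sqr_ge0//.
  by rewrite lerXn2r ?nnegrE ?(ltW LR)// divr_ge0// mulr_ge0 ?powR_ge0 ?(ltW d0).
have l2 : lam `^ (5 * g - 4) * Q * (lam `^ (1 - g)) ^+ 2 = (lam `^ g) ^+ 2.
  by rewrite !expr2 /Q !P; congr (_ `^ _); ring.
have -> : 4 * e ^+ 4 / B ^+ 2 * (d * lam `^ g / 2) ^+ 2 =
    e ^+ 4 * d ^+ 2 / CK ^+ 2 * (lam `^ (5 * g - 4) * Q).
  rewrite /B !exprMn -l2; field.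
  by rewrite !gt_eqF ?powR_gt0.
have -> : C' * (Q * (1 + ln lam)) = e ^+ 4 * d ^+ 2 / CK ^+ 2 * (A * (1 + ln lam) * Q).
  by rewrite AE; field; rewrite !gt_eqF.
have n0 : 0 <= e ^+ 4 * d ^+ 2 by rewrite mulr_ge0// exprn_ge0// ltW.
by rewrite ler_wpM2l ?(divr_ge0 n0) ?sqr_ge0// ler_wpM2r ?(ltW Q0)// hx.
Qed.

End parameters.

Section box_count.
Context {R : realType}.

(** The number of representations whose first two coordinates run through a
    box.  The exponential sums are smaller than the main term by a power of
    [lam] because [5 * g > 4]; the side [d] of the box has to be small for
    the phases to be slowly varying, and for [N] to be nearly constant. *)
Lemma box_count (g c1 C0 e : R) : 4 / 5 < g -> g < 1 -> 0 < c1 -> c1 <= 1 ->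
  0 < C0 -> 0 < e ->
  exists2 d0 : R, 0 < d0 & forall d, 0 < d -> d <= d0 ->
  exists2 l0 : R, 0 < l0 & forall lam, l0 <= lam ->
  forall (L D : nat) (i Y : 'I_L -> nat) (N0 : R),
  d * lam `^ g / 2 <= L%:R -> L%:R <= d * lam `^ g ->
  injective i -> (forall a, (i a <= D)%N) -> D.+1%:R <= C0 * d * lam ->
  (forall b b' : 'I_L, (dist_nat b b' <= dist_nat (Y b) (Y b'))%N) ->
  (forall b b', (dist_nat (Y b) (Y b'))%:R <= C0 * d * lam) ->
  (forall b, c1 * lam <= (Y b)%:R) -> (forall b, (Y b)%:R + D.+1%:R <= 4 * lam) ->
  (forall a b, `|(Y b + i a)%:R - N0| <= C0 * d * lam) ->
  `|#|[pred s : 'I_L * 'I_L | hit g (Y s.2 + i s.1)]|%:R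
     - g * N0 `^ (g - 1) * L%:R ^+ 2| <= e * (lam `^ (g - 1) * L%:R ^+ 2).
Proof.
move=> g45 g1 c10 c11 C00 e0; have g0 : 0 < g by lra.
have [|W WE W0] := @pos_abstract R ((c1 / 2) `^ (g - 1)).
  by rewrite powR_gt0//; lra.
pose e' := Num.min (1 / 20) (e / (24 * W)).
have e'0 : 0 < e' by rewrite lt_min !divr_gt0// mulr_gt0.
have e'1 : e' <= 1 / 20 by rewrite ge_min lexx.
have e'e : 24 * e' * W <= e.
  have : e' <= e / (24 * W) by rewrite ge_min lexx orbT.
  by rewrite ler_pdivlMr ?mulr_gt0//; lra.
have [|CK CKE CK0] := @pos_abstract R (4 / (e' ^+ 2 * (g * 5 `^ (g - 1)))).
  by rewrite divr_gt0// !mulr_gt0 ?powR_gt0 ?exprn_gt0.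
have [|cc ccE cc0] := @pos_abstract R (c1 `^ (g - 2)); first by rewrite powR_gt0.
pose d0 := Num.min (Num.min 1 (e' * c1 / (4 * C0))) (1 / (8 * CK * C0 * cc)).
exists d0.
  by rewrite !lt_min ltr01/=; apply/andP; split; rewrite divr_gt0 ?mulr_gt0.
move=> d dp; rewrite !le_min => /andP[/andP[d1 dc] dK].
have {}dc : C0 * d <= e' * c1 / 4.
  by move: dc; rewrite !ler_pdivlMr ?mulr_gt0//; lra.
have {}dK : 8 * CK * C0 * cc * d <= 1.
  by move: dK; rewrite ler_pdivlMr ?mulr_gt0//; lra.
have [x0 x00 hx] := exp_sum_small g45 g1 dp C00 CK0 e'0.
pose l1 := (16 * W) `^ (1 - g)^-1.
exists (Num.max (Num.max 1 (4 / (e' * c1))) (Num.max x0 l1)).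
  by rewrite !lt_max ltr01.
move=> lam; rewrite !ge_max => /andP[/andP[lam1 lamc] /andP[lamx laml]].
move=> L D i Y N0 Ld Lu ii iD DC Ydist YDk Yc Y4 YN.
have lam0 : 0 < lam by apply: lt_le_trans lam1.
have LR : 0 < L%:R :> R.
  by apply: lt_le_trans Ld; rewrite divr_gt0// mulr_gt0// powR_gt0.
have L0 : (0 < L)%N by rewrite -(ltr0n R).
have [N0l [N0u [Nlo Nhi]]] : c1 * lam / 2 <= N0 /\ N0 <= 5 * lam /\
    (forall a b, N0 * (1 - e') <= (Y b + i a)%:R) /\
    (forall a b, (Y b + i a)%:R + 1 <= N0 * (1 + e')).
  have C0dl : C0 * d * lam <= e' * (c1 * lam) / 4.
    by have := ler_wpM2r (ltW lam0) dc; clear; lra.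
  have lamc' : 4 <= e' * (c1 * lam).
    by move: lamc; rewrite ler_pdivrMr ?mulr_gt0//; clear; lra.
  have c1lam : 0 < c1 * lam by rewrite mulr_gt0.
  have e'c : e' * (c1 * lam) <= c1 * lam / 20.
    by have := ler_wpM2r (ltW c1lam) e'1; clear; lra.
  have c1l : c1 * lam <= lam by rewrite ler_piMl// ltW.
  pose o := Ordinal L0.
  have N0l : c1 * lam / 2 <= N0.
    have /ler_normlP[_] := YN o o; have := Yc o; rewrite natrD.
    have : 0 <= (i o)%:R :> R by []; move: C0dl e'c c1lam; clear; lra.
  have e'N : e' * (c1 * lam / 2) <= e' * N0 by rewrite ler_pM2l.
  split => //; split.
    have /ler_normlP[] := YN o o; have := Y4 o; rewrite natrD.
    have : (i o)%:R <= D.+1%:R :> R by rewrite ler_nat ltnW// ltnS.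
    by move: C0dl c1l e'c c1lam; clear; lra.
  split=> a b; have /ler_normlP[] := YN a b;
    move: C0dl lamc' e'N c1lam; clear; lra.
have N00 : 0 < N0 by have := mulr_gt0 c10 lam0; move: N0l; clear; lra.
have [|w wE w0] := @pos_abstract R (g * N0 `^ (g - 1)); first by rewrite mulr_gt0 ?powR_gt0.
have gn : g - 1 <= 0 by move: g1; clear; lra.
have wu : w <= W * lam `^ (g - 1).
  rewrite wE; apply: (@le_trans _ _ (N0 `^ (g - 1))).
    by rewrite ler_piMl ?powR_ge0// ltW.
  rewrite WE -powRM ?(ltW lam0)//; last by rewrite divr_ge0// ltW.
  by apply: ler_powR_neg => //; [rewrite mulr_gt0// divr_gt0|move: N0l; clear; lra].
have wl : g * 5 `^ (g - 1) * lam `^ (g - 1) <= w.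
  by rewrite wE -mulrA ler_pM2l// -powRM ?(ltW lam0)// ler_powR_neg.
have lamV : lam `^ (1 - g) = (lam `^ (g - 1))^-1.
  by rewrite -powRN; congr (_ `^ _); ring.
have w16 : w <= 1 / 16.
  apply: (le_trans wu).
  have h : 16 * W <= lam `^ (1 - g).
    have g1' : 0 < 1 - g by rewrite subr_gt0.
    have -> : 16 * W = l1 `^ (1 - g).
      by rewrite /l1 -powRrM mulVf ?powRr1 ?mulr_ge0 ?(ltW W0)// gt_eqF.
    by apply: ge0_ler_powR; rewrite ?nnegrE ?powR_ge0 ?(ltW g1') ?(ltW lam0).
  have := ler_wpM2r (powR_ge0 lam (g - 1)) h.
  by rewrite lamV mulVf ?gt_eqF ?powR_gt0//; clear; lra.
have [K K0 [Kw Ku]] := frequency_cutoff e'0 e'1 w0 w16.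
have KR : 0 < K%:R :> R by rewrite ltr0n.
have KCK : K%:R <= CK * lam `^ (1 - g).
  apply: (le_trans Ku); rewrite CKE lamV -[leRHS]mulrA -invfM ler_pM2l//.
  rewrite lef_pV2 ?posrE ?mulr_gt0 ?exprn_gt0 ?powR_gt0//.
  by rewrite -mulrA ler_pM2l ?exprn_gt0.
pose E := 2 * e' ^+ 2 * L%:R ^+ 2 / K%:R.
have E0 : 0 <= E by rewrite divr_ge0 ?ler0n// mulr_ge0 ?sqr_ge0// mulr_ge0 ?sqr_ge0.
have lamg : lam `^ g <= lam by apply: ler1_powR => //; exact: ltW.
have Ll : L%:R <= lam.
  by apply: (le_trans Lu); apply: le_trans lamg; rewrite ler_piMl ?powR_ge0.
have DC' : D.+1%:R <= C0 * lam.
  apply: (le_trans DC); rewrite ler_wpM2r ?(ltW lam0)//.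
  by rewrite ler_piMr ?(ltW C00).
have c1lam : 0 < c1 * lam by rewrite mulr_gt0.
have cosE h t : (0 < h)%N -> (h < 2 * K)%N ->
    `|\sum_(s : 'I_L * 'I_L) cos (2 * pi * h%:R * (Y s.2 + i s.1)%:R `^ g + t)| <= E.
  move=> h0 hK.
  rewrite -(ler_pXn2r (_ : 0 < 2)%N) ?nnegrE// real_normK ?num_real//.
  rewrite -(pair_bigA _ (fun a b => cos (2 * pi * h%:R * (Y b + i a)%:R `^ g + t)))/=.
  apply: le_trans (hx _ lam1 lamx L D K Ld Ll DC' K0 KCK).
  apply: (bilinear_cos g0 g1 t ii iD Ydist YDk c1lam Yc Y4 h0).
  have hCK : h%:R <= 2 * (CK * lam `^ (1 - g)).
    apply: (@le_trans _ _ (2 * K%:R)); last by rewrite ler_pM2l.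
    by rewrite -natrM ler_nat ltnW.
  have p4 : @pi R <= 4 by have := @pihalf_lt2 R; clear; lra.
  have lamI : lam `^ (1 - g) * (lam * lam `^ (g - 2)) = 1.
    rewrite -{2}(powRr1 (ltW lam0)) -!powRD ?(gt_eqF lam0) ?implybT//.
    by rewrite (_ : _ + _ = 0) ?powRr0//; ring.
  rewrite powRM ?(ltW lam0) ?(ltW c10)// -ccE.
  rewrite (_ : _ * _ = pi * h%:R * (g * (1 - g)) * (2 * (C0 * d * cc) * (lam * lam `^ (g - 2)))); last by ring.
  have X0 : 0 <= 2 * (C0 * d * cc) * (lam * lam `^ (g - 2)).
    by rewrite !mulr_ge0 ?powR_ge0// ltW.
  apply: (@le_trans _ _ (4 * (2 * (CK * lam `^ (1 - g))) * 1 * (2 * (C0 * d * cc) * (lam * lam `^ (g - 2))))).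
    rewrite ler_wpM2r//.
    have gg : 0 <= g * (1 - g) by rewrite mulr_ge0 ?(ltW g0)// subr_ge0 ltW.
    have gg1 : g * (1 - g) <= 1.
      by rewrite mulr_ile1 ?(ltW g0) ?(ltW g1) ?subr_ge0 ?(ltW g1)// gerBl ltW.
    apply: ler_pM => //; first by rewrite (mulr_ge0 (pi_ge0 R)).
    by apply: ler_pM => //; exact: pi_ge0.
  rewrite (_ : _ * _ = 2 * (8 * CK * C0 * cc * d) * (lam `^ (1 - g) * (lam * lam `^ (g - 2)))); last by ring.
  by rewrite lamI mulr1; move: dK; clear; lra.
have EK : E * K%:R <= 2 * e' ^+ 2 * #|{: 'I_L * 'I_L}|%:R.
  by rewrite card_prod card_ord natrM -expr2 /E divfK// gt_eqF.
have N0' s : (0 < Y (s : 'I_L * 'I_L).2 + i s.1)%N.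
  by rewrite -(ltr0n R) natrD ltr_wpDr// (lt_le_trans c1lam).
have Nw s : w * (1 - 2 * e') <= (Y (s : 'I_L * 'I_L).2 + i s.1).+1%:R `^ g - (Y s.2 + i s.1)%:R `^ g
    <= w * (1 + 2 * e').
  by rewrite wE; apply: window_range.
have := window_count g0 g1 N0' Nw e'0 e'1 w0 w16 E0 cosE Kw EK.
rewrite card_prod card_ord natrM -expr2 -wE => h; apply: (le_trans h).
rewrite [leRHS]mulrA [leLHS]mulrA ler_wpM2r ?sqr_ge0//.
have := ler_wpM2r (powR_ge0 lam (g - 1)) e'e.
have : 24 * e' * w <= 24 * e' * (W * lam `^ (g - 1)).
  by rewrite ler_wpM2l// mulr_ge0// ltW.
by clear; lra.
Qed.

End box_count.

(** * The sequence of floors of powers *)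

Section floor_powers.
Context {R : realType}.
Variable c : R.
Hypothesis c1 : 1 < c.
Let g := c^-1.
Implicit Types k N : nat.

Definition floor_pow k : nat := Num.truncn (k%:R `^ c : R).

Let c0 : 0 < c. Proof. exact: lt_trans c1. Qed.
Let g0 : 0 < g. Proof. by rewrite invr_gt0. Qed.
Let g1 : g < 1. Proof. by rewrite invf_lt1. Qed.

Lemma powRcK (x : R) : 0 <= x -> (x `^ c) `^ g = x.
Proof. by move=> x0; rewrite -powRrM mulfV ?gt_eqF// powRr1. Qed.

Lemma powRgK (x : R) : 0 <= x -> (x `^ g) `^ c = x.
Proof. by move=> x0; rewrite -powRrM mulVf ?gt_eqF// powRr1. Qed.

Lemma ler_powRc (x y : R) : 0 <= x -> 0 <= y -> (x `^ c <= y `^ c) = (x <= y).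
Proof.
move=> x0 y0; apply/idP/idP => h; last by apply: ge0_ler_powR; rewrite ?nnegrE// ltW.
rewrite -(powRcK x0) -(powRcK y0); apply: ge0_ler_powR => //; rewrite ?nnegrE ?powR_ge0//.
exact: ltW.
Qed.

Lemma floor_pow_itv k : (floor_pow k)%:R <= k%:R `^ c :> R /\ k%:R `^ c < (floor_pow k)%:R + 1 :> R.
Proof.
by have /andP[? ?] := truncn_itv (powR_ge0 (k%:R : R) c); split=> //; rewrite natr1.
Qed.

Lemma floor_powE k N : (floor_pow k == N) = (N%:R `^ g <= k%:R :> R) && (k%:R < N.+1%:R `^ g :> R).
Proof.
rewrite -[X in X <= _]/(N%:R `^ g) -[k%:R < _]/((k%:R : R) < N.+1%:R `^ g).
rewrite -(ler_powRc (powR_ge0 _ _) (ler0n _ k)) ltNge.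
rewrite -(ler_powRc (powR_ge0 _ _) (ler0n _ k)) -ltNge !powRgK//.
rewrite /floor_pow; apply/eqP/idP => [<-|]; first exact/truncn_itv/powR_ge0.
by move=> h; apply: truncn_def.
Qed.

Lemma floor_powS k : ((floor_pow k).+1 <= floor_pow k.+1)%N.
Proof.
have h : k%:R `^ c + 1 <= k.+1%:R `^ c :> R.
  have [->|k0] := posnP k; first by rewrite powR0 ?gt_eqF// powR1 add0r.
  have kR : 0 < k%:R :> R by rewrite ltr0n.
  have kk : k%:R <= k.+1%:R :> R by rewrite ler_nat.
  have [x /andP[kx _] E] := MVT_powR c kR kk.
  rewrite -lerBrDl E -[k.+1%:R]natr1 addrAC subrr add0r mulr1.
  rewrite -[leLHS]mulr1 ler_pM ?(ltW c1)//.
  have x1 : 1 <= x by rewrite (le_trans _ kx)// ler1n.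
  by have := ler_powR x1 (_ : 0 <= c - 1); rewrite powRr0; apply; rewrite subr_ge0 ltW.
have [l _] := floor_pow_itv k; have [_ u] := floor_pow_itv k.+1.
rewrite -ltnS -(ltr_nat R); rewrite -[(floor_pow k.+1).+1%:R]natr1.
by apply: le_lt_trans u; apply: le_trans h; rewrite -natr1 lerD2r.
Qed.

Lemma floor_powD k j : (floor_pow k + j <= floor_pow (k + j))%N.
Proof.
elim: j => [|j IH]; first by rewrite !addn0.
by rewrite !addnS; apply: leq_trans (floor_powS _).
Qed.

Lemma leq_floor_pow k k' : (k <= k')%N -> (floor_pow k <= floor_pow k')%N.
Proof. by move=> /subnKC <-; have := floor_powD k (k' - k); lia. Qed.

(** [floor_pow] expands distances because the gaps between consecutive
    [c]-th powers exceed [1]. *)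
Lemma dist_floor_pow k k' : (dist_nat k k' <= dist_nat (floor_pow k) (floor_pow k'))%N.
Proof.
rewrite /dist_nat; have [kk|kk] := leqP k k'.
  by have := floor_powD k (k' - k); rewrite subnKC//; lia.
by have := floor_powD k' (k - k'); rewrite subnKC ?(ltnW kk)//; lia.
Qed.

(** The mean value theorem, extended to [a = 0] where the power function is
    not covered by [MVT_powR]. *)
Lemma powRc_sub_le (a b X : R) : 0 <= a -> a <= b -> b <= X ->
  b `^ c - a `^ c <= c * X `^ (c - 1) * (b - a).
Proof.
move=> a0 ab bX; have b0 : 0 <= b := le_trans a0 ab.
move: a0; rewrite le_eqVlt => /predU1P[<-|a0].
  rewrite powR0 ?gt_eqF// !subr0.
  move: b0; rewrite le_eqVlt => /predU1P[<-|b0].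
    by rewrite powR0 ?gt_eqF// mulr0.
  have -> : b `^ c = b `^ (c - 1) * b.
    by rewrite -{3}(powRr1 (ltW b0)) -powRD ?subrK// (gt_eqF b0) implybT.
  rewrite ler_pM2r// -[leLHS]mul1r ler_pM ?powR_ge0 ?(ltW c1)//.
  by apply: ge0_ler_powR; rewrite ?nnegrE ?subr_ge0 ?(ltW c1) ?(ltW b0)// (le_trans (ltW b0)).
have [x /andP[ax xb] ->] := MVT_powR c a0 ab.
rewrite ler_pM ?mulr_ge0 ?powR_ge0 ?subr_ge0 ?(ltW c0)//.
rewrite ler_wpM2l ?(ltW c0)//.
have x0 : 0 <= x by apply: le_trans ax; exact: ltW.
have xX := le_trans xb bX.
by apply: ge0_ler_powR; rewrite ?nnegrE ?subr_ge0 ?(ltW c1)// (le_trans x0).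
Qed.

Lemma continuous_norm_powR : continuous (fun t : R => `|t| `^ c).
Proof.
move=> t; apply/cvgrPdist_le => e e0.
pose K := c * (`|t| + 1) `^ (c - 1).
have K0 : 0 < K by rewrite mulr_gt0 ?powR_gt0// ltr_wpDl.
near=> u.
have ut : `|t - u| <= Num.min 1 (e / K).
  by near: u; apply: cvgr_dist_le; [exact: cvg_id|rewrite lt_min ltr01 divr_gt0].
have ut1 : `|t - u| <= 1 by apply: (le_trans ut); rewrite ge_min lexx.
have utK : K * `|t - u| <= e.
  by rewrite mulrC -ler_pdivlMr//; apply: (le_trans ut); rewrite ge_min lexx orbT.
have uX : `|u| <= `|t| + 1.
  rewrite -(subKr t u); apply: (le_trans (ler_normB _ _)).
  by rewrite lerD2l.
have tX : `|t| <= `|t| + 1 by rewrite lerDl.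
have main (a b : R) : 0 <= a -> a <= b -> b <= `|t| + 1 -> b - a <= `|t - u| ->
    `|b `^ c - a `^ c| <= e.
  move=> a0 ab bX bat; have b0 := le_trans a0 ab.
  rewrite ger0_norm ?subr_ge0 ?ler_powRc//.
  apply: (le_trans (powRc_sub_le a0 ab bX)); apply: le_trans utK.
  by rewrite ler_pM2l.
have [tu|ut'] := leP `|t| `|u|.
  by rewrite distrC; apply: main => //; rewrite distrC; exact: lerB_dist.
by apply: main => //; [exact: ltW|exact: lerB_dist].
Unshelve. all: by end_near. Qed.

Lemma dist_floor_pow_le k k' (X B : R) : k%:R <= X -> k'%:R <= X ->
  (dist_nat k k')%:R <= B ->
  (dist_nat (floor_pow k) (floor_pow k'))%:R <= c * X `^ (c - 1) * B + 1.
Proof.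
wlog kk : k k' / (k <= k')%N => [wl kX k'X h|kX k'X h].
  have [kk|kk] := leqP k k'; first exact: wl.
  by rewrite /dist_nat addnC; apply: wl => //; [exact: ltnW|rewrite /dist_nat addnC].
have ff := leq_floor_pow kk.
have -> : dist_nat (floor_pow k) (floor_pow k') = (floor_pow k' - floor_pow k)%N.
  by rewrite /dist_nat; lia.
have {}h : k'%:R - k%:R <= B.
  by rewrite -natrB//; apply: le_trans h; rewrite ler_nat /dist_nat; lia.
rewrite natrB//.
have [_ l] := floor_pow_itv k; have [u _] := floor_pow_itv k'.
have kkR : k%:R <= k'%:R :> R by rewrite ler_nat.
have b := powRc_sub_le (ler0n R k) kkR k'X.
have : c * X `^ (c - 1) * (k'%:R - k%:R) <= c * X `^ (c - 1) * B.
  by rewrite ler_wpM2l// mulr_ge0 ?powR_ge0 ?(ltW c0).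
by lra.
Qed.

(** The value [N] is taken at most once, at the first integer past [N ^ g]. *)
Lemma floor_pow_hit k N : (0 < N)%N ->
  (floor_pow k == N) = hit g N && (Num.ceil (N%:R `^ g : R) == k%:Z).
Proof.
move=> N0; rewrite floor_powE.
have NR : 0 < N%:R :> R by rewrite ltr0n.
have Nd : N.+1%:R `^ g <= N%:R `^ g + 1 :> R.
  have /andP[_] := powR_succ_diff g0 g1 NR; rewrite natr1 => h.
  rewrite -lerBlDl; apply: (le_trans h).
  have : N%:R `^ (g - 1) <= 1 `^ (g - 1) :> R.
    by apply: ler_powR_neg; rewrite ?subr_le0 ?(ltW g1) ?ler1n.
  by rewrite powR1 => h1; rewrite mulr_ile1 ?powR_ge0 ?(ltW g0) ?(ltW g1).
rewrite /hit; apply/idP/idP => [/andP[h1 h2]|/andP[h /eqP E]].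
  have E : Num.ceil (N%:R `^ g : R) = k%:Z.
    apply/eqP; rewrite eq_le; apply/andP; split; first by rewrite ceil_le_int.
    have : ((k%:Z - 1)%:~R : R) < (Num.ceil (N%:R `^ g : R))%:~R.
      by apply: lt_le_trans (ceil_ge _); rewrite intrB ltrBlDr; apply: lt_le_trans Nd.
    by rewrite ltr_int; lia.
  by rewrite E eqxx andbT.
move: h; rewrite E => h; rewrite h andbT.
by rewrite -[leRHS]/((k%:Z)%:~R : R) -E ceil_ge.
Qed.

Lemma mem_lattice (l : nat) (x : int * int * int) :
  lattice_csphere c l x <->
  (floor_pow `|x.1.1| + floor_pow `|x.1.2| + floor_pow `|x.2| = l)%N.
Proof.
have F (m : int) : Num.floor (`|m%:~R : R| `^ c) = (floor_pow `|m|)%:Z.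
  apply/eqP; rewrite floor_eq -intr_norm -natr_absz intrD.
  by have [? ?] := floor_pow_itv `|m|; apply/andP.
rewrite /lattice_csphere/= !F -!PoszD; split => [[]//|->//].
Qed.

End floor_powers.

(** The [a]-th integer of the side [[q * L, (q + 1) * L)], up to its sign, to
    which the lattice spheres are blind. *)
Definition box_side (q : int) (L : nat) (a : nat) : nat := `|(q * L%:Z + a%:Z)%R|%N.

Lemma dist_box_side q L a a' : (a < L)%N -> (a' < L)%N ->
  dist_nat (box_side q L a) (box_side q L a') = dist_nat a a'.
Proof.
move=> aL a'L; rewrite /dist_nat /box_side.
have : 0 <= q * L%:Z \/ q * L%:Z <= - L%:Z.
  by case: (leP 0 q) => q0; [left; rewrite mulr_ge0|right; nia].
by move: (q * L%:Z) => P; lia.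
Qed.

Section box.
Context {R : realType}.
Variable c : R.
Hypotheses (c1 : 1 < c) (c2 : c < 9 / 8).
Let g := c^-1.
Local Notation R3 := (R * R * R)%type.

Let c0 : 0 < c. Proof. exact: lt_trans c1. Qed.
Let g0 : 0 < g. Proof. by rewrite invr_gt0. Qed.
Let g1 : g < 1. Proof. by rewrite invf_lt1. Qed.
Let g45 : 4 / 5 < g.
Proof.
have c2' := c2; have c0' := c0.
rewrite /g -(ltr_pM2r c0') mulVf ?gt_eqF//; lra.
Qed.

(* Linear arithmetic on the premises of the goal only. *)
Local Ltac slra := clear - c1 c2 c0 g0 g1 g45; lra.
Local Ltac slia := clear - c1 c2 c0 g0 g1 g45; lia.

(** One value of [floor_pow] of size [lam] bounds the coordinates of the whole
    side by [4 * T], with [T = lam ^ g]; there [c]-th powers grow at a rate of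
    order [T ^ (c - 1)], and the side has length at most [d * T]. *)
Lemma box_side_variation (d lam : R) (q : int) (L a0 : nat) :
  0 < d -> d <= 1 -> 1 <= lam -> 1 <= d * lam -> (a0 < L)%N ->
  L%:R <= d * lam `^ g -> (floor_pow c (box_side q L a0))%:R <= 2 * lam ->
  (forall a, (a < L)%N -> (box_side q L a)%:R <= 4 * lam `^ g) /\
  (forall a a', (a < L)%N -> (a' < L)%N ->
    (dist_nat (floor_pow c (box_side q L a)) (floor_pow c (box_side q L a')))%:R
      <= 4 * d * lam).
Proof.
move=> d0 d1 l1 dl a0L Lu fa0; have lam0 : 0 < lam by apply: lt_le_trans l1.
have c0' := c0; have c1' := c1; have c2' := c2.
set T := lam `^ g; have T0 : 0 < T by rewrite powR_gt0.
have T1 : 1 <= T by have := ler_powR l1 (ltW g0); rewrite powRr0.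
have TC : T `^ c = lam by rewrite powRgK// ltW.
have LT : L%:R <= T by apply: (le_trans Lu); rewrite ler_piMl// ltW.
have b0 : (box_side q L a0)%:R <= 3 * T :> R.
  rewrite -(ler_powRc c1) ?mulr_ge0 ?(ltW T0)// powRM ?(ltW T0)// TC.
  have [_ u] := floor_pow_itv c (box_side q L a0).
  have : 3 * lam <= 3 `^ c * lam.
    by rewrite ler_pM2r// le1r_powR ?(ltW c1)// ler1n.
  by move: u fa0 l1; slra.
have bu a : (a < L)%N -> (box_side q L a)%:R <= 4 * T :> R.
  move=> aL; have := dist_box_side q aL a0L => h.
  have : (box_side q L a)%:R <= (box_side q L a0)%:R + L%:R :> R.
    rewrite -natrD ler_nat; move: h aL a0L; rewrite /dist_nat.
    by move: (box_side q L a) (box_side q L a0) => x y; slia.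
  by move: b0 LT; slra.
split=> // a a' aL a'L.
have dL : (dist_nat (box_side q L a) (box_side q L a'))%:R <= L%:R :> R.
  by rewrite dist_box_side// ler_nat /dist_nat; move: aL a'L; slia.
apply: (le_trans (dist_floor_pow_le c1 (bu _ aL) (bu _ a'L) dL)).
have p4 : 4 `^ (c - 1) <= 2 :> R.
  apply: (@le_trans _ _ (4 `^ (2^-1) : R)).
    by rewrite ler_powR ?ler1n//; move: c2'; slra.
  by rewrite powR12_sqrt// (_ : 4 = 2 ^+ 2) ?sqrtr_sqr ?ger0_norm//; ring.
have TT : T `^ (c - 1) * T = lam.
  by rewrite -{2}(powRr1 (ltW T0)) -powRD ?subrK ?TC// (gt_eqF T0) implybT.
have : c * (4 * T) `^ (c - 1) * L%:R <= (9 / 8 * 2) * (T `^ (c - 1) * (d * T)).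
  rewrite powRM ?(ltW T0)// mulrA -[leRHS]mulrA -mulrA -mulrA.
  rewrite ler_pM ?mulr_ge0 ?powR_ge0 ?(ltW c0') ?(ltW c2')//.
  by rewrite ler_pM ?mulr_ge0 ?powR_ge0// ler_wpM2l ?powR_ge0.
have -> : T `^ (c - 1) * (d * T) = d * lam by rewrite mulrCA TT.
by move: dl; slra.
Qed.

End box.

Section box_sum.
Context {R : realType}.
Variable c : R.
Hypothesis c1 : 1 < c.
Let g := c^-1.
Local Notation R3 := (R * R * R)%type.
Implicit Types (x : int * int * int) (Psi : R3 -> R) (s : R).

Definition rpt s x : R3 := s *: ((x.1.1%:~R, x.1.2%:~R, x.2%:~R) : R3).

Lemma rpt1 s x : (rpt s x).1.1 = s * x.1.1%:~R. Proof. by []. Qed.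
Lemma rpt2 s x : (rpt s x).1.2 = s * x.1.2%:~R. Proof. by []. Qed.
Lemma rpt3 s x : (rpt s x).2 = s * x.2%:~R. Proof. by []. Qed.

Definition box_index (L : nat) x : int * int := ((x.1.1 %/ L)%Z, (x.1.2 %/ L)%Z).

(** Over a box the third coordinate is determined by the first two: the sum
    over the lattice points becomes a sum over the pairs for which the
    complementary value is attained. *)
Lemma box_sumE Psi s (L : nat) (q : int * int) (l : nat) (N : 'I_L -> 'I_L -> nat) :
  (0 < L)%N -> (forall x, x.2 < 0 -> Psi (rpt s x) = 0) ->
  (forall a b, (0 < N a b)%N) ->
  (forall a b : 'I_L, (floor_pow c (box_side q.1 L a) + floor_pow c (box_side q.2 L b)
                + N a b = l)%N) ->
  \sum_(x <- fset_set (lattice_csphere c l) | box_index L x == q) Psi (rpt s x) =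
  \sum_(u : 'I_L * 'I_L | hit g (N u.1 u.2))
     Psi (rpt s ((q.1 * L%:Z + u.1%:Z, q.2 * L%:Z + u.2%:Z),
                 Num.ceil ((N u.1 u.2)%:R `^ g : R))).
Proof.
move=> L0 P0 N0 Nl.
have finS : finite_set (lattice_csphere c l) by apply/finite_lattice_csphere/ltW.
rewrite (bigID (fun x => 0 <= x.2))/= [X in _ + X]big1 ?addr0; last first.
  by move=> x /andP[_]; rewrite -ltNge; exact: P0.
pose f (u : 'I_L * 'I_L) : int * int * int :=
  ((q.1 * L%:Z + u.1%:Z, q.2 * L%:Z + u.2%:Z), Num.ceil ((N u.1 u.2)%:R `^ g : R)).
rewrite -big_filter -[RHS]big_filter -(big_map f predT (fun x => Psi (rpt s x))).
apply: perm_big; apply: uniq_perm.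
- by rewrite filter_uniq// fset_uniq.
- rewrite map_inj_uniq ?filter_uniq ?index_enum_uniq// => -[a b] [a' b'] [] /addrI + /addrI + _.
  by move=> /= [] /val_inj -> [] /val_inj ->.
have LZ : L%:Z != 0 by lia.
move=> x; rewrite mem_filter in_fset_set//; apply/idP/mapP.
  move=> /andP[/andP[/eqP qx x0]]; rewrite inE => /mem_lattice.
  case: x x0 qx => -[x1 x2] x3 /= x0 qx Sx.
  have [q1 q2] : (x1 %/ L)%Z = q.1 /\ (x2 %/ L)%Z = q.2 by rewrite -qx.
  have m1 : (`|(x1 %% L)%Z| < L)%N.
    have := ltz_mod x1 LZ; have := modz_ge0 x1 LZ; lia.
  have m2 : (`|(x2 %% L)%Z| < L)%N.
    have := ltz_mod x2 LZ; have := modz_ge0 x2 LZ; lia.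
  pose u := (Ordinal m1, Ordinal m2).
  have E1 : x1 = q.1 * L%:Z + u.1%:Z.
    rewrite {1}(divz_eq x1 L%:Z) -q1/=; congr (_ + _).
    by rewrite gez0_abs// modz_ge0.
  have E2 : x2 = q.2 * L%:Z + u.2%:Z.
    rewrite {1}(divz_eq x2 L%:Z) -q2/=; congr (_ + _).
    by rewrite gez0_abs// modz_ge0.
  have kN : floor_pow c `|x3| == N u.1 u.2.
    by apply/eqP; have := Nl u.1 u.2; move: Sx; rewrite E1 E2 /box_side; lia.
  move: kN; rewrite floor_pow_hit// => /andP[h /eqP cE].
  exists u; first by rewrite mem_filter h mem_index_enum.
  by rewrite /f -E1 -E2 /g cE gez0_abs.
move=> [[a b]]; rewrite mem_filter => /andP[/= h _] ->.
have C0 : 0 <= Num.ceil ((N a b)%:R `^ g : R).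
  by rewrite ceil_ge0 (lt_le_trans (ltrN10 R))// powR_ge0.
rewrite /f/= C0 andbT; apply/andP; split.
  rewrite /box_index/= !divzMDl// !divz_small ?addr0; [|exact: ltn_ord..].
  by rewrite -surjective_pairing.
rewrite inE; apply/mem_lattice => /=; rewrite -/(box_side _ _ _) -/(box_side _ _ _) -[RHS](Nl a b).
congr (_ + _)%N; apply/eqP; rewrite floor_pow_hit//.
by apply/andP; split => //; rewrite gez0_abs.
Qed.

End box_sum.

(** * Stability of lattice sums in the radius *)

Section box_stability.
Context {R : realType}.
Variable c : R.
Hypotheses (c1 : 1 < c) (c2 : c < 9 / 8).
Let g := c^-1.
Local Notation R3 := (R * R * R)%type.
Implicit Types (x : int * int * int).

Let c0 : 0 < c. Proof. exact: lt_trans c1. Qed.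
Let g0 : 0 < g. Proof. by rewrite invr_gt0. Qed.
Let g1 : g < 1. Proof. by rewrite invf_lt1. Qed.
Let g45 : 4 / 5 < g.
Proof.
have c2' := c2; have c0' := c0.
rewrite /g -(ltr_pM2r c0') mulVf ?gt_eqF//; lra.
Qed.

Local Ltac slra := clear - c1 c2 c0 g0 g1 g45; lra.
Local Ltac slring := clear - c1 c2 c0 g0 g1 g45; ring.
Local Ltac slia := clear - c1 c2 c0 g0 g1 g45; lia.

Definition in_cube (x : R3) := [/\ `|x.1.1| <= 5, `|x.1.2| <= 5 & `|x.2| <= 5].

Definition close_by (eta : R) (x y : R3) :=
  [/\ `|x.1.1 - y.1.1| <= eta, `|x.1.2 - y.1.2| <= eta & `|x.2 - y.2| <= eta].

(** What is used of a test function: it is bounded and uniformly continuous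
    on a cube that contains all the rescaled points. *)
Definition test_function (Psi : R3 -> R) (B : R) :=
  (forall x : R3, in_cube x -> `|Psi x| <= B) /\
  (forall w, 0 < w -> exists2 eta, 0 < eta & forall x y : R3,
     in_cube x -> in_cube y -> close_by eta x y -> `|Psi x - Psi y| <= w).

(** A single lattice point with a large third coordinate controls its whole
    box: every pair of the box leaves at least a fixed proportion of [l] for
    the third coordinate. *)
Lemma box_room (d : R) (l L : nat) (q : int * int) (l1 : nat) x :
  0 < d -> d <= 1 / 1000 -> 100 <= l%:R :> R -> 1 <= d * l%:R ->
  L%:R <= d * l%:R `^ g -> (0 < L)%N ->
  (l <= l1)%N -> l1%:R <= (1 + d) * l%:R ->
  lattice_csphere c l1 x -> box_index L x = q ->
  1 / 4 <= l%:R `^ (- g) * x.2%:~R ->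
  [/\ forall a, (a < L)%N -> (box_side q.1 L a)%:R <= 4 * l%:R `^ g,
      forall a, (a < L)%N -> (box_side q.2 L a)%:R <= 4 * l%:R `^ g,
      forall a a', (a < L)%N -> (a' < L)%N ->
        (dist_nat (floor_pow c (box_side q.1 L a)) (floor_pow c (box_side q.1 L a')))%:R
        <= 4 * d * l%:R,
      forall a a', (a < L)%N -> (a' < L)%N ->
        (dist_nat (floor_pow c (box_side q.2 L a)) (floor_pow c (box_side q.2 L a')))%:R
        <= 4 * d * l%:R &
      forall a b, (a < L)%N -> (b < L)%N ->
        (floor_pow c (box_side q.1 L a))%:R + (floor_pow c (box_side q.2 L b))%:R
         + 1 / 40 * l%:R <= l%:R :> R].
Proof.
move=> d0 d1 l100 dl Lu L0 ll l1u Sx qx x3.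
have lam1 : 1 <= l%:R :> R by move: l100; slra.
have lam0 : 0 < l%:R :> R by move: l100; slra.
have LZ : L%:Z != 0 by move: L0; slia.
have side (m : int) : exists2 a, (a < L)%N & `|m|%N = box_side (m %/ L)%Z L a.
  exists `|(m %% L)%Z|%N.
    by have := ltz_mod m LZ; have := modz_ge0 m LZ; slia.
  by rewrite /box_side {1}(divz_eq m L%:Z) gez0_abs// modz_ge0.
have [a0 a0L E1] := side x.1.1; have [b0 b0L E2] := side x.1.2.
move: Sx => /mem_lattice; rewrite E1 E2.
have -> : (x.1.1 %/ L)%Z = q.1 by rewrite -qx.
have -> : (x.1.2 %/ L)%Z = q.2 by rewrite -qx.
move=> Sx.
have SxR : (floor_pow c (box_side q.1 L a0))%:R + (floor_pow c (box_side q.2 L b0))%:R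
   + (floor_pow c `|x.2|)%:R = l1%:R :> R by rewrite -!natrD Sx.
have l12 : l1%:R <= 2 * l%:R :> R.
  by apply: (le_trans l1u); rewrite ler_pM2r//; move: d1; slra.
have d11 : d <= 1 by move: d1; slra.
have p0 n : 0 <= n%:R :> R by [].
have f1 : (floor_pow c (box_side q.1 L a0))%:R <= 2 * l%:R :> R.
  move: SxR l12 (p0 (floor_pow c (box_side q.2 L b0))) (p0 (floor_pow c `|x.2|)).
  by slra.
have f2 : (floor_pow c (box_side q.2 L b0))%:R <= 2 * l%:R :> R.
  move: SxR l12 (p0 (floor_pow c (box_side q.1 L a0))) (p0 (floor_pow c `|x.2|)).
  by slra.
have [u1 v1] := box_side_variation c1 c2 d0 d11 lam1 dl a0L Lu f1.
have [u2 v2] := box_side_variation c1 c2 d0 d11 lam1 dl b0L Lu f2.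
split=> // a b aL bL.
have f3 : l%:R / 16 <= (floor_pow c `|x.2|)%:R + 1 :> R.
  have [_ u] := floor_pow_itv c `|x.2|.
  apply: le_trans (ltW u).
  have T0 : 0 < l%:R `^ g :> R by rewrite powR_gt0.
  have xT : 1 / 4 * l%:R `^ g <= `|x.2|%N%:R.
    move: x3; rewrite powRN [X in _ <= X]mulrC ler_pdivlMr// => x3; apply: (le_trans x3).
    by rewrite natr_absz intr_norm ler_norm.
  apply: (@le_trans _ _ ((1 / 4 * l%:R `^ g) `^ c)); last first.
    by rewrite ler_powRc// mulr_ge0// ltW.
  rewrite powRM ?(ltW T0)// powRgK ?(ltW lam0)// mulrC ler_wpM2r ?(ltW lam0)//.
  apply: (@le_trans _ _ ((1 / 4) `^ 2 : R)).
    by rewrite powR_mulrn//; slra.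
  by rewrite ger_powR//; move: c2; slra.
have w1 := v1 _ _ aL a0L; have w2 := v2 _ _ bL b0L.
have h1 : (floor_pow c (box_side q.1 L a))%:R <= (floor_pow c (box_side q.1 L a0))%:R + 4 * d * l%:R.
  rewrite -lerBlDl; apply: le_trans w1; rewrite lerBlDl -natrD ler_nat /dist_nat; slia.
have h2 : (floor_pow c (box_side q.2 L b))%:R <= (floor_pow c (box_side q.2 L b0))%:R + 4 * d * l%:R.
  rewrite -lerBlDl; apply: le_trans w2; rewrite lerBlDl -natrD ler_nat /dist_nat; slia.
have dl' : d * l%:R <= 1 / 1000 * l%:R by rewrite ler_pM2r.
by move: f3 h1 h2 SxR l1u dl' l100; slra.
Qed.

Lemma powR_lipschitz (m a b : R) : 0 < m -> m <= a -> m <= b ->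
  `|a `^ g - b `^ g| <= m `^ (g - 1) * `|a - b|.
Proof.
move=> m0; wlog ab : a b / a <= b => [wl ma mb|ma mb].
  by have [/wl|/ltW/wl] := leP a b; [exact|rewrite distrC (distrC a); exact].
have a0 := lt_le_trans m0 ma.
have [x /andP[ax _] E] := MVT_powR g a0 ab.
rewrite distrC E (distrC a) normrM ler_wpM2r// ger0_norm ?mulr_ge0 ?powR_ge0 ?(ltW g0)//.
rewrite -[leRHS]mul1r ler_pM ?powR_ge0 ?(ltW g0) ?(ltW g1)//.
by apply: ler_powR_neg; rewrite ?subr_le0 ?(ltW g1)//; exact: le_trans ax.
Qed.

(** Either no sphere of the range has a point of the support in the box, and
    the sums vanish, or [box_room] applies.  Then the sums are over the pairs
    of the box whose complement [N] is hit.  Passing from [l] to [l'] moves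
    [N] by at most [d * l] only, which changes neither the density
    [g * N ^ (g - 1)] of the hits nor the values of [Psi] by much. *)
Lemma box_stability (Psi : R3 -> R) (B e : R) :
  (forall x : R3, x.2 < 1 / 4 -> Psi x = 0) -> test_function Psi B -> 0 < e ->
  exists2 d0 : R, 0 < d0 & forall d, 0 < d -> d <= d0 ->
  exists l0 : nat, forall (l L : nat) (q : int * int), (l0 <= l)%N ->
  d * l%:R `^ g / 2 <= L%:R -> L%:R <= d * l%:R `^ g ->
  exists V : R, forall l' : nat, (l <= l')%N -> l'%:R <= (1 + d) * l%:R ->
  `|\sum_(x <- fset_set (lattice_csphere c l') | box_index L x == q)
      Psi (rpt (l%:R `^ (- g)) x) - V| <= e * (l%:R `^ (g - 1) * L%:R ^+ 2).
Proof.
move=> P0 [PB PU] e0.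
have [|Bp BpE Bp0] := @pos_abstract R (`|B| + 1); first by rewrite ltr_wpDl.
have PBp (x : R3) : in_cube x -> `|Psi x| <= Bp.
  move=> /PB h; apply: (le_trans h); rewrite BpE.
  by have := ler_norm B; slra.
pose e1 := Num.min 1 (e / (2 * Bp)).
have e10 : 0 < e1 by rewrite lt_min ltr01 divr_gt0// mulr_gt0.
have e11 : e1 <= 1 by rewrite ge_min lexx.
have e1B : Bp * e1 <= e / 2.
  have : e1 <= e / (2 * Bp) by rewrite ge_min lexx orbT.
  by rewrite ler_pdivlMr ?mulr_gt0//; slra.
have e82 : 0 < e / 82 by rewrite divr_gt0.
have [eta eta0 PE] := PU _ e82.
(* In the box [N] is at least [l / 40].  Hence the number of hits is at most
   [41 * Q] with [Q] as below, and the third coordinates vary by at most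
   [402 * d] after rescaling. *)
have q40 : 0 < 1 / 40 :> R by [].
have q41 : 1 / 40 <= 1 :> R by slra.
have q10 : 0 < 10 :> R by [].
have [d1 d10 hd] := box_count g45 g1 q40 q41 q10 e10.
exists (Num.min (Num.min d1 (1 / 1000)) (eta / 402)).
  rewrite !lt_min d10/=; apply/andP; split; first by slra.
  by move: eta0; slra.
move=> d dp; rewrite !le_min => /andP[/andP[dd1 d1000] deta].
have {}deta : 402 * d <= eta by move: deta; slra.
have [l1 l10 hl] := hd d dp dd1.
exists (Num.truncn (Num.max (Num.max l1 100) (Num.max d^-1 (d^-1 `^ c)))).+1.
move=> l L q; rewrite -(ler_nat R) => lb.
have {lb} : Num.max (Num.max l1 100) (Num.max d^-1 (d^-1 `^ c)) <= l%:R.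
  by apply: le_trans lb; apply: ltW; rewrite truncnS_gt.
rewrite !ge_max => /andP[/andP[l1l l100] /andP[dl dT]] Ld Lu.
have lam0 : 0 < l%:R :> R by move: l100; slra.
have {}dl : 1 <= d * l%:R by rewrite mulrC -ler_pdivrMr ?div1r.
set T := l%:R `^ g in Ld Lu *; have T0 : 0 < T by rewrite powR_gt0.
have {}dT : 1 <= d * T.
  have : d^-1 <= T.
    by rewrite -(ler_powRc c1) ?(ltW T0) ?invr_ge0 ?(ltW dp)// powRgK// ltW.
  by rewrite mulrC -ler_pdivrMr ?div1r.
set s := l%:R `^ (- g); have sE : s = T^-1 by rewrite /s powRN.
have s0 : 0 < s by rewrite sE invr_gt0.
have sT : s * T = 1 by rewrite sE mulVf// gt_eqF.
have LR : 0 < L%:R :> R by apply: lt_le_trans Ld; rewrite divr_gt0// mulr_gt0.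
have L0 : (0 < L)%N by rewrite -(ltr0n R).
have [[l2 [x [ll2 l2u Sx qx Px]]]|no] := pselect (exists l2 x,
    [/\ (l <= l2)%N, l2%:R <= (1 + d) * l%:R, lattice_csphere c l2 x, box_index L x = q &
     Psi (rpt s x) != 0]); last first.
  exists 0 => l' ll' l'u; rewrite subr0 big_seq_cond big1 ?normr0.
    by rewrite !mulr_ge0 ?powR_ge0 ?exprn_ge0 ?(ltW e0).
  move=> x /andP[xS /eqP xq]; apply/eqP; apply/negPn/negP => Px; apply: no.
  exists l', x; split => //.
  by move: xS; rewrite in_fset_set ?inE//; apply/finite_lattice_csphere/ltW.
have x3 : 1 / 4 <= s * x.2%:~R.
  by rewrite leNgt; apply: contra_neqN Px => h; apply: P0.
have [u1 u2 v1 v2 room] := box_room dp d1000 l100 dl Lu L0 ll2 l2u Sx qx x3.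
pose n1 (a : 'I_L) := floor_pow c (box_side q.1 L a).
pose n2 (a : 'I_L) := floor_pow c (box_side q.2 L a).
have nl a b : (n1 a + n2 b <= l)%N.
  rewrite -(ler_nat R) natrD; have := room a b (ltn_ord a) (ltn_ord b).
  by rewrite -/(n1 a) -/(n2 b); move: lam0; slra.
pose N l' (a b : 'I_L) := (l' - n1 a - n2 b)%N.
have Nge l' a b : (l <= l')%N -> 1 / 40 * l%:R <= (N l' a b)%:R :> R.
  move=> ll'; have := room a b (ltn_ord a) (ltn_ord b); rewrite -/(n1 a) -/(n2 b) => h.
  have : l%:R <= l'%:R :> R by rewrite ler_nat.
  have := nl a b; rewrite /N => nlab; rewrite -subnDA natrB ?(leq_trans nlab)// natrD.
  by move: h; slra.
have q40l : 0 < 1 / 40 * l%:R :> R by rewrite mulr_gt0.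
have N0 l' a b : (l <= l')%N -> (0 < N l' a b)%N.
  by move=> ll'; rewrite -(ltr0n R); apply: lt_le_trans (Nge _ _ _ ll').
pose o := Ordinal L0; pose N0R : R := (N l o o)%:R.
pose p0 : R3 := (s * (q.1 * L%:Z)%:~R, s * (q.2 * L%:Z)%:~R, s * N0R `^ g).
exists (Psi p0 * (g * N0R `^ (g - 1) * L%:R ^+ 2)) => l' ll' l'u.
have Nd a b : `|(N l' a b)%:R - N0R| <= 10 * d * l%:R.
  have := v1 a o (ltn_ord a) (ltn_ord o); have := v2 b o (ltn_ord b) (ltn_ord o).
  rewrite -/(n1 a) -/(n2 b) -/(n1 o) -/(n2 o) => w2 w1.
  have h : (dist_nat (N l' a b) (N l o o) <= (l' - l) + dist_nat (n1 a) (n1 o) + dist_nat (n2 b) (n2 o))%N.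
    by move: (nl a b) (nl o o) ll'; rewrite /dist_nat /N; slia.
  have {}h : (dist_nat (N l' a b) (N l o o))%:R <= (l'%:R - l%:R)
      + (dist_nat (n1 a) (n1 o))%:R + (dist_nat (n2 b) (n2 o))%:R :> R.
    by rewrite -natrB// -!natrD ler_nat.
  have : `|(N l' a b)%:R - N0R| <= (dist_nat (N l' a b) (N l o o))%:R.
    rewrite /N0R /dist_nat ler_norml; apply/andP; split.
      by rewrite lerBrDr addrC lerBlDr -natrD ler_nat; slia.
    by rewrite lerBlDr -natrD ler_nat; slia.
  by have := mulr_gt0 dp lam0; move: h w1 w2 l'u; slra.
(* The complement [N] is split as [Y b + i a] with [i a] small, as is needed
   to complete the sum over [a]. *)
have [nm nmP] : exists m : 'I_L, forall a, (n1 a <= n1 m)%N.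
  by exists [arg max_(a > o) n1 a]; case: arg_maxnP => // m _ h a; exact: h.
pose i a := (n1 nm - n1 a)%N.
pose Y b := (l' - n1 nm - n2 b)%N.
pose D := Num.truncn (4 * d * l%:R).
have dl0 : 0 <= 4 * d * l%:R by rewrite !mulr_ge0// ltW.
have YiN a b : (Y b + i a)%N = N l' a b.
  by move: (nl nm b) (nl a b) (nmP a) ll'; rewrite /Y /i /N; slia.
have iD a : (i a <= D)%N.
  rewrite /D -ltnS -(ltr_nat R); apply: le_lt_trans (truncnS_gt _).
  apply: le_trans (v1 a nm (ltn_ord a) (ltn_ord nm)).
  by rewrite -/(n1 a) -/(n1 nm) ler_nat /dist_nat /i; slia.
have D4 : D%:R <= 4 * d * l%:R :> R by have /andP[] := truncn_itv dl0.
have D10 : D.+1%:R <= 10 * d * l%:R :> R.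
  by rewrite -natr1; move: D4 dl; slra.
have ii : injective i.
  move=> a a'; rewrite /i => E; have E' : n1 a = n1 a' by move: (nmP a) (nmP a') E; slia.
  have := dist_floor_pow c1 (box_side q.1 L a) (box_side q.1 L a').
  rewrite dist_box_side ?ltn_ord// -/(n1 a) -/(n1 a') E' => h.
  by apply: val_inj; move: h; rewrite /dist_nat/=; slia.
have Y2 b b' : dist_nat (Y b) (Y b') = dist_nat (n2 b) (n2 b').
  by move: (nl nm b) (nl nm b') ll'; rewrite /Y /dist_nat; slia.
have Ydist (b b' : 'I_L) : (dist_nat b b' <= dist_nat (Y b) (Y b'))%N.
  rewrite Y2; apply: leq_trans (dist_floor_pow c1 _ _).
  by rewrite dist_box_side ?ltn_ord.
have Yd b b' : (dist_nat (Y b) (Y b'))%:R <= 10 * d * l%:R :> R.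
  rewrite Y2; apply: (le_trans (v2 b b' (ltn_ord b) (ltn_ord b'))).
  by rewrite ler_pM2r// ler_pM2r// ler_nat.
have Yl b : 1 / 40 * l%:R <= (Y b)%:R :> R.
  by have := Nge l' nm b ll'; rewrite /N /Y.
have d1l : d * l%:R <= 1 / 1000 * l%:R by rewrite ler_pM2r.
have Y4 b : (Y b)%:R + D.+1%:R <= 4 * l%:R :> R.
  have : (Y b)%:R <= l'%:R :> R by rewrite ler_nat /Y; slia.
  by move: l'u D10 d1l lam0; slra.
have YN a b : `|(Y b + i a)%:R - N0R| <= 10 * d * l%:R :> R by rewrite YiN.
have := hl _ l1l L D i Y N0R Ld Lu ii iD D10 Ydist Yd Yl Y4 YN.
have Psi0 z : z.2 < 0 -> Psi (rpt s z) = 0.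
  move=> z0; apply: P0; rewrite /rpt/=.
  have : s * z.2%:~R <= 0 by rewrite pmulr_rle0// lerz0 ltW.
  by rewrite /GRing.scale/=; slra.
rewrite (@box_sumE R c c1 Psi s L q l' (N l') L0 Psi0).
- have -> : #|[pred u : 'I_L * 'I_L | hit g (Y u.2 + i u.1)]| =
      #|[pred u : 'I_L * 'I_L | hit g (N l' u.1 u.2)]|.
    by apply: eq_card => u; rewrite !inE YiN.
  set H := [pred u : 'I_L * 'I_L | hit g (N l' u.1 u.2)].
  set P := g * N0R `^ (g - 1) * L%:R ^+ 2.
  set Q := l%:R `^ (g - 1) * L%:R ^+ 2 => cntP.
  have Q0 : 0 <= Q by rewrite mulr_ge0 ?powR_ge0 ?exprn_ge0.
  have N0ge : 1 / 40 * l%:R <= N0R by apply: Nge.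
  have PQ : P <= 40 * Q.
    rewrite /P /Q mulrA ler_wpM2r ?exprn_ge0//.
    apply: (@le_trans _ _ (1 * (1 / 40 * l%:R) `^ (g - 1))).
      rewrite ler_pM ?powR_ge0 ?(ltW g0) ?(ltW g1)//.
      by apply: ler_powR_neg; rewrite ?subr_le0 ?(ltW g1).
    rewrite mul1r powRM ?(ltW lam0)// ler_wpM2r ?powR_ge0//.
    apply: (@le_trans _ _ ((1 / 40) `^ (- 1) : R)).
      by rewrite ger_powR//; move: g0; slra.
    by rewrite powR_inv1// div1r invrK.
  have cntQ : #|H|%:R <= 41 * Q.
    have := mulr_ge0 (ltW e10) Q0; have := ler_wpM2r Q0 e11.
    by move: cntP PQ => /ler_normlP[_]; slra.
  have A4 : `|s * (q.1 * L%:Z)%:~R| <= 4.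
    have := u1 0%N L0; rewrite /box_side addr0 natr_absz intr_norm => h.
    by rewrite normrM (gtr0_norm s0) -(ler_pM2r T0) mulrAC sT mul1r.
  have B4 : `|s * (q.2 * L%:Z)%:~R| <= 4.
    have := u2 0%N L0; rewrite /box_side addr0 natr_absz intr_norm => h.
    by rewrite normrM (gtr0_norm s0) -(ler_pM2r T0) mulrAC sT mul1r.
  have sL : s * L%:R <= d.
    by rewrite -(ler_pM2r T0) mulrAC sT mul1r.
  have sa (a : 'I_L) : 0 <= s * a%:R <= d.
    rewrite mulr_ge0 ?(ltW s0)//=; apply: le_trans sL.
    by rewrite ler_pM2l// ler_nat ltnW.
  have N0T : 0 <= s * N0R `^ g <= 1.
    rewrite mulr_ge0 ?(ltW s0) ?powR_ge0//= -sT ler_pM2l//.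
    apply: ge0_ler_powR; rewrite ?nnegrE ?(ltW g0)// ler_nat /N; slia.
  have third a b : `|s * (Num.ceil ((N l' a b)%:R `^ g : R))%:~R - s * N0R `^ g| <= 402 * d.
    rewrite -mulrBr normrM (gtr0_norm s0) -(ler_pM2r T0) mulrAC sT mul1r.
    have := powR_lipschitz q40l (Nge l' a b ll') N0ge.
    have -> : (1 / 40 * l%:R) `^ (g - 1) = (1 / 40) `^ (g - 1) * l%:R `^ (g - 1) :> R.
      by rewrite powRM ?(ltW lam0).
    have k40 : (1 / 40) `^ (g - 1) <= 40 :> R.
      apply: (@le_trans _ _ ((1 / 40) `^ (- 1) : R)).
        by rewrite ger_powR//; move: g0; slra.
      by rewrite powR_inv1// div1r invrK.
    have lT : l%:R `^ (g - 1) * l%:R = T.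
      by rewrite mulrC mulr_powRB1 ?(ltW lam0).
    have h2 : (1 / 40) `^ (g - 1) * l%:R `^ (g - 1) * `|(N l' a b)%:R - N0R| <=
        40 * l%:R `^ (g - 1) * (10 * d * l%:R).
      by rewrite ler_pM ?mulr_ge0 ?powR_ge0// ler_wpM2r ?powR_ge0.
    have h3 : 40 * l%:R `^ (g - 1) * (10 * d * l%:R) = 400 * d * T by rewrite -lT; slring.
    have cl := ceil_ge ((N l' a b)%:R `^ g : R).
    have cu := ceilB1_lt ((N l' a b)%:R `^ g : R).
    rewrite intrB in cu; rewrite h3 in h2.
    move=> /le_trans/(_ h2)/ler_normlP[m1 m2].
    by rewrite ler_norml; apply/andP; split; move: cl cu m1 m2 dT; slra.
  have pc : in_cube p0.
    split=> /=; [by move: A4; slra|by move: B4; slra|].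
    by have /andP[k1 k2] := N0T; rewrite ger0_norm//; move: k2; slra.
  have near_p0 u : `|Psi (rpt s (q.1 * L + (u : 'I_L * 'I_L).1, q.2 * L + u.2,
        Num.ceil ((N l' u.1 u.2)%:R `^ g : R))) - Psi p0| <= e / 82.
    have /andP[a1 a2] := sa u.1; have /andP[b1 b2] := sa u.2.
    have th := third u.1 u.2.
    have e1E : s * (q.1 * L + u.1)%:~R = s * (q.1 * L)%:~R + s * u.1%:R by rewrite intrD mulrDr.
    have e2E : s * (q.2 * L + u.2)%:~R = s * (q.2 * L)%:~R + s * u.2%:R by rewrite intrD mulrDr.
    apply: PE => //.
      split; rewrite ?rpt1 ?rpt2 ?rpt3 /= ?e1E ?e2E.
      - apply: (le_trans (ler_normD _ _)); rewrite (ger0_norm a1).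
        by move: A4 a2 d1000; slra.
      - apply: (le_trans (ler_normD _ _)); rewrite (ger0_norm b1).
        by move: B4 b2 d1000; slra.
      - have /andP[k1 k2] := N0T.
        rewrite -(subrK (s * N0R `^ g) (s * _)); apply: (le_trans (ler_normD _ _)).
        by rewrite (ger0_norm k1); move: th k2 d1000; slra.
    split; rewrite ?rpt1 ?rpt2 ?rpt3 /= ?e1E ?e2E.
    - by rewrite addrAC subrr add0r ger0_norm//; move: a2 deta dp; slra.
    - by rewrite addrAC subrr add0r ger0_norm//; move: b2 deta dp; slra.
    - by apply: (le_trans th).
  rewrite (_ : _ - _ = \sum_(u | H u) (Psi (rpt s (q.1 * L + u.1, q.2 * L + u.2,
      Num.ceil ((N l' u.1 u.2)%:R `^ g : R))) - Psi p0) + Psi p0 * (#|H|%:R - P)); last first.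
    by rewrite sumrB sumr_const -[Psi p0 *+ _]mulr_natr; slring.
  apply: (le_trans (ler_normD _ _)).
  have s1 : `|\sum_(u | H u) (Psi (rpt s (q.1 * L + u.1, q.2 * L + u.2,
      Num.ceil ((N l' u.1 u.2)%:R `^ g : R))) - Psi p0)| <= e / 82 * (41 * Q).
    apply: (le_trans (ler_norm_sum _ _ _)).
    apply: (le_trans (ler_sum _ (fun u _ => near_p0 u))).
    rewrite sumr_const -[leLHS]mulr_natr ler_wpM2l//.
    by move: e0; slra.
  have s2 : `|Psi p0 * (#|H|%:R - P)| <= e / 2 * Q.
    rewrite normrM; apply: (@le_trans _ _ (Bp * (e1 * Q))).
      by rewrite ler_pM// PBp.
    by rewrite mulrA ler_wpM2r.
  by move: s1 s2; slra.
- by move=> a b; exact: N0.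
- move=> a b; rewrite -/(n1 a) -/(n2 b); move: (nl a b) ll'; rewrite /N; slia.
Qed.

End box_stability.

Section stability.
Context {R : realType}.
Variable c : R.
Hypotheses (c1 : 1 < c) (c2 : c < 9 / 8).
Let g := c^-1.
Local Notation R3 := (R * R * R)%type.
Implicit Types (x : int * int * int) (Psi : R3 -> R).

Let c0 : 0 < c. Proof. exact: lt_trans c1. Qed.
Let g0 : 0 < g. Proof. by rewrite invr_gt0. Qed.
Let g1 : g < 1. Proof. by rewrite invf_lt1. Qed.

Local Ltac slra := clear - c1 c2 c0 g0 g1; lra.
Local Ltac slia := clear - c1 c2 c0 g0 g1; lia.

Definition lattice_sum (l' : nat) (s : R) Psi :=
  \sum_(x <- fset_set (lattice_csphere c l')) Psi (rpt s x).

(** Both spheres are rescaled by the radius of the first one, and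
    [l ^ (3 * g - 1)] is the order of their numbers of points. *)
Definition stable Psi := forall e : R, 0 < e -> exists2 d : R, 0 < d &
  exists l0 : nat, forall l l' : nat, (l0 <= l)%N -> (l <= l')%N ->
  l'%:R <= (1 + d) * l%:R ->
  `|lattice_sum l' (l%:R `^ (- g)) Psi - lattice_sum l (l%:R `^ (- g)) Psi|
    <= e * l%:R `^ (3 * g - 1).

Lemma lattice_coord_le (l : nat) (lam : R) x : 1 <= lam -> l%:R <= 2 * lam ->
  lattice_csphere c l x ->
  [/\ `|x.1.1|%N%:R <= 3 * lam `^ g, `|x.1.2|%N%:R <= 3 * lam `^ g
    & `|x.2|%N%:R <= 3 * lam `^ g].
Proof.
move=> lam1 l2 /mem_lattice Sx; have lam0 : 0 < lam := lt_le_trans ltr01 lam1.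
have T0 : 0 < lam `^ g by rewrite powR_gt0.
have f n : (floor_pow c n <= l)%N -> n%:R <= 3 * lam `^ g.
  move=> nl; rewrite -(ler_powRc c1) ?mulr_ge0 ?(ltW T0)// powRM ?(ltW T0)//.
  rewrite powRgK ?(ltW lam0)//.
  have [_ u] := floor_pow_itv c n.
  have : (floor_pow c n)%:R <= l%:R :> R by rewrite ler_nat.
  have : 3 * lam <= 3 `^ c * lam by rewrite ler_pM2r// le1r_powR ?(ltW c1)// ler1n.
  by move: u l2 lam1; slra.
by split; apply: f; rewrite -Sx; slia.
Qed.

Lemma lattice_sum_boxes (l L H : nat) (s : R) Psi : (0 < L)%N ->
  (forall x, lattice_csphere c l x ->
    (`|(x.1.1 %/ L)%Z| <= H)%N /\ (`|(x.1.2 %/ L)%Z| <= H)%N) ->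
  lattice_sum l s Psi = \sum_(j : 'I_(H.*2.+1) * 'I_(H.*2.+1))
    \sum_(x <- fset_set (lattice_csphere c l) |
       box_index L x == (j.1%:Z - H%:Z, j.2%:Z - H%:Z)) Psi (rpt s x).
Proof.
move=> L0 xH.
have finS : finite_set (lattice_csphere c l) by apply/finite_lattice_csphere/ltW.
pose p x : 'I_(H.*2.+1) * 'I_(H.*2.+1) :=
  (inord `|((x.1.1 %/ L)%Z + H%:Z)%R|, inord `|((x.1.2 %/ L)%Z + H%:Z)%R|).
rewrite /lattice_sum (partition_big p xpredT)//=; apply: eq_bigr => j _.
rewrite big_seq_cond [RHS]big_seq_cond; apply: eq_bigl => x.
have [/=|//] := boolP (x \in fset_set (lattice_csphere c l)).
rewrite in_fset_set// inE => /xH.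
case: j => j1 j2 [h1 h2]; rewrite /p /box_index !xpair_eqE -!val_eqE/=.
move: (x.1.1 %/ L)%Z (x.1.2 %/ L)%Z h1 h2 => q1 q2 h1 h2.
have hH (q : int) (j : 'I_(H.*2.+1)) : (`|q| <= H)%N ->
    (nat_of_ord (@inord H.*2 `|(q + H%:Z)%R|) == j) = (q == j%:Z - H%:Z).
  by move=> qH; rewrite inordK; move: qH; slia.
by rewrite !hH.
Qed.

(** The points of the sphere are covered by about [d ^ (- 2)] boxes of side
    [d * l ^ g], and [box_stability] bounds the error in each of them by
    [e * d ^ 2 * l ^ (3 * g - 1)]. *)
Lemma stable_supported Psi (B : R) :
  (forall x : R3, x.2 < 1 / 4 -> Psi x = 0) -> test_function Psi B -> stable Psi.
Proof.
move=> P0 PT e e0.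
have e600 : 0 < e / 600 by move: e0; slra.
have [d0 d00 hd] := box_stability c1 c2 P0 PT e600.
pose d := Num.min d0 1.
have dp : 0 < d by rewrite lt_min d00/=.
have dd0 : d <= d0 by rewrite ge_min lexx.
have d1 : d <= 1 by rewrite ge_min lexx orbT.
have [l1 hl] := hd d dp dd0.
exists d => //.
exists (maxn l1 (Num.truncn ((2 / d) `^ c)).+1) => l l'.
rewrite geq_max => /andP[l1l lb] ll' l'u.
have lb' : (2 / d) `^ c <= l%:R.
  by apply: (le_trans (ltW (truncnS_gt _))); rewrite ler_nat.
have l0 : (0 < l)%N by apply: leq_trans lb.
have lam1 : 1 <= l%:R :> R by rewrite ler1n.
have lam0 : 0 < l%:R :> R by rewrite ltr0n.
set T := l%:R `^ g; have T0 : 0 < T by rewrite powR_gt0.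
have dT : 2 <= d * T.
  rewrite mulrC -ler_pdivrMr// -(ler_powRc c1) ?divr_ge0 ?(ltW dp) ?(ltW T0)//.
  by rewrite powRgK// ltW.
pose L := Num.truncn (d * T).
have /andP[Lu Ll] := truncn_itv (mulr_ge0 (ltW dp) (ltW T0)).
rewrite -/L in Lu Ll; rewrite -natr1 in Ll.
have Ld : d * T / 2 <= L%:R by move: Ll dT; slra.
have L0 : (0 < L)%N by rewrite -(ltr0n R); move: Ld dT; slra.
have LR : 0 < L%:R :> R by rewrite ltr0n.
pose H := (Num.truncn (6 / d)).+1.
have /andP[Hl Hu] := truncn_itv (divr_ge0 (ler0n R 6) (ltW dp)).
have l'2 : l'%:R <= 2 * l%:R :> R.
  by apply: (le_trans l'u); rewrite ler_pM2r//; move: d1; slra.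
have bound (m : int) : `|m|%N%:R <= 3 * T -> (`|(m %/ L)%Z| <= H)%N.
  move=> mT.
  have mL : (`|(m %/ L)%Z| * L <= `|m| + L)%N.
    have LZ : L%:Z != 0 by move: L0; slia.
    have := divz_eq m L%:Z; have := ltz_mod m LZ; have := modz_ge0 m LZ.
    rewrite -[X in (_ * X)%N]/(`|L%:Z|)%N -abszM.
    by move: (m %/ L)%Z (m %% L)%Z L0 => q r; move: (q * L%:Z) => P; slia.
  have {}mL : `|(m %/ L)%Z|%N%:R * L%:R <= 3 * T + L%:R :> R.
    by apply: (@le_trans _ _ (`|m|%N%:R + L%:R)); [rewrite -natrM -natrD ler_nat|rewrite lerD2r].
  rewrite -ltnS -(ltr_nat R) -(ltr_pM2r LR); apply: (le_lt_trans mL).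
  have Td : 3 * T <= 6 / d * L%:R.
    rewrite mulrAC ler_pdivlMr//; move: Ld; slra.
  have : 6 / d * L%:R < (H)%:R * L%:R by rewrite ltr_pM2r.
  by rewrite -[H.+1%:R]natr1 mulrDl mul1r; move: Td; slra.
have boxes n : (l <= n)%N -> n%:R <= (1 + d) * l%:R ->
    lattice_sum n (l%:R `^ (- g)) Psi = \sum_(j : 'I_(H.*2.+1) * 'I_(H.*2.+1))
    \sum_(x <- fset_set (lattice_csphere c n) |
       box_index L x == (j.1%:Z - H%:Z, j.2%:Z - H%:Z)) Psi (rpt (l%:R `^ (- g)) x).
  move=> ln nu; apply: lattice_sum_boxes => // x Sx.
  have n2 : n%:R <= 2 * l%:R :> R.
    by apply: (le_trans nu); rewrite ler_pM2r//; move: d1; slra.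
  by have [h1 h2 _] := lattice_coord_le lam1 n2 Sx; split; apply: bound.
have lu : l%:R <= (1 + d) * l%:R.
  by rewrite ler_peMl ?(ltW lam0)//; move: dp; slra.
rewrite (boxes l')// (boxes l)// -sumrB.
apply: (le_trans (ler_norm_sum _ _ _)).
apply: (@le_trans _ _ (\sum_(j : 'I_(H.*2.+1) * 'I_(H.*2.+1))
    2 * (e / 600 * (l%:R `^ (g - 1) * L%:R ^+ 2)))).
  apply: ler_sum => j _.
  have [V hV] := hl l L (j.1%:Z - H%:Z, j.2%:Z - H%:Z) l1l Ld Lu.
  have := hV l' ll' l'u; have := hV l (leqnn l) lu.
  set a := \sum_(_ <- _ | _) _; set b := \sum_(_ <- _ | _) _ => hb ha.
  have -> : b - a = (b - V) - (a - V) by rewrite opprB addrA subrK.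
  apply: (le_trans (ler_normB _ _)).
  by move: ha hb; slra.
rewrite sumr_const card_prod card_ord -[leLHS]mulr_natl.
(* The [2 * H + 1] boxes on each axis have total length at most [17 * T]. *)
have HL : (H.*2.+1)%:R * L%:R <= 17 * T.
  have hH : H.*2.+1%:R <= 12 / d + 5.
    rewrite -muln2 -addn1 natrD natrM /H -[(Num.truncn _).+1%:R]natr1.
    by move: Hl; slra.
  apply: (@le_trans _ _ ((12 / d + 5) * (d * T))); first by rewrite ler_pM.
  rewrite mulrDl mulrA divfK ?gt_eqF//.
  have : d * T <= 1 * T by rewrite ler_pM2r.
  by slra.
have HL2 : (H.*2.+1 * H.*2.+1)%:R * L%:R ^+ 2 <= 289 * T ^+ 2.
  rewrite natrM (_ : _ * _ = ((H.*2.+1)%:R * L%:R) ^+ 2); last first.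
    by rewrite exprMn expr2.
  apply: (@le_trans _ _ ((17 * T) ^+ 2)).
    by rewrite lerXn2r ?nnegrE ?mulr_ge0 ?(ltW T0).
  by rewrite exprMn ler_wpM2r ?exprn_ge0 ?(ltW T0)// expr2; slra.
have TT : l%:R `^ (g - 1) * T ^+ 2 = l%:R `^ (3 * g - 1).
  rewrite expr2 /T -!powRD ?(gt_eqF lam0) ?implybT//.
  by congr (_ `^ _); clear; ring.
rewrite -TT.
rewrite (_ : _ * _ = e / 300 * (l%:R `^ (g - 1) * ((H.*2.+1 * H.*2.+1)%:R * L%:R ^+ 2))); last first.
  by field.
apply: (@le_trans _ _ (e / 300 * (l%:R `^ (g - 1) * (289 * T ^+ 2)))).
  apply: ler_wpM2l; first by move: e0; slra.
  by apply: ler_wpM2l HL2; exact: powR_ge0.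
have : 0 <= e * (l%:R `^ (g - 1) * T ^+ 2).
  by rewrite mulr_ge0 ?(ltW e0)// mulr_ge0 ?powR_ge0 ?exprn_ge0 ?(ltW T0).
by move: (l%:R `^ (g - 1)) (T ^+ 2) => a b; slra.
Qed.

End stability.

(** * Partition of unity and symmetries *)

Section test_functions.
Context {R : realType}.
Local Notation R3 := (R * R * R)%type.

Lemma close_by_ball (x y : R3) (e : R) : (ball x e y : Prop) <->
  [/\ `|x.1.1 - y.1.1| < e, `|x.1.2 - y.1.2| < e & `|x.2 - y.2| < e].
Proof.
by split=> [[[? ?] ?]|[? ? ?]]; split => //; split.
Qed.

(** Boundedness and uniform continuity on the cube, by compactness. *)
Lemma continuous_test_function (Psi : R3 -> R) : continuous Psi ->
  exists B, test_function Psi B.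
Proof.
move=> cPsi.
have cube : [set x : R3 | in_cube x] = `[- 5, 5] `*` `[- 5, 5] `*` `[- 5, 5].
  apply/seteqP; split=> -[[x y] z] /=; rewrite /in_cube/= !in_itv/= -!ler_norml.
    by case=> -> -> ->.
  by case=> -[-> ->] ->.
have cK : compact [set x : R3 | in_cube x].
  by rewrite cube; do 2 ?apply: compact_setX; exact: segment_compact.
have [B [_ hB]] : bounded_set (Psi @` [set x : R3 | in_cube x]).
  apply: compact_bounded; apply: continuous_compact cK.
  exact: continuous_subspaceT.
exists (B + 1); split=> [x Kx|w w0].
  by apply: hB; [rewrite ltrDl|exists x].
pose P (eta : R) (x : R3) := forall y, close_by eta x y -> `|Psi x - Psi y| <= w.
have [H _] := compact_near_coveringP [set x : R3 | in_cube x].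
have loc x : in_cube x -> \forall x' \near x & i \near 0^'+, P i x'.
  move=> _; have w2 : 0 < w / 2 by rewrite divr_gt0.
  have /cvgrPdist_le/(_ _ w2)/nbhs_ballP[r /= r0 hr] := cPsi x.
  have r2 : 0 < r / 2 by rewrite divr_gt0.
  exists (ball x (r / 2), [set i : R | 0 < i < r / 2]).
    split; first exact: nbhsx_ballx.
    by near=> i; apply/andP; split; near: i;
      [exact: nbhs_right_gt|exact: nbhs_right_lt].
  move=> [x' i] /= [xx' /andP[i0 ir]] y [y1 y2 y3].
  have hx' : `|Psi x - Psi x'| <= w / 2.
    by apply: hr; apply: le_ball xx'; rewrite ler_pdivrMr// ler_peMr ?ler1n// ltW.
  have hy : `|Psi x - Psi y| <= w / 2.
    apply: hr; rewrite [r]splitr; apply: ball_triangle xx' _.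
    by apply/close_by_ball; split; exact: le_lt_trans ir.
  rewrite (_ : _ - _ = (Psi x - Psi y) - (Psi x - Psi x')); last by ring.
  by apply: (le_trans (ler_normB _ _)); rewrite [w]splitr lerD.
have nr : \forall i \near 0^'+, [set x | in_cube x] `<=` P i by exact: H.
have /filter_ex[eta [eta0 hP]] : \forall i \near 0^'+, 0 < i /\ [set x | in_cube x] `<=` P i.
  by near=> i; split; near: i; [exact: nbhs_right_gt|exact: nr].
by exists eta => // x y Kx _; exact: hP.
Unshelve. all: by end_near. Qed.

(** Vanishes for [t <= 1 / 4], and is at least [1 / 12] from [1 / 3] on. *)
Definition bump (t : R) : R := Num.max 0 (t - 1 / 4).

Definition bump_sum (x : R3) : R :=
  bump x.1.1 + bump (- x.1.1) + (bump x.1.2 + bump (- x.1.2)) + (bump x.2 + bump (- x.2)).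

(** Dividing by the sum of the bumps makes the six pieces add up to [Psi]
    wherever this sum is at least [1 / 12], which is the case on rescaled
    lattice points. *)
Definition piece (p : R3 -> R) (Psi : R3 -> R) (x : R3) : R :=
  Psi x * (bump (p x) / Num.max (1 / 12) (bump_sum x)).

Lemma bump_ge0 t : 0 <= bump t. Proof. by rewrite /bump le_max lexx. Qed.

Lemma continuous_bump (p : R3 -> R) : continuous p -> continuous (bump \o p).
Proof.
move=> cp x; apply: (@continuous_max R R3 (fun=> 0) (fun y => p y - 1 / 4)).
  exact: cvg_cst.
by apply: cvgB; [exact: cp|exact: cvg_cst].
Qed.

Lemma continuous_coord1 : continuous (fun x : R3 => x.1.1).
Proof. by move=> x; apply: cvg_comp; [exact: cvg_fst|exact: cvg_fst]. Qed.

Lemma continuous_coord2 : continuous (fun x : R3 => x.1.2).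
Proof. by move=> x; apply: cvg_comp; [exact: cvg_fst|exact: cvg_snd]. Qed.

Lemma continuous_coord3 : continuous (fun x : R3 => x.2).
Proof. by move=> x; exact: cvg_snd. Qed.

Lemma continuous_piece (p Psi : R3 -> R) : continuous p -> continuous Psi ->
  continuous (piece p Psi).
Proof.
move=> cp cPsi x; apply: cvgM; first exact: cPsi.
apply: cvgM; first exact: (continuous_bump cp).
have cN (q : R3 -> R) : continuous q -> continuous (fun y => - q y).
  by move=> cq y; apply: cvgN; exact: cq.
have c1 := continuous_bump continuous_coord1; have c2 := continuous_bump continuous_coord2.
have c3 := continuous_bump continuous_coord3.
have d1 := continuous_bump (cN _ continuous_coord1).
have d2 := continuous_bump (cN _ continuous_coord2).
have d3 := continuous_bump (cN _ continuous_coord3).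
apply: cvgV; first by rewrite gt_eqF// lt_max; apply/orP; left; lra.
apply: (@continuous_max R R3 (fun=> 1 / 12) bump_sum); first exact: cvg_cst.
apply: cvgD; last by apply: cvgD; [exact: c3|exact: d3].
by apply: cvgD; apply: cvgD; [exact: c1|exact: d1|exact: c2|exact: d2].
Qed.

End test_functions.

Section symmetries.
Context {R : realType}.
Variable c : R.
Hypotheses (c1 : 1 < c) (c2 : c < 9 / 8).
Let g := c^-1.
Local Notation R3 := (R * R * R)%type.
Implicit Types (x : int * int * int) (Psi : R3 -> R).

Let c0 : 0 < c. Proof. exact: lt_trans c1. Qed.
Let g0 : 0 < g. Proof. by rewrite invr_gt0. Qed.
Let g1 : g < 1. Proof. by rewrite invf_lt1. Qed.

Local Ltac slra := clear - c1 c2 c0 g0 g1; lra.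

Lemma stable_add Psi1 Psi2 : stable c Psi1 -> stable c Psi2 ->
  stable c (fun y => Psi1 y + Psi2 y).
Proof.
move=> s1 s2 e e0; have e2 : 0 < e / 2 by rewrite divr_gt0.
have [d1 d10 [l1 h1]] := s1 _ e2; have [d2 d20 [l2 h2]] := s2 _ e2.
exists (Num.min d1 d2); first by rewrite lt_min d10.
exists (maxn l1 l2) => l l'; rewrite geq_max => /andP[l1l l2l] ll' l'u.
have u (d : R) : Num.min d1 d2 <= d -> l'%:R <= (1 + d) * l%:R.
  by move=> h; apply: (le_trans l'u); rewrite ler_wpM2r// lerD2l.
have m1 : Num.min d1 d2 <= d1 by rewrite ge_min lexx.
have m2 : Num.min d1 d2 <= d2 by rewrite ge_min lexx orbT.
have b1 := h1 l l' l1l ll' (u _ m1).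
have b2 := h2 l l' l2l ll' (u _ m2).
rewrite /lattice_sum !big_split/= -/(lattice_sum c l' _ Psi1) -/(lattice_sum c l _ Psi1).
rewrite -/(lattice_sum c l' _ Psi2) -/(lattice_sum c l _ Psi2).
rewrite opprD addrACA; apply: (le_trans (ler_normD _ _)).
rewrite (_ : e * _ = e / 2 * l%:R `^ (3 * g - 1) + e / 2 * l%:R `^ (3 * g - 1)).
  exact: lerD.
by rewrite -mulrDl -splitr.
Qed.

Lemma lattice_sum_sym (l : nat) (s : R) (sg : int * int * int -> int * int * int)
    (tau : R3 -> R3) Psi :
  involutive sg -> (forall x, lattice_csphere c l x -> lattice_csphere c l (sg x)) ->
  (forall x, tau (rpt s x) = rpt s (sg x)) ->
  lattice_sum c l s (Psi \o tau) = lattice_sum c l s Psi.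
Proof.
move=> sgK sgS tauE; have finS : finite_set (lattice_csphere c l).
  by apply/finite_lattice_csphere/ltW.
rewrite /lattice_sum (eq_bigr (fun x => Psi (rpt s (sg x)))); last first.
  by move=> x _ /=; rewrite tauE.
rewrite -(big_map sg predT (fun x => Psi (rpt s x))); apply: perm_big.
apply: uniq_perm; rewrite ?map_inj_uniq ?fset_uniq//; first exact: inv_inj.
move=> x; apply/mapP/idP => [[y yS ->]|xS].
  by move: yS; rewrite !in_fset_set// !inE; exact: sgS.
exists (sg x); last by rewrite sgK.
by move: xS; rewrite !in_fset_set// !inE; exact: sgS.
Qed.

Lemma stable_ext Psi1 Psi2 :
  (forall (l l' : nat) x, (0 < l)%N -> (l <= l')%N -> lattice_csphere c l' x ->
    Psi1 (rpt (l%:R `^ (- g)) x) = Psi2 (rpt (l%:R `^ (- g)) x)) ->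
  stable c Psi1 -> stable c Psi2.
Proof.
move=> PP s1 e e0; have [d d0 [l0 h]] := s1 _ e0.
exists d => //; exists (maxn 1 l0) => l l'; rewrite geq_max => /andP[l1 l0l] ll' l'u.
have E n : (l <= n)%N ->
    lattice_sum c n (l%:R `^ (- g)) Psi2 = lattice_sum c n (l%:R `^ (- g)) Psi1.
  move=> ln; rewrite /lattice_sum big_seq [RHS]big_seq; apply: eq_bigr => x.
  rewrite in_fset_set ?inE; last by apply/finite_lattice_csphere/ltW.
  by move=> Sx; rewrite (PP _ n).
by rewrite !E//; exact: h.
Qed.

(** The symmetry [tau] brings the coordinate that is large on the support to
    the third place, where [stable_supported] applies. *)
Lemma stable_piece Psi (sg : int * int * int -> int * int * int) (tau : R3 -> R3) :
  continuous Psi -> continuous tau -> involutive sg -> involutive tau ->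
  (forall l x, lattice_csphere c l x -> lattice_csphere c l (sg x)) ->
  (forall s x, tau (rpt s x) = rpt s (sg x)) ->
  (forall y, bump_sum (tau y) = bump_sum y) ->
  stable c (piece (fun y => (tau y).2) Psi).
Proof.
move=> cPsi ctau sgK tauK sgS tauE tb.
have cPt : continuous (Psi \o tau).
  by move=> y; apply: continuous_comp; [exact: ctau|exact: cPsi].
have [B hB] := continuous_test_function (continuous_piece (@continuous_coord3 R) cPt).
have st : stable c (piece (fun y => y.2) (Psi \o tau)).
  apply: (stable_supported c1 c2 _ hB) => y y4; rewrite /piece /bump.
  by rewrite (_ : Num.max 0 (y.2 - 1 / 4) = 0) ?mul0r ?mulr0//; apply: max_l; move: y4; slra.
move=> e e0; have [d d0 [l0 h]] := st e e0; exists d => //; exists l0 => l l' l0l ll' l'u.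
have E n : lattice_sum c n (l%:R `^ (- g)) (piece (fun y => (tau y).2) Psi) =
    lattice_sum c n (l%:R `^ (- g)) (piece (fun y => y.2) (Psi \o tau)).
  rewrite -(lattice_sum_sym (tau := tau) (piece _ (Psi \o tau)) sgK (sgS n) (tauE _)).
  by apply: eq_bigr => x _ /=; rewrite /piece/= tauK tb.
by rewrite !E; exact: h.
Qed.

(** On rescaled lattice points one coordinate exceeds [1 / 3], so that the
    six bumps never vanish together. *)
Lemma bump_sum_ge (l l' : nat) x : (0 < l)%N -> (l <= l')%N ->
  lattice_csphere c l' x -> 1 / 12 <= bump_sum (rpt (l%:R `^ (- g)) x).
Proof.
move=> l0 ll' /mem_lattice Sx; have lam0 : 0 < l%:R :> R by rewrite ltr0n.
have T0 : 0 < l%:R `^ g :> R by rewrite powR_gt0.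
set s := l%:R `^ (- g); have sE : s = (l%:R `^ g)^-1 by rewrite /s powRN.
have s0 : 0 < s by rewrite sE invr_gt0.
have big (m : int) : (l <= 3 * floor_pow c `|m|)%N ->
    1 / 12 <= bump (s * m%:~R) + bump (- (s * m%:~R)).
  move=> lm; have [u _] := floor_pow_itv c `|m|.
  have m3 : l%:R `^ g / 3 <= `|m|%N%:R :> R.
    rewrite -(ler_powRc c1) ?divr_ge0 ?(ltW T0)// powRM ?(ltW T0) ?invr_ge0//.
    rewrite powRgK ?(ltW lam0)//; apply: le_trans u.
    apply: (@le_trans _ _ (l%:R * 3^-1)).
      rewrite ler_wpM2l ?(ltW lam0)//.
      have := @ge1r_powR R 3^-1 c; rewrite invr_gt0 ltr0n invf_le1 ?ltr0n// ler1n.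
      by apply => //; exact: ltW.
    by rewrite ler_pdivrMr// -natrM ler_nat mulnC.
  have : 1 / 3 <= `|s * m%:~R|.
    rewrite normrM (gtr0_norm s0) -intr_norm -natr_absz -(ler_pM2r T0).
    by rewrite [leRHS]mulrAC sE mulVf ?gt_eqF// mul1r; move: m3; slra.
  have := bump_ge0 (s * m%:~R); have := bump_ge0 (- (s * m%:~R)).
  have b1 t : t - 1 / 4 <= bump t :> R by rewrite /bump le_max lexx orbT.
  have := b1 (s * m%:~R); have := b1 (- (s * m%:~R)).
  by move: (s * m%:~R) => t; have [t0|t0] := leP 0 t;
     [rewrite (ger0_norm t0)|rewrite (ltr0_norm t0)]; slra.
have nn (t : R) : 0 <= bump t + bump (- t) by rewrite addr_ge0 ?bump_ge0.
have n1 := nn (s * x.1.1%:~R); have n2 := nn (s * x.1.2%:~R); have n3 := nn (s * x.2%:~R).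
rewrite /bump_sum rpt1 rpt2 rpt3.
have : (l <= 3 * floor_pow c `|x.1.1|)%N \/ (l <= 3 * floor_pow c `|x.1.2|)%N \/
    (l <= 3 * floor_pow c `|x.2|)%N by move: Sx ll'; clear; lia.
by case=> [/big|[/big|/big]]; move: n1 n2 n3; slra.
Qed.

(** Each test function is a sum of six pieces that are supported where a
    given signed coordinate is large, and a permutation of the coordinates
    with a change of sign exchanges these pieces. *)
Lemma stable_continuous Psi : continuous Psi -> stable c Psi.
Proof.
move=> cPsi.
have cN (q : R3 -> R) : continuous q -> continuous (fun y => - q y).
  by move=> cq y; apply: cvgN; exact: cq.
have cp (p q r : R3 -> R) : continuous p -> continuous q -> continuous r ->
    continuous (fun y => (p y, q y, r y) : R3).
  move=> h1 h2 h3 y.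
  apply: (@cvg_pair _ _ _ _ (nbhs (p y, q y)) (nbhs (r y))); last exact: h3.
  by apply: (@cvg_pair _ _ _ _ (nbhs (p y)) (nbhs (q y))); [exact: h1|exact: h2].
have k1 := @continuous_coord1 R; have k2 := @continuous_coord2 R; have k3 := @continuous_coord3 R.
have S0 : stable c (piece (fun y => y.2) Psi).
  by apply: (@stable_piece Psi id id cPsi) => // y; exact: cvg_id.
have S1 : stable c (piece (fun y => - y.2) Psi).
  apply: (@stable_piece Psi (fun x => (x.1, - x.2)) (fun y => (y.1.1, y.1.2, - y.2)) cPsi).
  - by apply: cp => //; exact: cN.
  - by move=> [[? ?] ?]/=; rewrite opprK.
  - by move=> [[? ?] ?]/=; rewrite opprK.
  - by move=> l x /mem_lattice h; apply/mem_lattice; rewrite /= abszN.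
  - by move=> s x; rewrite /rpt/= mulrNz; congr (_, _); rewrite scalerN.
  - by move=> y; rewrite /bump_sum/= opprK; ring.
have S2 : stable c (piece (fun y => y.1.1) Psi).
  apply: (@stable_piece Psi (fun x => (x.2, x.1.2, x.1.1)) (fun y => (y.2, y.1.2, y.1.1)) cPsi).
  - by apply: cp.
  - by move=> [[? ?] ?].
  - by move=> [[? ?] ?].
  - by move=> l x /mem_lattice h; apply/mem_lattice; rewrite /= -h; clear; lia.
  - by [].
  - by move=> y; rewrite /bump_sum/=; ring.
have S3 : stable c (piece (fun y => - y.1.1) Psi).
  apply: (@stable_piece Psi (fun x => (- x.2, x.1.2, - x.1.1))
     (fun y => (- y.2, y.1.2, - y.1.1)) cPsi).
  - by apply: cp => //; exact: cN.
  - by move=> [[? ?] ?]/=; rewrite !opprK.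
  - by move=> [[? ?] ?]/=; rewrite !opprK.
  - by move=> l x /mem_lattice h; apply/mem_lattice; rewrite /= !abszN -h; clear; lia.
  - by move=> s x; rewrite /rpt/= !mulrNz; congr (_, _, _); rewrite scalerN.
  - by move=> y; rewrite /bump_sum/= !opprK; ring.
have S4 : stable c (piece (fun y => y.1.2) Psi).
  apply: (@stable_piece Psi (fun x => (x.1.1, x.2, x.1.2)) (fun y => (y.1.1, y.2, y.1.2)) cPsi).
  - by apply: cp.
  - by move=> [[? ?] ?].
  - by move=> [[? ?] ?].
  - by move=> l x /mem_lattice h; apply/mem_lattice; rewrite /= -h; clear; lia.
  - by [].
  - by move=> y; rewrite /bump_sum/=; ring.
have S5 : stable c (piece (fun y => - y.1.2) Psi).
  apply: (@stable_piece Psi (fun x => (x.1.1, - x.2, - x.1.2))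
     (fun y => (y.1.1, - y.2, - y.1.2)) cPsi).
  - by apply: cp => //; exact: cN.
  - by move=> [[? ?] ?]/=; rewrite !opprK.
  - by move=> [[? ?] ?]/=; rewrite !opprK.
  - by move=> l x /mem_lattice h; apply/mem_lattice; rewrite /= !abszN -h; clear; lia.
  - by move=> s x; rewrite /rpt/= !mulrNz; congr (_, _, _); rewrite scalerN.
  - by move=> y; rewrite /bump_sum/= !opprK; ring.
have := stable_add (stable_add S0 S1) (stable_add (stable_add S2 S3) (stable_add S4 S5)).
apply: stable_ext => l l' x l0 ll' Sx.
have := bump_sum_ge l0 ll' Sx; set y := rpt _ x => b12.
rewrite /piece -!mulrDr -!mulrDl max_r//.
rewrite (_ : (_ + _)%R = bump_sum y); last by rewrite /bump_sum; ring.
by rewrite mulfV ?mulr1// gt_eqF// (lt_le_trans _ b12).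
Qed.

End symmetries.

(** * Lattice sums over shells as integrals *)

Section grid.
Context {R : realType}.
Local Notation R3 := (R * R * R)%type.
Local Notation mu1 := (@lebesgue_measure R).
Implicit Types (m : int * int * int) (t : R).

Definition grid t (x : space3 R) : int * int * int :=
  (Num.floor (t * x.1.1), Num.floor (t * x.1.2), Num.floor (t * x.2)).

Definition cell1 t (n : int) : set (measurableTypeR R) := `[n%:~R / t, (n + 1)%:~R / t[.

Definition cell t m : set (space3 R) :=
  cell1 t m.1.1 `*` cell1 t m.1.2 `*` cell1 t m.2.

Lemma cell1E t n x : 0 < t -> cell1 t n x <-> Num.floor (t * x) = n.
Proof.
move=> t0; rewrite /cell1/= in_itv/= ler_pdivrMr// ltr_pdivlMr// [x * t]mulrC.
by rewrite -floor_eq; split=> [/eqP|->].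
Qed.

Lemma cellE t m x : 0 < t -> cell t m x <-> grid t x = m.
Proof.
move=> t0; case: m => -[a b] d; rewrite /cell /grid/= !cell1E//.
by split=> [[[-> ->] ->]//|[-> -> ->]].
Qed.

Lemma measurable_cell t m : measurable (cell t m).
Proof. by apply: measurableX; [apply: measurableX|]; exact: measurable_itv. Qed.

Lemma lebesgue_cell1 t n : 0 < t -> mu1 (cell1 t n) = (t^-1)%:E.
Proof.
move=> t0; rewrite /cell1 lebesgue_measure_itv/= lte_fin.
rewrite ltr_pM2r ?invr_gt0// ltr_int ltrDl ltr01 -EFinB -mulrBl intrD addrAC subrr add0r.
by rewrite mul1r.
Qed.

Lemma lebesgue_cell t m : 0 < t -> lebesgue3 R (cell t m) = ((t^-1) ^+ 3)%:E.
Proof.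
move=> t0.
have mC n : measurable (cell1 t n) by exact: measurable_itv.
transitivity ((mu1 \x mu1)%E (cell1 t m.1.1 `*` cell1 t m.1.2) * mu1 (cell1 t m.2))%E.
  by apply: product_measure1E => //; exact: measurableX.
rewrite product_measure1E//.
transitivity ((t^-1)%:E * (t^-1)%:E * (t^-1)%:E)%E.
  by congr (_ * _ * _)%E; exact: lebesgue_cell1.
by rewrite -!EFinM !exprS expr0 mulr1 mulrA.
Qed.

Lemma measurable_grid t (F : int * int * int -> R) : 0 < t ->
  measurable_fun [set: space3 R] (F \o grid t).
Proof.
move=> t0 _ Y mY; rewrite setTI.
have -> : (F \o grid t) @^-1` Y = \bigcup_(m in F @^-1` Y) cell t m.
  apply/seteqP; split=> x.
    by move=> Yx; exists (grid t x) => //; exact: (@cellE t _ x t0).2.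
  by move=> [m /= Ym /(@cellE t m x t0).1 xm]; rewrite /= xm.
rewrite bigcup_mkcond; apply: countable_bigcupT_measurable.
  exact: countableP.
by move=> m; case: ifP => _; [exact: measurable_cell|exact: measurable0].
Qed.

Lemma grid_close t (x : R3) : 0 < t ->
  [/\ `|x.1.1 - (rpt t^-1 (grid t x)).1.1| <= t^-1,
      `|x.1.2 - (rpt t^-1 (grid t x)).1.2| <= t^-1 &
      `|x.2 - (rpt t^-1 (grid t x)).2| <= t^-1].
Proof.
move=> t0; have h (u : R) : `|u - t^-1 * (Num.floor (t * u))%:~R| <= t^-1.
  have /andP[l r] := floor_itv (t * u); rewrite intrD in r.
  rewrite -(ler_pM2l t0) mulfV ?gt_eqF// -{1}(gtr0_norm t0) -normrM mulrBr mulrA.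
  by rewrite mulfV ?gt_eqF// mul1r ger0_norm; lra.
by rewrite rpt1 rpt2 rpt3; split; exact: h.
Qed.

Lemma grid_cvg (t : nat -> R) (x : R3) : (forall n, 0 < t n) ->
  (t n)^-1 @[n --> \oo] --> 0 ->
  rpt (t n)^-1 (grid (t n) x) @[n --> \oo] --> x.
Proof.
move=> t0 tV; have coord (u : nat -> R) (v : R) : (forall n, `|v - u n| <= (t n)^-1) ->
    u n @[n --> \oo] --> v.
  move=> uv; apply/cvgrPdist_le => e e0.
  move/cvgrPdist_le : tV => /(_ e e0); apply: filterS => n.
  rewrite sub0r normrN => h; apply: (le_trans (uv n)).
  by apply: le_trans h; exact: ler_norm.
have cp (p q r : nat -> R) (a b d : R) : p n @[n --> \oo] --> a ->
    q n @[n --> \oo] --> b -> r n @[n --> \oo] --> d ->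
    (p n, q n, r n) @[n --> \oo] --> ((a, b, d) : R3).
  move=> h1 h2 h3; apply: (@cvg_pair _ _ _ _ (nbhs (a, b)) (nbhs d)); last exact: h3.
  by apply: (@cvg_pair _ _ _ _ (nbhs a) (nbhs b)).
case: x => -[a b] d; apply: cp; apply: coord => n;
  by have [h1 h2 h3] := grid_close (a, b, d) (t0 n).
Qed.

(** The space carries the product of three Borel sigma-algebras; a continuous
    function is measurable for it as a limit of functions that are constant
    on the cells of a finer and finer grid. *)
Lemma measurable_continuous3 (Psi : R3 -> R) : continuous Psi ->
  measurable_fun [set: space3 R] (Psi : space3 R -> R).
Proof.
move=> cPsi; pose t (n : nat) : R := n.+1%:R.
apply: (@measurable_fun_cvg _ _ _ _ (fun n => (fun m => Psi (rpt (t n)^-1 m)) \o grid (t n))).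
  by move=> n; apply: measurable_grid; rewrite ltr0n.
move=> x _; apply: continuous_cvg; first exact: cPsi.
apply: grid_cvg; first by move=> n; rewrite ltr0n.
exact: cvg_harmonic.
Qed.

Lemma integral_cells t (s : seq (int * int * int)) (F : int * int * int -> R) :
  0 < t ->
  (\int[lebesgue3 R]_x (\sum_(m <- s) F m * \1_(cell t m) x)%:E =
   ((t^-1) ^+ 3 * \sum_(m <- s) F m)%:E)%E.
Proof.
move=> t0.
have int_ind m : (lebesgue3 R).-integrable setT (fun x => (\1_(cell t m) x)%:E).
  apply/integrableP; split.
    by apply/measurable_EFinP; apply: measurable_indic; exact: measurable_cell.
  rewrite (eq_integral (fun x => (\1_(cell t m) x)%:E)); last first.
    by move=> x _; rewrite gee0_abs// lee_fin.
  rewrite integral_indic//; last exact: measurable_cell.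
  by rewrite setIT; apply: (le_lt_trans (_ : _ <= ((t^-1) ^+ 3)%:E)%E);
    [rewrite lebesgue_cell|rewrite ltry].
have int_cell m : (lebesgue3 R).-integrable setT (fun x => ((F m)%:E * (\1_(cell t m) x)%:E)%E).
  exact: integrableZl.
under eq_integral do (rewrite -sumEFin; under eq_bigr do rewrite EFinM).
rewrite integral_sum//.
under eq_bigr.
  move=> m _; rewrite integralZl//.
  rewrite integral_indic//; last exact: measurable_cell.
  rewrite setIT [X in (_ * X)%E](_ : _ = ((t^-1) ^+ 3)%:E); last exact: lebesgue_cell.
  rewrite -EFinM; over.
by rewrite sumEFin -mulr_suml mulrC.
Qed.

End grid.

Section shells.
Context {R : realType}.
Variable c : R.
Hypotheses (c1 : 1 < c) (c2 : c < 9 / 8).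
Let g := c^-1.
Local Notation R3 := (R * R * R)%type.
Implicit Types (m : int * int * int).

Let c0 : 0 < c. Proof. exact: lt_trans c1. Qed.
Let g0 : 0 < g. Proof. by rewrite invr_gt0. Qed.

Local Ltac slra := clear - c1 c2 c0 g0; lra.
Local Ltac slia := clear - c1 c2 c0 g0; lia.

(** The [c]-th power of [cnorm c]. *)
Definition gauge (x : R3) : R := `|x.1.1| `^ c + `|x.1.2| `^ c + `|x.2| `^ c.

Definition shell (d : R) : set (space3 R) := [set x | 1 < gauge x < 1 + d].

Definition level m : nat :=
  (floor_pow c `|m.1.1| + floor_pow c `|m.1.2| + floor_pow c `|m.2|)%N.

Definition shell_points (l J : nat) : set (int * int * int) :=
  [set m | (l <= level m < l + J)%N].

Lemma finite_shell_points l J : finite_set (shell_points l J).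
Proof.
apply: (@sub_finite_set _ _ (\bigcup_(j in `I_(l + J)) lattice_csphere c j)).
  by move=> m /andP[_ lJ]; exists (level m) => //; exact/mem_lattice.
apply: bigcup_finite; first exact: finite_II.
by move=> j _; apply/finite_lattice_csphere/ltW.
Qed.

Lemma sum_shell_points l J (F : int * int * int -> R) :
  \sum_(m <- fset_set (shell_points l J)) F m =
  \sum_(j < J) \sum_(m <- fset_set (lattice_csphere c (l + j))) F m.
Proof.
case: J => [|J].
  rewrite big_ord0 (_ : shell_points l 0 = set0) ?fset_set0 ?big_nil//.
  by apply/seteqP; split=> m //=; rewrite /shell_points/=; slia.
pose p m : 'I_J.+1 := inord (level m - l).
rewrite (partition_big p xpredT)//=; apply: eq_bigr => j _.
rewrite -big_filter; apply: perm_big; apply: uniq_perm.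
- by rewrite filter_uniq// fset_uniq.
- exact: fset_uniq.
have fS := finite_shell_points l J.+1.
have fL : finite_set (lattice_csphere c (l + j)) by apply/finite_lattice_csphere/ltW.
move=> m; rewrite mem_filter !in_fset_set//; apply/andP/idP.
  rewrite !inE /p => -[/eqP pj /andP[l1 l2]]; apply/mem_lattice.
  rewrite -/(level m) -pj inordK; first by rewrite subnKC.
  by move: l1 l2; slia.
rewrite !inE => /mem_lattice; rewrite -/(level m) => E.
rewrite /p /shell_points/= E addKn inord_val eqxx; split=> //.
by rewrite leq_addr/= ltn_add2l ltn_ord.
Qed.

Lemma continuous_gauge : continuous gauge.
Proof.
have h (p : R3 -> R) : continuous p -> continuous (fun x => `|p x| `^ c).
  by move=> cp x; apply: (@continuous_comp _ _ _ p (fun t : R => `|t| `^ c));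
    [exact: cp|exact: continuous_norm_powR].
move=> x; apply: cvgD; last exact: (h _ (@continuous_coord3 R)).
by apply: cvgD; [exact: (h _ (@continuous_coord1 R))|exact: (h _ (@continuous_coord2 R))].
Qed.

(** The three floors cost at most [3] units of the level, and the level is
    scaled by [lam^-1]. *)
Lemma level_gauge (s lam : R) m : 0 < s -> s `^ c = lam^-1 ->
  gauge (rpt s m) - 3 * lam^-1 <= (level m)%:R * lam^-1 <= gauge (rpt s m).
Proof.
move=> s0 sc; have l0 : 0 < lam^-1 by rewrite -sc powR_gt0.
have h (n : int) : (floor_pow c `|n|)%:R * lam^-1 <= `|s * n%:~R| `^ c <=
    (floor_pow c `|n|)%:R * lam^-1 + lam^-1.
  have [u v] := floor_pow_itv c `|n|.
  rewrite normrM (gtr0_norm s0) -intr_norm -natr_absz.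
  rewrite powRM ?(ltW s0)// sc -[X in _ <= _ + X]mul1r -mulrDl [lam^-1 * _]mulrC.
  by rewrite ler_pM2r// ler_pM2r// u ltW.
have /andP[a1 b1] := h m.1.1; have /andP[a2 b2] := h m.1.2; have /andP[a3 b3] := h m.2.
rewrite /gauge rpt1 rpt2 rpt3 /level !natrD.
by apply/andP; split; move: a1 b1 a2 b2 a3 b3; slra.
Qed.

(** The cells are disjoint: at most the cell of [x] contributes. *)
Lemma sum_cell_eval (A : set (int * int * int)) (F : int * int * int -> R) (t : R) x :
  finite_set A -> 0 < t ->
  \sum_(m <- fset_set A) F m * \1_(cell t m) x =
  if pselect (A (grid t x)) then F (grid t x) else 0.
Proof.
move=> fA t0; case: pselect => [Ax|Ax].
  rewrite (bigD1_seq (grid t x))/= ?fset_uniq//; last first.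
    by rewrite in_fset_set// inE.
  rewrite indicE mem_set ?mulr1; last exact: (@cellE R t _ x t0).2.
  rewrite big1 ?addr0// => m mx; rewrite indicE memNset ?mulr0//.
  by move=> /(@cellE R t _ x t0).1 E; rewrite E eqxx in mx.
rewrite big_seq big1// => m; rewrite in_fset_set// inE => Am.
rewrite indicE memNset ?mulr0//.
by move=> /(@cellE R t _ x t0).1 E; apply: Ax; rewrite E.
Qed.

End shells.

Section shell_limit.
Context {R : realType}.
Variable c : R.
Hypotheses (c1 : 1 < c) (c2 : c < 9 / 8).
Let g := c^-1.
Local Notation R3 := (R * R * R)%type.
Implicit Types (m : int * int * int).

Let c0 : 0 < c. Proof. exact: lt_trans c1. Qed.
Let g0 : 0 < g. Proof. by rewrite invr_gt0. Qed.

Lemma measurable_gauge : measurable_fun [set: space3 R] (gauge c : space3 R -> R).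
Proof. by apply: measurable_continuous3; exact: continuous_gauge. Qed.

Lemma measurable_shell d : measurable (shell c d).
Proof.
have -> : shell c d = gauge c @^-1` `]1, 1 + d[.
  by apply/seteqP; split=> x /=; rewrite in_itv/=.
by rewrite -[X in measurable X]setTI; exact: measurable_gauge.
Qed.

(** A cube that contains the rescaled points together with their cells, and
    on which test functions are bounded. *)
Definition itv5 : set (measurableTypeR R) := `[- 5, 5].

Definition cube5 : set (space3 R) := itv5 `*` itv5 `*` itv5.

Lemma measurable_cube5 : measurable cube5.
Proof. by apply: measurableX; [apply: measurableX|]; exact: measurable_itv. Qed.

Lemma cube5E (x : R3) : in_cube x -> cube5 x.
Proof. by case=> *; split; [split|]; rewrite /itv5 /= in_itv/= -ler_norml. Qed.

Lemma integrable_indic_lty (A : set (space3 R)) : measurable A ->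
  (lebesgue3 R A < +oo)%E -> (lebesgue3 R).-integrable setT (fun x => (\1_A x)%:E).
Proof.
move=> mA Afin; apply/integrableP; split.
  by apply/measurable_EFinP; exact: measurable_indic.
rewrite (eq_integral (fun x => (\1_A x)%:E)); last first.
  by move=> x _; rewrite gee0_abs// lee_fin.
by rewrite integral_indic// setIT.
Qed.

Lemma lebesgue_cube5_lty : (lebesgue3 R cube5 < +oo)%E.
Proof.
have fin : (@lebesgue_measure R itv5 < +oo)%E.
  by rewrite lebesgue_measure_itv/=; case: ifP => _; rewrite ltry.
have mI : measurable itv5 by exact: measurable_itv.
rewrite (_ : lebesgue3 R cube5 = (@lebesgue_measure R \x @lebesgue_measure R)%E
    (itv5 `*` itv5) * @lebesgue_measure R itv5)%E; last first.
  by apply: product_measure1E => //; exact: measurableX.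
rewrite product_measure1E// -[X in (_ * X)%E]fineK ?ge0_fin_numE//.
by rewrite -[X in (X * X * _)%E]fineK ?ge0_fin_numE// -!EFinM ltry.
Qed.

Section limit.
Variables (Psi : R3 -> R) (d : R).
Hypotheses (cPsi : continuous Psi) (d0 : 0 < d) (d1 : d <= 1).
Hypothesis null1 : lebesgue3 R [set x : space3 R | gauge c x = 1] = 0%E.
Hypothesis null2 : lebesgue3 R [set x : space3 R | gauge c x = 1 + d] = 0%E.

Let T (n : nat) : R := n.+1%:R `^ g.
Let s (n : nat) : R := n.+1%:R `^ (- g).
Let J (n : nat) : nat := Num.truncn (d * n.+1%:R).

Let l0 n : 0 < n.+1%:R :> R. Proof. exact: ltr0n. Qed.
Let T0 n : 0 < T n. Proof. by rewrite powR_gt0. Qed.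
Let sE n : s n = (T n)^-1. Proof. by rewrite /s powRN. Qed.
Let s0 n : 0 < s n. Proof. by rewrite powR_gt0. Qed.
Let sc n : s n `^ c = n.+1%:R^-1.
Proof.
by rewrite /s -powRrM mulNr mulVf ?gt_eqF// powR_inv1.
Qed.

Lemma rescaling_cvg0 : (T n)^-1 @[n --> \oo] --> 0.
Proof.
have : (T : nat -> R) @ \oo --> +oo.
  apply/cvgryPge => A; near=> n.
  have [A0|A0] := leP A 0; first by apply: (le_trans A0); rewrite ltW.
  rewrite /T -(ler_powRc c1) ?powR_ge0 ?(ltW A0)// powRgK ?(ltW (l0 n))//.
  apply: (@le_trans _ _ n%:R); last by rewrite ler_nat.
  near: n; exact: nbhs_infty_ger.
move=> h; apply/gtr0_cvgV0 => //; first by near=> n.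
Unshelve. all: by end_near. Qed.

(** The function that is constant on the cells and whose integral is the
    rescaled sum. *)
Let G n (x : space3 R) : R :=
  \sum_(m <- fset_set (shell_points c n.+1 (J n))) Psi (rpt (s n) m) * \1_(cell (T n) m) x.

Let Jl n : d * n.+1%:R - 1 <= (J n)%:R <= d * n.+1%:R.
Proof.
have /andP[u v] := truncn_itv (mulr_ge0 (ltW d0) (ltW (l0 n))).
by rewrite u andbT lerBlDr natr1 ltW.
Qed.

Let cvg_grid x : rpt (s n) (grid (T n) x) @[n --> \oo] --> (x : R3).
Proof.
rewrite (_ : (fun n => _) = (fun n => rpt (T n)^-1 (grid (T n) x))).
  by apply: grid_cvg; [exact: T0|exact: rescaling_cvg0].
by apply/funext => n; rewrite sE.
Qed.

Let cvg_level x : (level c (grid (T n) x))%:R * (n.+1%:R)^-1 @[n --> \oo] --> gauge c x.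
Proof.
have cg : gauge c (rpt (s n) (grid (T n) x)) @[n --> \oo] --> gauge c x.
  apply: continuous_cvg; first exact: continuous_gauge.
  exact: cvg_grid.
apply: (squeeze_cvgr (f := fun n => gauge c (rpt (s n) (grid (T n) x)) - 3 * (n.+1%:R)^-1)
    (h := fun n => gauge c (rpt (s n) (grid (T n) x)))) => //.
  by near=> n; exact: level_gauge.
rewrite -[X in _ --> X]subr0 -(mulr0 3).
by apply: cvgB => //; apply: cvgM; [exact: cvg_cst|exact: cvg_harmonic].
Unshelve. all: by end_near. Qed.

Let cvg_J : (J n)%:R * (n.+1%:R)^-1 @[n --> \oo] --> d.
Proof.
apply: (squeeze_cvgr (f := fun n => d - (n.+1%:R)^-1) (h := fun=> d)).
- near=> n; have /andP[u v] := Jl n.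
  rewrite ler_pdivlMr// mulrBl mulVf ?gt_eqF// u/=.
  by rewrite ler_pdivrMr.
- rewrite -[X in _ --> X]subr0; apply: cvgB; first exact: cvg_cst.
  exact: cvg_harmonic.
- exact: cvg_cst.
Unshelve. all: by end_near. Qed.

Let inshell n x : (shell_points c n.+1 (J n) (grid (T n) x) : Prop) <->
  1 <= (level c (grid (T n) x))%:R * (n.+1%:R : R)^-1 < 1 + (J n)%:R * n.+1%:R^-1.
Proof.
have -> : 1 + (J n)%:R * n.+1%:R^-1 = (n.+1 + J n)%:R * n.+1%:R^-1 :> R.
  by rewrite natrD mulrDl mulfV// gt_eqF.
by rewrite ler_pdivlMr// mul1r ltr_pM2r ?invr_gt0// ler_nat ltr_nat.
Qed.

Let G_cvg x : gauge c x != 1 -> gauge c x != 1 + d ->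
  G n x @[n --> \oo] --> Psi x * \1_(shell c d) x.
Proof.
move=> x1 x2.
have GE n : G n x = if pselect (shell_points c n.+1 (J n) (grid (T n) x))
    then Psi (rpt (s n) (grid (T n) x)) else 0.
  rewrite /G (@sum_cell_eval R (shell_points c n.+1 (J n)) (fun m => Psi (rpt (s n) m)))//.
  exact: finite_shell_points.
have cJ : 1 + (J n)%:R * (n.+1%:R)^-1 @[n --> \oo] --> 1 + d.
  by apply: cvgD; [exact: cvg_cst|exact: cvg_J].
have cL := cvg_level (x := x).
have [/andP[a b]|out] := boolP (1 < gauge c x < 1 + d).
  rewrite indicE mem_set ?mulr1; last by rewrite /shell/= a b.
  have mid : (gauge c x + (1 + d)) / 2 < 1 + d by move: b; lra.
  have mid' : gauge c x < (gauge c x + (1 + d)) / 2 by move: b; lra.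
  have cP : Psi (rpt (s n) (grid (T n) x)) @[n --> \oo] --> Psi x.
    by apply: continuous_cvg; [exact: cPsi|exact: cvg_grid].
  apply: cvg_trans cP; apply: near_eq_cvg; near=> n.
  rewrite GE; case: pselect => // -[]; apply/inshell; apply/andP; split.
    apply: ltW; near: n; exact: (cvgr_gt _ cL _ a).
  apply: (@lt_trans _ _ ((gauge c x + (1 + d)) / 2)).
    by near: n; exact: (cvgr_lt _ cL _ mid').
  by near: n; exact: (cvgr_gt _ cJ _ mid).
rewrite indicE memNset ?mulr0; last by apply/negP.
apply: cvg_near_cst; move: out; rewrite negb_and -!leNgt => /orP[le1|ge2].
  have lt1 : gauge c x < 1 by rewrite lt_neqAle x1.
  near=> n; rewrite GE; case: pselect => // Hs; exfalso; move: Hs => /inshell/andP[u _].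
  suff : (level c (grid (T n) x))%:R * (n.+1%:R)^-1 < 1 :> R by rewrite ltNge u.
  by near: n; exact: (cvgr_lt _ cL _ lt1).
have gt2 : 1 + d < gauge c x by rewrite lt_neqAle eq_sym x2.
near=> n; rewrite GE; case: pselect => // Hs; exfalso; move: Hs => /inshell/andP[_ v].
suff h : 1 + d <= (level c (grid (T n) x))%:R * (n.+1%:R)^-1.
  have /andP[_ w] := Jl n.
  have jd : (J n)%:R * (n.+1%:R)^-1 <= d by rewrite ler_pdivrMr.
  have := lt_le_trans v (_ : _ <= 1 + d); rewrite lerD2l => /(_ jd).
  by rewrite ltNge h.
by apply: ltW; near: n; exact: (cvgr_gt _ cL _ gt2).
Unshelve. all: by end_near. Qed.

Let measurable_G n : measurable_fun setT (G n).
Proof.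
rewrite (_ : G n = (fun m => if pselect (shell_points c n.+1 (J n) m)
    then Psi (rpt (s n) m) else 0) \o grid (T n)).
  by apply: measurable_grid.
apply/funext => x /=.
rewrite /G (@sum_cell_eval R (shell_points c n.+1 (J n)) (fun m => Psi (rpt (s n) m)))//.
exact: finite_shell_points.
Qed.

Let G_dominated : exists B : R, forall n x, `|G n x| <= B * \1_cube5 x.
Proof.
have [B [PB _]] := continuous_test_function cPsi.
have B0 : 0 <= B.
  apply: (le_trans (normr_ge0 (Psi 0))); apply: PB.
  by split; rewrite /= normr0.
exists B => n x.
rewrite /G (@sum_cell_eval R (shell_points c n.+1 (J n)) (fun m => Psi (rpt (s n) m)))//; last first.
  exact: finite_shell_points.
case: pselect => Sx /=; last by rewrite normr0 mulr_ge0.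
have lam1 : 1 <= n.+1%:R :> R by rewrite ler1n.
have [b1 b2 b3] : [/\ `|(grid (T n) x).1.1|%N%:R <= 3 * T n,
    `|(grid (T n) x).1.2|%N%:R <= 3 * T n & `|(grid (T n) x).2|%N%:R <= 3 * T n].
  apply: (@lattice_coord_le R c c1 c2 (level c (grid (T n) x)) n.+1%:R) => //; last first.
    exact/mem_lattice.
  have /andP[_ w] := Jl n; move: Sx => /andP[_]; rewrite -(ltr_nat R) natrD => h.
  have : d * n.+1%:R <= n.+1%:R by rewrite ler_piMl.
  by move: h w; lra.
have T1 : (T n)^-1 <= 1.
  by rewrite invf_le1//; have := ler_powR lam1 (ltW g0); rewrite powRr0.
have bound (k : int) : `|k|%N%:R <= 3 * T n -> `|s n * k%:~R| <= 3.
  by rewrite normrM (gtr0_norm (s0 n)) -intr_norm -natr_absz sE [_^-1 * _]mulrC ler_pdivrMr.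
have [k1 k2 k3] := And3 (bound _ b1) (bound _ b2) (bound _ b3).
have [q1 q2 q3] := grid_close (x : R3) (T0 n).
rewrite -sE rpt1 rpt2 rpt3 in q1 q2 q3; rewrite -sE in T1.
have far (u v : R) : `|u - v| <= s n -> `|v| <= 3 -> `|u| <= 5.
  by move=> uv v3; rewrite -(subrK v u); apply: (le_trans (ler_normD _ _)); move: uv v3 T1; lra.
have xc : in_cube (x : R3) by split; [exact: far q1 k1|exact: far q2 k2|exact: far q3 k3].
rewrite indicE mem_set ?mulr1; last exact: cube5E.
apply: PB; split; rewrite ?rpt1 ?rpt2 ?rpt3.
- by move: k1; lra.
- by move: k2; lra.
- by move: k3; lra.
Qed.

(** Lattice points weighted by [T ^- 3] converge to Lebesgue measure: the sum
    is the integral of a function that is constant on the cells of the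
    rescaled lattice, and it converges pointwise off the two boundary
    spheres. *)
Lemma shell_sum_cvg :
  ((s n) ^+ 3 * \sum_(m <- fset_set (shell_points c n.+1 (J n))) Psi (rpt (s n) m))%:E
    @[n --> \oo] --> (\int[lebesgue3 R]_x (Psi x * \1_(shell c d) x)%:E)%E.
Proof.
have [B GB] := G_dominated.
have mP : measurable_fun setT (fun x : space3 R => (Psi x * \1_(shell c d) x)%:E).
  apply/measurable_EFinP; apply: measurable_funM; first exact: measurable_continuous3.
  by apply: measurable_indic; exact: measurable_shell.
have [] := @dominated_convergence _ (space3 R) R (lebesgue3 R) setT measurableT
  (fun n x => (G n x)%:E) (fun x => (Psi x * \1_(shell c d) x)%:E)
  (fun x => (B * \1_cube5 x)%:E).
- by move=> n; apply/measurable_EFinP; exact: measurable_G.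
- exact: mP.
- pose N1 := [set x : space3 R | gauge c x = 1]; pose N2 := [set x : space3 R | gauge c x = 1 + d].
  have mN (a : R) : measurable [set x : space3 R | gauge c x = a].
    rewrite (_ : [set x | _] = gauge c @^-1` [set a])//.
    by rewrite -[X in measurable X]setTI; exact: measurable_gauge.
  exists (N1 `|` N2); split; first by apply: measurableU; exact: mN.
    by apply: null_set_setU => //; exact: mN.
  move=> x /= nx; apply: contrapT => /not_orP[/eqP x1 /eqP x2]; apply: nx => _.
  by apply: cvg_EFin; [exact: nearW|exact: (G_cvg x1 x2)].
- apply: (@eq_integrable _ _ _ _ _ _ (fun x => B%:E * (\1_cube5 x)%:E)%E).
  + exact: measurableT.
  + by move=> x _; rewrite EFinM.
  + apply: integrableZl => //; apply: integrable_indic_lty.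
      exact: measurable_cube5.
    exact: lebesgue_cube5_lty.
- by apply/aeW => x n _; rewrite lee_fin.
move=> _ _; apply: cvg_trans; apply: near_eq_cvg; near=> n => /=.
by rewrite (@integral_cells R (T n) _ (fun m => Psi (rpt (s n) m)))// sE.
Unshelve. all: by end_near. Qed.

End limit.
End shell_limit.

(** * Thin shells in polar coordinates *)

Section polar.
Context {R : realType}.
Variable c : R.
Hypotheses (c1 : 1 < c) (c2 : c < 9 / 8).
Let g := c^-1.
Local Notation R3 := (R * R * R)%type.
Local Notation mu1 := (@lebesgue_measure R).

Let c0 : 0 < c. Proof. exact: lt_trans c1. Qed.
Let g0 : 0 < g. Proof. by rewrite invr_gt0. Qed.

Lemma gauge_ge0 (x : R3) : 0 <= gauge c x.
Proof. by rewrite !addr_ge0 ?powR_ge0. Qed.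

Lemma gauge_scale (r : R) (x : R3) : 0 <= r -> gauge c (r *: x) = r `^ c * gauge c x.
Proof.
move=> r0; have h (u : R) : `|r * u| `^ c = r `^ c * `|u| `^ c.
  by rewrite normrM (ger0_norm r0) powRM.
by rewrite /gauge !mulrDr -!h.
Qed.

Lemma csphereE (x : R3) : csphere c x <-> gauge c x = 1.
Proof.
rewrite /csphere/= /cnorm -/(gauge c x) -/g; split=> [h|->]; last by rewrite powR1.
by rewrite -[gauge c x](powRgK c1 (gauge_ge0 x)) -/g h powR1.
Qed.

Lemma measurable_csphere : measurable (csphere c : set (space3 R)).
Proof.
rewrite (_ : csphere c = gauge c @^-1` [set 1]).
  by rewrite -[X in measurable X]setTI; apply: measurable_gauge.
by apply/seteqP; split=> x; [move=> /csphereE|move=> h; apply/csphereE].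
Qed.

Variable mu : {measure set (space3 R) -> \bar R}.
Hypothesis hmu : is_csphere_measure c mu.

(** The form of the polar formula used below: the inner integral only has to
    be computed for [0 < r]. *)
Lemma polar_radial (f : space3 R -> \bar R) (h : R -> \bar R) :
  (measurable_fun setT f /\ (forall x, 0 <= f x)%E) \/ (lebesgue3 R).-integrable setT f ->
  (forall r : R, 0 < r -> (\int[mu]_(y in csphere c) f (r *: (y : R3)) = h r)%E) ->
  (\int[lebesgue3 R]_x f x = \int[mu1]_(r in `]0%R, +oo[) ((r ^+ 2)%:E * h r))%E.
Proof.
move=> hf hh; rewrite hmu.2//; apply: eq_integral => r.
by rewrite inE/= in_itv/= andbT => r0; rewrite hh.
Qed.

(** In polar coordinates a single radius contributes. *)
Lemma null_sphere (a : R) : lebesgue3 R [set x : space3 R | gauge c x = a] = 0%E.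
Proof.
set N := [set x | _].
have mN : measurable N.
  rewrite (_ : N = gauge c @^-1` [set a])//.
  by rewrite -[X in measurable X]setTI; exact: measurable_gauge.
transitivity (\int[lebesgue3 R]_x (\1_N x)%:E)%E.
  by rewrite integral_indic// setIT.
have inN (r : R) (y : space3 R) : 0 < r -> csphere c y ->
    \1_N (r *: (y : R3)) = (r `^ c == a)%:R :> R.
  move=> /ltW r0 /csphereE yS; rewrite indicE; congr ((nat_of_bool _)%:R).
  by apply/idP/eqP; rewrite inE /N/= gauge_scale// yS mulr1.
rewrite (@polar_radial _ (fun r : R => (((r `^ c == a)%:R : R)%:E * mu (csphere c))%E)).
- set F := fun r : R => ((r ^+ 2)%:E * (((r `^ c == a)%:R)%:E * mu (csphere c)))%E.
  transitivity (\int[mu1]_(r in `]0%R, +oo[) (F \_ [set (a `^ g)%R]) r)%E.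
    apply: eq_integral => r; rewrite inE/= in_itv/= andbT => r0.
    rewrite patchE; case: ifPn => // rN; rewrite /F.
    rewrite (_ : (r `^ c == a) = false) ?mul0e ?mule0//.
    apply/eqP => E; move: rN; rewrite notin_setE; apply => /=.
    by rewrite -E powRcK// ltW.
  by rewrite -integral_mkcondr (@integral_Sset1 _ _ _ (a `^ g))//; exact: subIsetr.
- left; split; first by apply/measurable_EFinP; exact: measurable_indic.
  by move=> x; rewrite lee_fin.
move=> r r0; rewrite -integral_cst; last exact: measurable_csphere.
by apply: eq_integral => y; rewrite inE => yS; rewrite inN.
Qed.

Section finite_mass.
Variable M : R.
Hypotheses (M0 : 0 < M) (muM : mu (csphere c) = M%:E).

Let gauge_shell d (r : R) (y : space3 R) : 0 < r -> csphere c y ->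
  (shell c d (r *: (y : R3)) <-> 1 < r `^ c < 1 + d).
Proof. by move=> /ltW r0 /csphereE yS; rewrite /shell/= gauge_scale// yS mulr1. Qed.

Lemma shell_volumeE d : (lebesgue3 R (shell c d) =
  \int[mu1]_(r in `]0%R, +oo[) ((r ^+ 2)%:E * ((\1_[set r : R | (1 < r `^ c < 1 + d)%R] r * M)%:E)))%E.
Proof.
transitivity (\int[lebesgue3 R]_x (\1_(shell c d) x)%:E)%E.
  by rewrite integral_indic// ?setIT//; exact: measurable_shell.
apply: polar_radial.
- left; split; last by move=> x; rewrite lee_fin.
  by apply/measurable_EFinP; apply: measurable_indic; exact: measurable_shell.
move=> r r0; rewrite EFinM -muM -integral_cst; last exact: measurable_csphere.
apply: eq_integral => y; rewrite inE => yS; congr (_%:E); rewrite !indicE; congr ((nat_of_bool _)%:R).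
by apply/idP/idP; rewrite !inE => /(gauge_shell d r0 yS).
Qed.

Let radii d := [set r : R | (1 < r `^ c < 1 + d)%R].

Let radiiE d : 0 < d -> radii d `&` `]0%R, +oo[ = `]1, (1 + d) `^ g[%classic.
Proof.
move=> d0; have d1 : 0 <= 1 + d by lra.
apply/seteqP; split=> r /=; rewrite !in_itv/= ?andbT.
  move=> [/andP[r1 r2] /ltW r0]; apply/andP; split.
    by rewrite ltNge -(ler_powRc c1)// powR1 -ltNge.
  by rewrite ltNge -(ler_powRc c1) ?powR_ge0// powRgK// -ltNge.
move=> /andP[r1 r2]; have r0 : 0 < r by lra.
split=> //; apply/andP; split.
  have e1 : (1 : R) `^ c = 1 by rewrite powR1.
  by rewrite -[X in X < _]e1 ltNge (ler_powRc c1) ?(ltW r0)// -ltNge.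
by rewrite -[X in _ < X](powRgK c1)// ltNge (ler_powRc c1) ?(ltW r0) ?powR_ge0// -ltNge.
Qed.

(** The radii of the shell form the interval from [1] to [(1 + d) ^ (1 / c)],
    of length between [d / 4] and [d], on which the density [r ^ 2] lies
    between [1] and [4]. *)
Lemma shell_volume d : 0 < d -> d <= 1 ->
  exists2 v : R, lebesgue3 R (shell c d) = v%:E & d / 4 * M <= v /\ v <= 4 * d * M.
Proof.
move=> d0 d1; have g1 : g <= 1 by rewrite invf_le1// ltW.
have dp : 0 <= 1 + d by lra.
have lo : 1 + d / 4 <= (1 + d) `^ g.
  rewrite -(ler_powRc c1) ?powR_ge0//; last by lra.
  rewrite powRgK//; apply: (@le_trans _ _ ((1 + d / 4) `^ 2)).
    by apply: ler_powR; move: c2; lra.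
  by rewrite powR_mulrn; [nra|lra].
have hi : (1 + d) `^ g <= 1 + d.
  by rewrite -[X in _ <= X]powRr1//; apply: ler_powR => //; lra.
set b := (1 + d) `^ g in lo hi.
have b1 : 1 <= b by lra.
set D : set (measurableTypeR R) := `]1, b[%classic.
have mD : measurable D by exact: measurable_itv.
have DE : (mu1 D = (b - 1)%:E)%E.
  by rewrite lebesgue_measure_itv/= lte_fin -EFinB; case: ltP => // ?; congr (_%:E); lra.
have volE : lebesgue3 R (shell c d) = (\int[mu1]_(r in D) ((r ^+ 2 * M)%:E))%E.
  rewrite shell_volumeE /D /b -radiiE// setIC integral_mkcondr.
  apply: eq_integral => r _; rewrite patchE indicE.
  by case: ifP => _; rewrite ?mul1r ?mul0r ?mule0// EFinM.
have mf : measurable_fun D (fun r : R => (r ^+ 2 * M)%:E).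
  by apply/measurable_EFinP; apply: measurable_funM => //; exact: measurable_funX.
have lowb : ((M * (b - 1))%:E <= lebesgue3 R (shell c d))%E.
  rewrite volE EFinM -DE -integral_cst//; apply: ge0_le_integral => //.
  - by move=> r _; rewrite lee_fin ltW.
  - move=> r; rewrite /D/= in_itv/= => /andP[r1 _]; rewrite lee_fin.
    by rewrite /= ler_peMl ?(ltW M0)// expr2; nra.
have highb : (lebesgue3 R (shell c d) <= (4 * M * (b - 1))%:E)%E.
  rewrite volE EFinM -DE -integral_cst//; apply: ge0_le_integral => //.
  - by move=> r _; rewrite lee_fin mulr_ge0 ?sqr_ge0// ltW.
  - move=> r; rewrite /D/= in_itv/= => /andP[r1 r2]; rewrite lee_fin.
    have r3 : r <= 2 by lra.
    by rewrite /= ler_pM2r// expr2; nra.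
have fin : lebesgue3 R (shell c d) \is a fin_num.
  by rewrite ge0_fin_numE//; apply: (le_lt_trans highb); rewrite ltry.
exists (fine (lebesgue3 R (shell c d))); first by rewrite fineK.
move: lowb highb; rewrite -(fineK fin) !lee_fin /= => lowb highb.
by have M0' := M0; split; [apply: le_trans lowb|apply: (le_trans highb)]; nra.
Qed.

Let shell_cube d (x : R3) : d <= 1 -> shell c d x ->
  [/\ `|x.1.1| <= 2, `|x.1.2| <= 2 & `|x.2| <= 2].
Proof.
move=> d1 /andP[_]; rewrite /gauge => h.
have p1 := powR_ge0 `|x.1.1| c; have p2 := powR_ge0 `|x.1.2| c; have p3 := powR_ge0 `|x.2| c.
have two (u : R) : `|u| `^ c <= 2 -> `|u| <= 2.
  move=> u2; rewrite -(ler_powRc c1)//; apply: (le_trans u2).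
  rewrite -[X in X <= _]powRr1//; apply: ler_powR; first by lra.
  exact: ltW.
by split; apply: two; lra.
Qed.

Lemma integrable_shell (Psi : R3 -> R) d : continuous Psi -> 0 < d -> d <= 1 ->
  (lebesgue3 R).-integrable setT (fun x => (Psi x * \1_(shell c d) x)%:E).
Proof.
move=> cP d0 d1; have [B [PB _]] := continuous_test_function cP.
have [v vE _] := shell_volume d0 d1.
have mS := measurable_shell c1 d.
apply: (@le_integrable _ _ _ _ _ measurableT _ (fun x => B%:E * (\1_(shell c d) x)%:E)%E).
- apply/measurable_EFinP; apply: measurable_funM; first exact: measurable_continuous3.
  exact: measurable_indic.
- move=> x _; rewrite -EFinM !abse_EFin lee_fin indicE.
  case: (boolP (x \in shell c d)) => xS; last by rewrite !mulr0 normr0.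
  rewrite !mulr1; apply: (le_trans (PB x _)); last exact: ler_norm.
  have [x1 x2 x3] := shell_cube d1 (set_mem xS).
  by split; [move: x1|move: x2|move: x3]; lra.
- apply: integrableZl => //; apply: integrable_indic_lty => //.
  by rewrite vE ltry.
Qed.

(** The shell average of a continuous function whose integral over the sphere
    vanishes is small for thin shells: replacing [phi x] by its value at the
    radial projection of [x] changes little, and makes the integral vanish. *)
Lemma shell_mean (phi : R3 -> R) (w : R) : continuous phi ->
  (\int[mu]_(y in csphere c) (phi y)%:E = 0)%E -> 0 < w ->
  exists2 d0 : R, 0 < d0 & forall d, 0 < d -> d <= d0 -> d <= 1 ->
    exists2 v : R, lebesgue3 R (shell c d) = v%:E &
    (`| \int[lebesgue3 R]_x (phi x * \1_(shell c d) x)%:E | <= (w * v)%:E)%E.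
Proof.
move=> cphi phi0 w0; have [B [_ /(_ w w0)[eta eta0 heta]]] := continuous_test_function cphi.
have g1 : g <= 1 by rewrite invf_le1// ltW.
exists (eta / 2) => [|d d0 de d1]; first by rewrite divr_gt0.
have [v vE _] := shell_volume d0 d1.
have mS := measurable_shell c1 d.
exists v => //.
(* The radial projection, made continuous at the origin. *)
pose t (x : R3) : R := (Num.max 1 (gauge c x)) `^ (- g).
pose Phi (x : R3) := phi (t x *: x).
have ct : continuous t.
  move=> x; apply: (@continuous_comp _ _ _ (fun x => Num.max 1 (gauge c x)) (@powR R ^~ (- g))).
    apply: continuous_max; first exact: cvg_cst.
    exact: (continuous_gauge c1).
  apply: differentiable_continuous; apply/derivable1_diffP.
  by apply: derivable_powR; rewrite in_itv/= andbT lt_max ltr01.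
have cPhi : continuous Phi.
  move=> x; apply: (@continuous_comp _ _ _ (fun x => t x *: x) phi); last exact: cphi.
  by apply: cvgZ; [exact: ct|exact: cvg_id].
have iphi := integrable_shell cphi d0 d1.
have iPhi := integrable_shell cPhi d0 d1.
have Phi_int : (\int[lebesgue3 R]_x (Phi x * \1_(shell c d) x)%:E = 0)%E.
  rewrite (@polar_radial _ (fun=> 0%E)).
  - by apply: integral0_eq => r _; rewrite mule0.
  - by right.
  move=> r r0; have [rd|rd] := pselect (1 < r `^ c < 1 + d); last first.
    apply: integral0_eq => y yS; rewrite indicE memNset ?mulr0// => /(gauge_shell d r0 yS).
    exact: rd.
  rewrite -[RHS]phi0; apply: eq_integral => y; rewrite inE => yS.
  rewrite indicE mem_set ?mulr1; last exact/(gauge_shell d r0 yS).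
  congr (_%:E); rewrite /Phi /t gauge_scale ?(ltW r0)// (csphereE y).1// mulr1.
  rewrite max_r; last by move: rd => /andP[/ltW].
  rewrite powRN (powRcK c1) ?(ltW r0)// scalerA mulVf ?scale1r//; exact: lt0r_neq0.
have mB := measurable_int _ (integrableB measurableT iphi iPhi).
rewrite -[X in (`|X| <= _)%E]sube0 -Phi_int -integralB//.
apply: (le_trans (le_abse_integral _ _ _)) => //.
rewrite EFinM -vE -[X in (_ <= _ * lebesgue3 R X)%E]setIT.
rewrite -integral_indic// -ge0_integralZl//; last 2 first.
- by apply/measurable_EFinP; exact: measurable_indic.
- by rewrite lee_fin ltW.
apply: ge0_le_integral => //.
- exact: measurableT_comp.
- by apply/measurable_EFinP; apply: measurable_funM => //; exact: measurable_indic.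
move=> x _; rewrite -EFinB -EFinM abse_EFin lee_fin -mulrBl indicE.
case: (boolP (x \in shell c d)) => xS; last by rewrite !mulr0 normr0.
rewrite !mulr1; have [x1 x2 x3] := shell_cube d1 (set_mem xS).
have /andP[q1 q2] : 1 < gauge c x < 1 + d by exact: (set_mem xS).
have tE : t x = gauge c x `^ (- g) by rewrite /t max_r// ltW.
have t1 : t x <= 1.
  by rewrite tE -(powRr0 (gauge c x)); apply: ler_powR; [exact: ltW|rewrite oppr_le0 ltW].
have t2 : 1 - d <= t x.
  apply: (@le_trans _ _ ((gauge c x) `^ (- 1))); last first.
    by rewrite tE; apply: ler_powR; [exact: ltW|rewrite lerN2].
  rewrite powR_inv1; last by lra.
  by rewrite -[X in _ <= X]mul1r ler_pdivlMr; [nra|lra].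
have t0 : 0 <= t x by exact: powR_ge0.
have ht (u : R) : `|u| <= 2 -> `|t x * u| <= 5 /\ `|u - t x * u| <= eta.
  move=> u2; rewrite -{2}[u]mul1r -mulrBl !normrM (ger0_norm t0).
  rewrite (@ger0_norm _ (1 - t x)); last by lra.
  by have := normr_ge0 u; split; nra.
have [[y1 z1] [y2 z2] [y3 z3]] := And3 (ht _ x1) (ht _ x2) (ht _ x3).
apply: heta; split => //.
- by move: x1; lra.
- by move: x2; lra.
- by move: x3; lra.
Qed.

End finite_mass.
End polar.

(** * The mass of the sphere *)

Section gamma_integrals.
Context {R : realType}.
Variable c : R.
Hypothesis c1 : 1 < c.
Let g := c^-1.
Local Notation mu1 := (@lebesgue_measure R).

Let c0 : 0 < c. Proof. exact: lt_trans c1. Qed.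
Let g0 : 0 < g. Proof. by rewrite invr_gt0. Qed.

Let continuous_powR_pos (a x : R) : 0 < x -> t `^ a @[t --> x] --> x `^ a.
Proof.
move=> x0; apply: (@differentiable_continuous _ _ _ x (@powR R ^~ a)).
by apply/derivable1_diffP; apply: derivable_powR; rewrite in_itv/= andbT.
Qed.

(** The substitution [t = r ^ c], performed on compact intervals that exhaust
    the half-line, away from the singularities at both ends. *)
Lemma gamma_substitution (s : R) :
  (\int[mu1]_(r in `]0%R, +oo[) (r `^ (s - 1) * expR (- r `^ c))%R%:E =
   \int[mu1]_(t in `]0%R, +oo[) (g * (t `^ (s * g - 1) * expR (- t)))%R%:E)%E.
Proof.
set f := fun r : R => r `^ (s - 1) * expR (- r `^ c).
set G := fun t : R => g * (t `^ (s * g - 1) * expR (- t)).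
pose a (n : nat) : R := n.+1%:R^-1; pose b (n : nat) : R := n.+1%:R.
have a0 n : 0 < a n by rewrite /a invr_gt0.
have ab n : a n <= b n.
  apply: (@le_trans _ _ 1); last by rewrite /b ler1n.
  by rewrite /a invf_le1// ler1n.
have b0 n : 0 < b n by exact: lt_le_trans (ab n).
have aS n m : (n <= m)%N -> a m <= a n by move=> nm; rewrite /a lef_pV2 ?posrE// ler_nat.
have bS n m : (n <= m)%N -> b n <= b m by move=> nm; rewrite /b ler_nat.
have absorb (x : R) : 0 < x -> exists n, a n <= x <= b n.
  move=> x0; pose n := Num.truncn (x + x^-1).
  have xV : 0 < x^-1 by rewrite invr_gt0.
  have := truncnS_gt (x + x^-1); rewrite -/n => h; exists n; apply/andP; split.
    by rewrite /a -[X in _ <= X]invrK lef_pV2 ?posrE//; lra.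
  by rewrite /b; lra.
have mf (D : set (measurableTypeR R)) : measurable_fun D (fun r => (f r)%:E).
  apply/measurable_EFinP; apply: measurable_funTS; apply: measurable_funM.
    exact: measurable_powR.
  apply: measurableT_comp; first exact: measurable_expR.
  by apply: measurableT_comp => //; exact: measurable_powR.
have mG (D : set (measurableTypeR R)) : measurable_fun D (fun r => (G r)%:E).
  apply/measurable_EFinP; apply: measurable_funTS; apply: measurable_funM => //.
  apply: measurable_funM; first exact: measurable_powR.
  by apply: measurableT_comp => //; exact: measurable_expR.
have f0 x : 0 <= f x by rewrite mulr_ge0 ?powR_ge0 ?expR_ge0.
have G0 x : 0 <= G x by rewrite mulr_ge0 ?(ltW g0)// mulr_ge0 ?powR_ge0 ?expR_ge0.
pose K n : set (measurableTypeR R) := `[a n, b n]%classic.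
pose K' n : set (measurableTypeR R) := `[a n `^ c, b n `^ c]%classic.
have UK : \bigcup_n K n = `]0, +oo[%classic.
  apply/seteqP; split=> x /=.
    by move=> [n _]; rewrite /K/= !in_itv/= andbT => /andP[h _]; exact: lt_le_trans h.
  by rewrite in_itv/= andbT => /absorb[n h]; exists n.
have UK' : \bigcup_n K' n = `]0, +oo[%classic.
  apply/seteqP; split=> x /=.
    move=> [n _]; rewrite /K'/= !in_itv/= andbT => /andP[h _].
    by apply: lt_le_trans h; rewrite powR_gt0.
  rewrite in_itv/= andbT => x0; have xg : 0 < x `^ g by rewrite powR_gt0.
  have [n /andP[h1 h2]] := absorb _ xg; exists n => //.
  rewrite /K'/= in_itv/= -[x](powRgK c1 (ltW x0)) -/g.
  by rewrite !ler_powRc ?powR_ge0 ?(ltW (a0 n)) ?(ltW (b0 n))// h1.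
have step n : (\int[mu1]_(r in K n) (f r)%:E = \int[mu1]_(t in K' n) (G t)%:E)%E.
  pose F : R -> R := fun t => t `^ c.
  have dF (x : R) : 0 < x -> F^`()%classic x = c * x `^ (c - 1).
    by move=> x0; apply: powR_derive1; rewrite in_itv/= andbT.
  have cF' (x : R) : 0 < x -> F^`()%classic t @[t --> x] --> F^`()%classic x.
    move=> x0; rewrite (dF x x0).
    apply: (@cvg_trans _ ((fun t => c * t `^ (c - 1)) @ x)); last first.
      apply: (@cvgM _ _ (nbhs x) _ (cst c) (fun t => t `^ (c - 1))); first exact: cvg_cst.
      exact: continuous_powR_pos.
    apply: near_eq_cvg; near=> t; rewrite dF//.
    by near: t; exact: lt_nbhsr.
  rewrite /K /K' (@integration_by_substitution_increasing R F G (a n) (b n)).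
  - apply: eq_integral => x; rewrite inE/= in_itv/= => /andP[xa _].
    have x0 := lt_le_trans (a0 n) xa.
    congr (_%:E); rewrite fctE /= dF//.
    rewrite /f /G /F -powRrM.
    have -> : x `^ (s - 1) = x `^ (c * (s * g - 1)) * x `^ (c - 1).
      rewrite -powRD; last by rewrite (gt_eqF x0) implybT.
      by congr (_ `^ _); rewrite mulrBr mulrCA mulfV ?gt_eqF//; lra.
    have gc : g * c = 1 by rewrite mulVf ?gt_eqF.
    rewrite -[LHS]mul1r -gc; ring.
  - exact: ab.
  - move=> x y; rewrite !in_itv/= => /andP[xa _] /andP[ya _] xy.
    apply: gt0_ltr_powR => //; rewrite nnegrE; apply: le_trans (ltW (a0 n)) _ => //.
  - by move=> x; rewrite in_itv/= => /andP[xa _]; apply: cF'; exact: lt_trans xa.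
  - by apply: cvgP; apply: cvg_at_right_filter; exact: cF'.
  - by apply: cvgP; apply: cvg_at_left_filter; exact: cF'.
  - split.
    + move=> x; rewrite in_itv/= => /andP[xa _]; apply: derivable_powR.
      by rewrite in_itv/= andbT; exact: lt_trans xa.
    + by apply: cvg_at_right_filter; exact: continuous_powR_pos.
    + by apply: cvg_at_left_filter; exact: continuous_powR_pos.
  - apply: continuous_in_subspaceT => x; rewrite inE/= in_itv/= => /andP[xa _].
    have x0 : 0 < x by apply: lt_le_trans xa; rewrite powR_gt0.
    apply: cvgM; first exact: cvg_cst.
    apply: cvgM; first exact: continuous_powR_pos.
    by apply: continuous_comp; [exact: opp_continuous|exact: continuous_expR].
have mono (u v : nat -> R) : {homo u : n m / (n <= m)%N >-> m <= n} ->
    {homo v : n m / (n <= m)%N >-> n <= m} ->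
    nondecreasing_seq (fun n => `[u n, v n]%classic : set R).
  move=> hu hv n m nm; apply/subsetPset => x /=; rewrite !in_itv/= => /andP[h1 h2].
  by rewrite (le_trans (hu _ _ nm) h1) (le_trans h2 (hv _ _ nm)).
have limK : (\int[mu1]_(r in K n) (f r)%:E @[n --> \oo] -->
    \int[mu1]_(r in `]0%R, +oo[) (f r)%:E)%E.
  rewrite -UK; apply: ge0_nondecreasing_set_cvg_integral => //.
  - by apply: mono => n m nm; [exact: aS|exact: bS].
  - by move=> n; exact: measurable_itv.
  - by move=> n x _; rewrite lee_fin.
have limK' : (\int[mu1]_(r in K' n) (G r)%:E @[n --> \oo] -->
    \int[mu1]_(r in `]0%R, +oo[) (G r)%:E)%E.
  rewrite -UK'; apply: ge0_nondecreasing_set_cvg_integral => //.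
  - apply: (mono (fun n => a n `^ c) (fun n => b n `^ c)) => n m nm.
      by rewrite ler_powRc ?(ltW (a0 _))//; exact: aS.
    by rewrite ler_powRc ?(ltW (b0 _))//; exact: bS.
  - by move=> n; exact: measurable_itv.
  - by move=> n x _; rewrite lee_fin.
apply: (cvg_unique _ limK) => //.
rewrite (_ : (fun n => (\int[mu1]_(r in K n) (f r)%:E)%E) = (fun n => (\int[mu1]_(r in K' n) (G r)%:E)%E))//.
by apply/funext.
Unshelve. all: by end_near. Qed.

End gamma_integrals.

Section radial_integrals.
Context {R : realType}.
Variable c : R.
Hypothesis c1 : 1 < c.
Let g := c^-1.
Local Notation mu1 := (@lebesgue_measure R).

Let c0 : 0 < c. Proof. exact: lt_trans c1. Qed.

Let radial (s r : R) : R := r `^ (s - 1) * expR (- r `^ c).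

Let radial_ge0 s r : 0 <= radial s r.
Proof. by rewrite mulr_ge0 ?powR_ge0 ?expR_ge0. Qed.

Let measurable_radial s (D : set (measurableTypeR R)) :
  measurable_fun D (fun r => (radial s r)%:E).
Proof.
apply/measurable_EFinP; apply: measurable_funTS; apply: measurable_funM.
  exact: measurable_powR.
apply: measurableT_comp; first exact: measurable_expR.
by apply: measurableT_comp => //; exact: measurable_powR.
Qed.

Let radial_le s r : 1 <= s -> s <= 3 -> 0 < r ->
  radial s r <= 16 * expR 2 * expR (- 2^-1 * r).
Proof.
move=> s1 s3 r0.
have h1 : r `^ (s - 1) <= 16 * expR ((1 + r) / 2).
  apply: (@le_trans _ _ ((1 + r) `^ (s - 1))).
    by apply: ge0_ler_powR; rewrite ?nnegrE; lra.
  apply: (@le_trans _ _ ((1 + r) `^ 2)); first by apply: ler_powR; lra.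
  rewrite powR_mulrn; last by lra.
  have := expR_ge1Dx ((1 + r) / 4).
  rewrite (_ : (1 + r) / 2 = (1 + r) / 4 + (1 + r) / 4); last by lra.
  by rewrite expRD; nra.
have h2 : expR (- r `^ c) <= expR (1 - r).
  rewrite ler_expR; have [r1|r1] := leP 1 r; last first.
    by have := powR_ge0 r c; lra.
  have := ler_powR r1 (ltW c1); rewrite powRr1; [lra|exact: ltW].
apply: (le_trans (ler_pM (powR_ge0 _ _) (expR_ge0 _) h1 h2)).
rewrite -!mulrA ler_pM2l// -!expRD ler_expR; lra.
Qed.

(** The integrals of [r `^ (s - 1) * expR (- r `^ c)] in terms of the Gamma
    function; what the polar formula needs is [s = 1] and [s = 3]. *)
Lemma radial_integral s : 1 <= s -> s <= 3 ->
  exists2 I : R, 0 < I & (\int[mu1]_(r in `]0%R, +oo[) (radial s r)%:E = I%:E)%E /\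
    Gamma (s / c) = c * I.
Proof.
move=> s1 s3; set A := (\int[mu1]_(r in _) _)%E.
have mH : measurable (`]0%R, +oo[%classic : set (measurableTypeR R)) by exact: measurable_itv.
have Afin : (A < +oo)%E.
  pose B : R := 32 * expR 2.
  have B0 : 0 <= B by rewrite mulr_ge0// expR_ge0.
  apply: (@le_lt_trans _ _ (B%:E)); last by rewrite ltry.
  rewrite -[leRHS]mule1 -(@integral_exponential_pdf R 2^-1)//.
  have mpdf := @measurable_exponential_pdf R 2^-1.
  rewrite -ge0_integralZl//; last 2 first.
  - exact/measurable_EFinP.
  - by move=> x _; rewrite lee_fin exponential_pdf_ge0.
  apply: (@le_trans _ _ (\int[mu1]_(r in `]0%R, +oo[) (B%:E * (exponential_pdf 2^-1 r)%:E))%E).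
    apply: ge0_le_integral => //.
    - by move=> r _; rewrite lee_fin.
    - by apply: measurable_funTS; apply/measurable_EFinP; apply: measurable_funM.
    move=> r; rewrite /= in_itv/= andbT => r0; rewrite -EFinM lee_fin.
    apply: (le_trans (radial_le s1 s3 r0)).
    rewrite /exponential_pdf patchE mem_set; last by rewrite /= in_itv/= andbT ltW.
    rewrite /B mulrA; rewrite ler_pM2r ?expR_gt0//.
    by have := expR_gt0 (2 : R); lra.
  apply: (@ge0_subset_integral _ _ _ mu1 _ _ mH measurableT) => //.
  - by apply/measurable_EFinP; apply: measurable_funM.
  - by move=> r _; rewrite -EFinM lee_fin mulr_ge0// exponential_pdf_ge0.
have Apos : (0 < A)%E.
  pose b : R := expR (- 1) / 4.
  have b0 : 0 < b by rewrite divr_gt0// expR_gt0.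
  have mK : measurable (`[2^-1, 1]%classic : set (measurableTypeR R)) by exact: measurable_itv.
  have le1 : (\int[mu1]_(r in `[(2^-1)%R, 1%R]) b%:E <= A)%E.
    apply: (@le_trans _ _ (\int[mu1]_(r in `[(2^-1)%R, 1%R]) (radial s r)%:E)%E).
      apply: ge0_le_integral => //; first by move=> r _; rewrite lee_fin ltW.
      move=> r; rewrite /= in_itv/= => /andP[r1 r2]; rewrite lee_fin /b mulrC.
      have r0 : 0 < r by apply: lt_le_trans r1; rewrite invr_gt0.
      rewrite /radial; apply: ler_pM; rewrite ?expR_ge0 ?invr_ge0//.
        apply: (@le_trans _ _ (r `^ 2)).
          by rewrite powR_mulrn ?(ltW r0)//; nra.
        have [->|rn1] := eqVneq r 1; first by rewrite !powR1.
        have r2' : r < 1 by rewrite lt_neqAle rn1.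
        by rewrite /powR gt_eqF// ler_expR; have := ln_le0 (ltW r2'); nra.
      rewrite ler_expR lerN2; apply: (@le_trans _ _ (1 `^ c)); last by rewrite powR1.
      by apply: ge0_ler_powR; rewrite ?nnegrE ?(ltW c0) ?(ltW r0).
    apply: ge0_subset_integral => //.
    - by move=> r _; rewrite lee_fin.
    by move=> r /=; rewrite !in_itv/= andbT => /andP[r1 _]; apply: lt_le_trans r1; rewrite invr_gt0.
  apply: lt_le_trans le1; rewrite integral_cst//.
  rewrite [X in (_ * X)%E](_ : _ = (1 - 2^-1)%:E); first by rewrite -EFinM lte_fin mulr_gt0//; lra.
  by rewrite /= lebesgue_measure_itv/= lte_fin ifT ?EFinB//; lra.
have AE : A = (fine A)%:E by rewrite fineK// ge0_fin_numE// ltW.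
exists (fine A); first by rewrite fine_gt0// Apos.
split => //; rewrite /Gamma /Rintegral.
have := gamma_substitution c1 s; rewrite -/A => AG.
set C := (\int[mu1]_(t in _) _)%E.
have AC : (A = g%:E * C)%E.
  rewrite AG -ge0_integralZl//.
  - apply/measurable_EFinP; apply: measurable_funTS; apply: measurable_funM.
      exact: measurable_powR.
    by apply: measurableT_comp => //; exact: measurable_expR.
  - by move=> t _; rewrite lee_fin mulr_ge0 ?powR_ge0 ?expR_ge0.
  - by rewrite lee_fin ltW// invr_gt0.
have -> : C = (c%:E * A)%E by rewrite AC muleA -EFinM mulfV ?gt_eqF// mul1e.
by rewrite AE -EFinM.
Qed.

End radial_integrals.

Section area.
Variable R : realType.

(** The first two factors of Lebesgue measure in space; sigma-finiteness is
    what Tonelli's theorem asks of them. *)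
Definition area : set (measurableTypeR R * measurableTypeR R) -> \bar R :=
  (@lebesgue_measure R \x @lebesgue_measure R)%E.

HB.instance Definition _ := Measure.copy area (@lebesgue_measure R \x @lebesgue_measure R)%E.

Let sigma_finite_area : sigma_finite setT area.
Proof.
have /sigma_finiteP[F [TF ndF Foo]] := sigma_finiteT (@lebesgue_measure R).
exists (fun n => F n `*` F n).
  rewrite -setXTT TF predeqE => -[x y]; split; last by move=> [n _ []/= ? ?]; split; exists n.
  move=> [/= [n _ Fnx] [k _ Fky]]; exists (maxn n k) => //; split.
    by move: x Fnx; exact/subsetPset/ndF/leq_maxl.
  by move: y Fky; exact/subsetPset/ndF/leq_maxr.
move=> k; have [mF Fk] := Foo k; split; first exact: measurableX.
by rewrite /area product_measure1E// lte_mul_pinfty// ge0_fin_numE.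
Qed.

HB.instance Definition _ := Measure_isSigmaFinite.Build _ _ _ area sigma_finite_area.

End area.

Section mass.
Context {R : realType}.
Variable c : R.
Hypothesis c1 : 1 < c.
Local Notation mu1 := (@lebesgue_measure R).

Let e1 (x : R) : R := expR (- `|x| `^ c).

Let e1_ge0 x : 0 <= e1 x. Proof. exact: expR_ge0. Qed.

Let continuous_e1 : continuous e1.
Proof.
move=> x; apply: (@continuous_comp _ _ _ (fun x : R => - `|x| `^ c) (@expR R)).
  by apply: cvgN; exact: continuous_norm_powR.
exact: continuous_expR.
Qed.

Let measurable_e1 : measurable_fun [set: measurableTypeR R] e1.
Proof. exact: continuous_measurable_fun. Qed.

Let integral_e1 (I : R) :
  (\int[mu1]_(r in `]0%R, +oo[) (r `^ (1 - 1) * expR (- r `^ c))%R%:E = I%:E)%E ->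
  (\int[mu1]_x (e1 x)%:E = (2 * I)%:E)%E.
Proof.
move=> hI; have even : e1 =1 e1 \o -%R by move=> x; rewrite /e1/= normrN.
rewrite (ge0_symfun_integralT e1_ge0 continuous_e1 even).
rewrite EFinM -hI; congr (_ * _)%E.
rewrite -set_itvcy -integral_itv_obnd_cbnd; last first.
  by apply/measurable_EFinP; exact: measurable_funTS.
apply: eq_integral => r; rewrite inE/= in_itv/= andbT => r0.
by rewrite /e1 subrr powRr0 mul1r gtr0_norm.
Qed.

Let integral_prod d (T : measurableType d) (m : {sigma_finite_measure set T -> \bar R})
    (f : T -> R) (h : R -> R) (a b : R) :
  measurable_fun setT f -> measurable_fun [set: measurableTypeR R] h ->
  (forall x, 0 <= f x) -> (forall x, 0 <= h x) ->
  (\int[m]_x (f x)%:E = a%:E)%E -> (\int[mu1]_x (h x)%:E = b%:E)%E ->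
  (\int[(m \x mu1)]_z (f z.1 * h z.2)%:E = (a * b)%:E)%E.
Proof.
move=> mf mh f0 h0 fa hb.
rewrite fubini_tonelli1; last 2 first.
- apply/measurable_EFinP; apply: measurable_funM.
    by apply: measurableT_comp => //; exact: measurable_fst.
  by apply: (@measurableT_comp _ _ _ _ _ _ h) => //; exact: measurable_snd.
- by move=> z; rewrite lee_fin mulr_ge0.
transitivity (\int[m]_x ((f x)%:E * b%:E))%E.
  apply: eq_integral => x _; rewrite /fubini_F -hb -ge0_integralZl//.
  - exact/measurable_EFinP.
  - by move=> y _; rewrite lee_fin.
  - by rewrite lee_fin.
rewrite EFinM -fa; apply: (@ge0_integralZr _ _ _ m setT measurableT (fun x => (f x)%:E)).
- exact/measurable_EFinP.
- by move=> y _; rewrite lee_fin.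
- by rewrite -hb; apply: integral_ge0 => y _; rewrite lee_fin.
Qed.

(** The integral of [expR (- gauge c x)] over the space is the cube of a
    one-dimensional integral by Tonelli's theorem, and the product of the
    mass of the sphere and of a radial integral by the polar formula. *)
Lemma sphere_mass (mu : {measure set (space3 R) -> \bar R}) :
  is_csphere_measure c mu ->
  mu (csphere c) = (8 * Gamma c^-1 ^+ 3 / (c ^+ 2 * Gamma (3 / c)))%:E /\
  0 < 8 * Gamma c^-1 ^+ 3 / (c ^+ 2 * Gamma (3 / c)).
Proof.
move=> hmu; have c0 : 0 < c := lt_trans ltr01 c1.
have [I I0 [hI GI]] : exists2 I : R, 0 < I &
    (\int[mu1]_(r in `]0%R, +oo[) (r `^ (1 - 1) * expR (- r `^ c))%R%:E = I%:E)%E /\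
    Gamma (1 / c) = c * I by apply: radial_integral => //; lra.
have [J J0 [hJ GJ]] : exists2 J : R, 0 < J &
    (\int[mu1]_(r in `]0%R, +oo[) (r `^ (3 - 1) * expR (- r `^ c))%R%:E = J%:E)%E /\
    Gamma (3 / c) = c * J by apply: radial_integral => //; lra.
have K := integral_e1 hI.
pose f (x : space3 R) : R := e1 x.1.1 * e1 x.1.2 * e1 x.2.
have mg : measurable_fun setT (fun z : measurableTypeR R * measurableTypeR R => e1 z.1 * e1 z.2).
  apply: measurable_funM.
    by apply: (@measurableT_comp _ _ _ _ _ _ e1) => //; exact: measurable_fst.
  by apply: (@measurableT_comp _ _ _ _ _ _ e1) => //; exact: measurable_snd.
have mf : measurable_fun setT f.
  apply: measurable_funM.
    by apply: (@measurableT_comp _ _ _ _ _ _ (fun z => e1 z.1 * e1 z.2)) => //; exact: measurable_fst.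
  by apply: (@measurableT_comp _ _ _ _ _ _ e1) => //; exact: measurable_snd.
have f0 x : 0 <= f x by rewrite !mulr_ge0.
have fE x : f x = expR (- gauge c x).
  by rewrite /f /e1 /gauge !opprD !expRD.
have vol : (\int[lebesgue3 R]_x (f x)%:E = (2 * I * (2 * I) * (2 * I))%:E)%E.
  have K2 := integral_prod measurable_e1 measurable_e1 e1_ge0 e1_ge0 K K.
  have g0 z : 0 <= e1 z.1 * e1 z.2 by rewrite mulr_ge0.
  have K3 := @integral_prod _ _ (@area R) _ _ _ _ mg measurable_e1 g0 e1_ge0 K2 K.
  exact: K3.
have polar : (\int[lebesgue3 R]_x (f x)%:E = J%:E * mu (csphere c))%E.
  rewrite (polar_radial hmu (h := fun r : R => ((expR (- r `^ c)%R)%:E * mu (csphere c))%E)).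
  - rewrite -hJ -ge0_integralZr//; last 2 first.
    + apply/measurable_EFinP; apply: measurable_funTS; apply: measurable_funM.
        exact: measurable_powR.
      apply: measurableT_comp; first exact: measurable_expR.
      by apply: measurableT_comp => //; exact: measurable_powR.
    + by move=> r _; rewrite lee_fin mulr_ge0 ?powR_ge0 ?expR_ge0.
    apply: eq_integral => r; rewrite inE/= in_itv/= andbT => r0.
    have three : 3 - 1 = 2%:R :> R by ring.
    by rewrite muleA -EFinM three powR_mulrn// ltW.
  - left; split; first exact/measurable_EFinP.
    by move=> x; rewrite lee_fin.
  move=> r r0; rewrite -integral_cst; last exact: (measurable_csphere c1).
  apply: eq_integral => y; rewrite inE => /(csphereE c1) yS.
  by rewrite fE gauge_scale ?(ltW r0)// yS mulr1.
have mE : mu (csphere c) = (8 * I ^+ 3 / J)%:E.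
  move: polar; rewrite vol.
  case: (mu (csphere c)) => [m|/eqP|/eqP].
  - rewrite -EFinM => -[E]; congr (_%:E).
    have -> : 8 * I ^+ 3 = J * m by rewrite -E; ring.
    by rewrite mulrC mulKf// lt0r_neq0.
  - by rewrite gt0_muley// lte_fin.
  - by rewrite gt0_muleNy// lte_fin.
have -> : 8 * Gamma c^-1 ^+ 3 / (c ^+ 2 * Gamma (3 / c)) = 8 * I ^+ 3 / J.
  have := GI; rewrite div1r => ->; rewrite GJ; field.
  by rewrite !lt0r_neq0.
by split => //; rewrite divr_gt0// mulr_gt0// exprn_gt0.
Qed.

End mass.

(** * Equidistribution *)

Section equidistribution.
Context {R : realType}.
Variable c : R.
Hypotheses (c1 : 1 < c) (c2 : c < 9 / 8).
Let g := c^-1.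
Local Notation R3 := (R * R * R)%type.

Variable mu : {measure set (space3 R) -> \bar R}.
Hypothesis hmu : is_csphere_measure c mu.
Variable M : R.
Hypotheses (M0 : 0 < M) (muM : mu (csphere c) = M%:E).

Let a (n : nat) : R := n.+1%:R.
Let s (n : nat) : R := n.+1%:R `^ (- g).

Let a0 n : 0 < a n. Proof. exact: ltr0n. Qed.

(* The scaling turns the error term of [stable] into [e] divided by the
   index of the sphere. *)
Let s3 n : s n ^+ 3 * a n `^ (3 * g - 1) = (a n)^-1.
Proof.
rewrite -powR_mulrn ?powR_ge0// -powRrM -powRD; last by rewrite (gt_eqF (a0 n)) implybT.
rewrite -powR_inv1 ?(ltW (a0 n))//; congr (_ `^ _); ring.
Qed.

Definition normalized_sum (n : nat) (Psi : R3 -> R) : R :=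
  s n ^+ 3 * a n * lattice_sum c n.+1 (s n) Psi.

(** A single normalized sum is close to its average over a thin shell of
    neighbouring radii, and such averages converge to integrals. *)
Lemma shell_average (Psi : R3 -> R) (e : R) : continuous Psi -> 0 < e ->
  exists2 d1 : R, 0 < d1 & forall d, 0 < d -> d <= d1 -> d <= 1 -> forall I : R,
    (\int[lebesgue3 R]_x (Psi x * \1_(shell c d) x)%:E = I%:E)%E ->
    \forall n \near \oo, exists2 q : R, d / 2 <= q <= d &
      `|q * normalized_sum n Psi - I| <= e * d.
Proof.
move=> cPsi e0; have e4 : 0 < e / 4 by rewrite divr_gt0.
have [d1 d10 [l0 hst]] := stable_continuous c1 c2 cPsi e4.
exists d1 => // d d0 dd1 d1' I hI.
have := shell_sum_cvg c1 c2 cPsi d0 d1' (null_sphere c1 hmu 1) (null_sphere c1 hmu (1 + d)).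
rewrite hI => /fine_cvg /=; set A := (X in X @ _ --> _) => cA.
have de : 0 < d * (e / 4) by rewrite mulr_gt0.
near=> n; pose J := Num.truncn (d * a n).
have da : 0 <= d * a n by rewrite mulr_ge0 ?(ltW d0) ?(ltW (a0 n)).
have /andP[Jle Jlt] := truncn_itv da; rewrite -/J in Jle Jlt.
have an : 2 / d <= a n.
  apply: (@le_trans _ _ n%:R); last by rewrite /a ler_nat.
  near: n; exact: nbhs_infty_ger.
have q1 : d / 2 <= J%:R / a n.
  rewrite ler_pdivlMr//; move: an Jlt; rewrite ler_pdivrMr// -[J.+1%:R]natr1.
  by rewrite [a n * d]mulrC mulrAC; move: (d * a n) (J%:R : R) => u v; lra.
have q2 : J%:R / a n <= d by rewrite ler_pdivrMr.
exists (J%:R / a n); first by rewrite q1.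
have AI : `|A n - I| <= d * (e / 4).
  by rewrite distrC; near: n; move/cvgrPdist_le : cA => /(_ _ de).
have AE : A n = s n ^+ 3 * \sum_(j < J) lattice_sum c (n.+1 + j) (s n) Psi.
  by rewrite /A/= (sum_shell_points c1).
have XE : J%:R / a n * normalized_sum n Psi =
    s n ^+ 3 * \sum_(j < J) lattice_sum c n.+1 (s n) Psi.
  rewrite sumr_const card_ord -[_ *+ J]mulr_natr /normalized_sum.
  have : a n != 0 by exact: lt0r_neq0.
  by move: (s n) (a n) => u v v0; field.
have s0 : 0 <= s n ^+ 3 by rewrite exprn_ge0 ?powR_ge0.
have AX : `|J%:R / a n * normalized_sum n Psi - A n| <= d * (e / 4).
  rewrite XE AE -mulrBr normrM (ger0_norm s0) -sumrB.
  apply: (@le_trans _ _ (s n ^+ 3 * \sum_(j < J) (e / 4 * a n `^ (3 * g - 1)))).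
    rewrite ler_wpM2l//; apply: (le_trans (ler_norm_sum _ _ _)).
    apply: ler_sum => j _; rewrite distrC; apply: hst.
    - apply: (@leq_trans n); last exact: leqnSn.
      near: n; exact: nbhs_infty_ge.
    - exact: leq_addr.
    rewrite natrD mulrDl mul1r lerD2l.
    apply: (@le_trans _ _ J%:R); first by rewrite ler_nat ltnW.
    by apply: (le_trans Jle); rewrite ler_pM2r.
  rewrite sumr_const card_ord -[_ *+ J]mulr_natr.
  rewrite (_ : _ * _ = s n ^+ 3 * a n `^ (3 * g - 1) * J%:R * (e / 4)); last by ring.
  by rewrite s3 [_^-1 * _]mulrC ler_pM2r.
rewrite -(subrK (A n) (_ * normalized_sum n Psi)) -addrA.
apply: (le_trans (ler_normD _ _)).
apply: (le_trans (lerD AX AI)); rewrite (_ : e * d = 4 * (d * (e / 4))); last by field.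
by have := ltW de; move: (d * (e / 4)) => u; lra.
Unshelve. all: by end_near. Qed.

(** For the constant function [1] the shell averages are the volumes of the
    shells, which have a lower bound proportional to the thickness. *)
Lemma normalized_count : \forall n \near \oo, M / 8 <= normalized_sum n (fun=> 1).
Proof.
have c1' : continuous ((fun=> 1) : R3 -> R) by move=> x; exact: cvg_cst.
have e0 : 0 < M / 8 by rewrite divr_gt0.
have [d1 d10 hd] := shell_average c1' e0.
pose d := Num.min 1 d1.
have d0 : 0 < d by rewrite lt_min ltr01 d10.
have dle1 : d <= 1 by rewrite ge_min lexx.
have dled1 : d <= d1 by rewrite ge_min lexx orbT.
have [v vE [v1 _]] := shell_volume c1 c2 hmu M0 muM d0 dle1.
have hv : (\int[lebesgue3 R]_x (1 * \1_(shell c d) x)%:E = v%:E)%E.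
  under eq_integral do rewrite mul1r.
  by rewrite integral_indic ?setIT//; exact: measurable_shell.
have := hd d d0 dled1 dle1 v hv; apply: filterS => n [q /andP[q1 q2]].
rewrite ler_distl => /andP[h _].
have q0 : 0 < q by apply: lt_le_trans q1; rewrite divr_gt0.
rewrite -(ler_pM2l q0); apply: le_trans h.
by have M0' := M0; nra.
Qed.

(** By [shell_mean] the shell integrals of [phi] are negligible with respect
    to the thickness of the shell, so that the bound of [shell_average] can
    be divided by this thickness. *)
Lemma mean_zero_cvg (phi : R3 -> R) : continuous phi ->
  (\int[mu]_(y in csphere c) (phi y)%:E = 0)%E ->
  normalized_sum n phi @[n --> \oo] --> 0.
Proof.
move=> cphi phi0; apply/cvgrPdist_le => e e0.
have e4 : 0 < e / 4 by rewrite divr_gt0.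
have w0 : 0 < e / (16 * M) by rewrite divr_gt0// mulr_gt0.
have [d1 d10 hd] := shell_average cphi e4.
have [d2 d20 hd2] := shell_mean c1 c2 hmu M0 muM cphi phi0 w0.
pose d := Num.min 1 (Num.min d1 d2).
have d0 : 0 < d by rewrite !lt_min ltr01 d10.
have dle1 : d <= 1 by rewrite ge_min lexx.
have dled1 : d <= d1 by rewrite !ge_min lexx orbT.
have dled2 : d <= d2 by rewrite !ge_min lexx !orbT.
have [v vE [_ v2]] := shell_volume c1 c2 hmu M0 muM d0 dle1.
have [v' v'E] := hd2 d d0 dled2 dle1.
move: v'E; rewrite vE => -[<-].
set I := (\int[_]_x _)%E => hI.
have IE : I = (fine I)%:E.
  by rewrite fineK// fin_num_abs; apply: (le_lt_trans hI); rewrite ltry.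
have := hd d d0 dled1 dle1 (fine I) IE; apply: filterS => n [q /andP[q1 q2]] h.
move: hI; rewrite IE abse_EFin lee_fin => hI.
have q0 : 0 < q by apply: lt_le_trans q1; rewrite divr_gt0.
have qX : `|q * normalized_sum n phi| <= e * q.
  rewrite -(subrK (fine I) (q * _)); apply: (le_trans (ler_normD _ _)).
  have wv : e / (16 * M) * v <= e / 4 * d.
    apply: (@le_trans _ _ (e / (16 * M) * (4 * d * M))); first by rewrite ler_pM2l.
    rewrite (_ : _ * _ = e / 4 * d)//; field; exact: lt0r_neq0.
  apply: (le_trans (lerD h (le_trans hI wv))).
  by nra.
by move: qX; rewrite normrM (gtr0_norm q0) mulrC ler_pM2r// sub0r normrN.
Qed.

End equidistribution.

Section averages.
Context {R : realType}.
Variable c : R.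
Hypothesis c1 : 1 < c.
Local Notation R3 := (R * R * R)%type.

Lemma sum_rescaled_csphere l (phi : R3 -> R) : (0 < l)%N ->
  \sum_(x \in rescaled_csphere c l) phi x = lattice_sum c l (l%:R `^ (- c^-1)) phi.
Proof.
move=> l0; have s0 : l%:R `^ (- c^-1) != 0 :> R.
  by rewrite gt_eqF// powR_gt0// ltr0n.
rewrite /rescaled_csphere fsbig_image; last first.
  move=> [[x y] z] [[x' y'] z'] _ _ /= [/(mulfI s0)/intr_inj -> /(mulfI s0)/intr_inj ->].
  by move=> /(mulfI s0)/intr_inj ->.
by rewrite fsbig_finite//; apply/finite_lattice_csphere/ltW.
Qed.

Lemma lattice_sum1 l (t : R) : lattice_sum c l t (fun=> 1) = (rcount c l)%:R.
Proof. by rewrite /lattice_sum big_const_seq count_predT iter_addr_0. Qed.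

Lemma lattice_sumB l (t V : R) (phi : R3 -> R) :
  lattice_sum c l t (fun x => phi x - V) = lattice_sum c l t phi - V * (rcount c l)%:R.
Proof.
rewrite /lattice_sum sumrB; congr (_ - _).
by rewrite big_const_seq count_predT iter_addr_0 mulr_natr.
Qed.

Variable mu : {measure set (space3 R) -> \bar R}.
Variable M : R.
Hypothesis (muM : mu (csphere c) = M%:E).

Lemma integrable_csphere (phi : R3 -> R) : continuous phi ->
  mu.-integrable (csphere c) (EFin \o phi).
Proof.
move=> cphi; apply: measurable_bounded_integrable.
- exact: (measurable_csphere c1).
- by rewrite muM ltry.
- by apply: measurable_funTS; exact: measurable_continuous3.
have [B [PB _]] := continuous_test_function cphi.
exists B; split; first exact: num_real.
move=> B' BB x /(csphereE c1) xS; apply: (le_trans (PB x _)); last exact: ltW.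
have c0 : 0 < c by exact: lt_trans c1.
have one (u : R) : `|u| `^ c <= 1 -> `|u| <= 5.
  move=> u1; apply: (@le_trans _ _ 1); last by rewrite ler1n.
  by rewrite -(ler_powRc c1)// powR1.
move: xS; rewrite /gauge => xS.
have p1 := powR_ge0 `|x.1.1| c; have p2 := powR_ge0 `|x.1.2| c; have p3 := powR_ge0 `|x.2| c.
by split; apply: one; lra.
Qed.

Lemma integral_csphere_normalized (phi : R3 -> R) : continuous phi ->
  exists2 W : R, (\int[mu]_(x in csphere c) (phi x)%:E = W%:E)%E &
    \int[csphere_normalized c mu]_(x in csphere c) phi x = M^-1 * W.
Proof.
move=> cphi; have iphi := integrable_csphere cphi.
have mS := measurable_csphere c1.
have mphi : measurable_fun (csphere c) (fun x : space3 R => (phi x)%:E).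
  by apply/measurable_EFinP/measurable_funTS; exact: measurable_continuous3.
exists (fine (\int[mu]_(x in csphere c) (phi x)%:E)%E).
  by rewrite fineK//; exact: integrable_fin_num iphi.
rewrite /Rintegral integralE !ge0_integral_mscale//=; last 2 first.
- exact: measurable_funeneg.
- exact: measurable_funepos.
have fp := integrable_pos_fin_num mS iphi.
have fn := integrable_neg_fin_num mS iphi.
rewrite -muleBr ?fin_num_adde_defr// -integralE fineM//; last first.
  exact: integrable_fin_num iphi.
by rewrite /= muM.
Qed.

End averages.

Theorem theorem1p8 (R : realType) (c : R) (hc1 : 1 < c) (hc2 : c < 9 / 8)
    (mu : {measure set (space3 R) -> \bar R}) (hmu : is_csphere_measure c mu) :
  let nu := csphere_normalized c mu in
  [/\ mu (csphere c) =
        (8 * Gamma c^-1 ^+ 3 / (c ^+ 2 * Gamma (3 / c)))%:E,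
      nu (csphere c) = 1%E
    & forall phi : R * R * R -> R, smooth phi ->
        (rcount c l)%:R^-1 * (\sum_(x \in rescaled_csphere c l) phi x)
          @[l --> \oo] --> \int[nu]_(x in csphere c) phi x].
Proof.
move=> nu; have [mE M0] := sphere_mass hc1 hmu.
split => //.
  transitivity (((fine (mu (csphere c)))^-1)%:E * mu (csphere c))%E; first by [].
  by rewrite mE -EFinM mulVf// gt_eqF.
move: mE M0; set M := 8 * _ / _ => mE M0 phi hphi.
have cphi : continuous phi := (hphi 0%N).1.
have [W WE ->] := integral_csphere_normalized hc1 mE cphi.
set V := M^-1 * W.
have cphi0 : continuous (fun x => phi x - V).
  by move=> x; apply: cvgB; [exact: cphi|exact: cvg_cst].
have phi0 : (\int[mu]_(x in csphere c) (phi x - V)%:E = 0)%E.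
  under eq_integral do rewrite EFinB.
  have mS := measurable_csphere hc1.
  rewrite integralB//; last 2 first.
  - exact: (integrable_csphere hc1 mE cphi).
  - by apply: (integrable_csphere hc1 mE) => x; exact: cvg_cst.
  by rewrite WE integral_cst// mE -EFinM -EFinB /V mulrAC mulVf ?gt_eqF// mul1r subrr.
have X0 := mean_zero_cvg hc1 hc2 hmu M0 mE cphi0 phi0.
have Y1 := normalized_count hc1 hc2 hmu M0 mE.
rewrite -(cvg_shiftS (fun l => (rcount c l)%:R^-1 * (\sum_(x \in rescaled_csphere c l) phi x))).
apply/cvgrPdist_le => e e0.
have eM : 0 < e * (M / 8) by rewrite mulr_gt0// divr_gt0.
near=> n.
have Yn : M / 8 <= normalized_sum c n (fun=> 1) by near: n; exact: Y1.
have Xn : `|normalized_sum c n (fun x => phi x - V)| <= e * (M / 8).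
  by rewrite -normrN -[- _]sub0r; near: n; move/cvgrPdist_le : X0 => /(_ _ eM).
move: Xn Yn; rewrite /normalized_sum lattice_sumB lattice_sum1 /= sum_rescaled_csphere//.
set k := n.+1%:R `^ (- c^-1) ^+ 3 * n.+1%:R; set S := lattice_sum _ _ _ _; set r := (rcount _ _)%:R => Xn Yn.
have k0 : 0 < k by rewrite mulr_gt0// exprn_gt0// powR_gt0.
have r0 : 0 < r by rewrite -(pmulr_rgt0 _ k0); apply: lt_le_trans Yn; rewrite divr_gt0.
rewrite (_ : V - _ = - (k * (S - V * r)) / (k * r)); last first.
  by field; rewrite !lt0r_neq0.
rewrite normrM normrN normfV (gtr0_norm (mulr_gt0 k0 r0)) ler_pdivrMr ?mulr_gt0//.
by apply: (le_trans Xn); rewrite ler_pM2l.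
Unshelve. all: by end_near. Qed.
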